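(* $\Delta_{\rm env}$-embedding of operator systems is a transitive relation: if $\mathcal{R},\mathcal{S},\mathcal{T}$ are operator systems such that $\mathcal{R}$ $\Delta_{\rm env}$-embeds in $\mathcal{S}$ and $\mathcal{S}$ $\Delta_{\rm env}$-embeds in $\mathcal{T}$, then $\mathcal{R}$ $\Delta_{\rm env}$-embeds in $\mathcal{T}$.
   Context: An operator system is a (not necessarily closed) selfadjoint subspace of some $\mathcal{B}(H)$ containing $I_H$. For an operator system $\mathcal{T}$, $\iota_{\rm env}:\mathcal{T}\to\mathrm{C}^*_{\rm env}(\mathcal{T})$ is the canonical embedding in the C*-envelope, and $\iota_{\rm env}^{**}:\mathcal{T}\to\mathrm{C}^*_{\rm env}(\mathcal{T})\hookrightarrow\mathrm{C}^*_{\rm env}(\mathcal{T})^{**}$ its composition with the inclusion in the double dual, a von Neumann algebra acting on the universal representation space of $\mathrm{C}^*_{\rm env}(\mathcal{T})$; commutants are taken there. For a projection $p$ commuting with $\iota_{\rm env}^{**}(\mathcal{T})$, $p[\iota_{\rm env}^{**}(\mathcal{T})]$ denotes the operator system $\{p\,\iota_{\rm env}^{**}(t):t\in\mathcal{T}\}$ acting on the range of $p$. $\mathcal{S}$ $\Delta_{\rm env}$-embeds in $\mathcal{T}$ if $\mathcal{S}$ is $\Delta$-equivalent to $p[\iota_{\rm env}^{**}(\mathcal{T})]$ for some projection $p\in\iota_{\rm env}^{**}(\mathcal{T})'$. Here $[\mathcal{V}]$ for a set of operators or products (as in $[\mathcal{M}^*\mathcal{M}]$) is norm-closed linear span. A TRO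 is a linear subspace $\mathcal{M}\subseteq\mathcal{B}(H,K)$ with $\mathcal{M}\mathcal{M}^*\mathcal{M}\subseteq\mathcal{M}$; it is non-degenerate if $I_H\in[\mathcal{M}^*\mathcal{M}]$ and $I_K\in[\mathcal{M}\mathcal{M}^*]$. Concrete operator systems $\mathcal{S}\subseteq\mathcal{B}(H)$, $\mathcal{T}\subseteq\mathcal{B}(K)$ are TRO-equivalent if there is a non-degenerate TRO $\mathcal{M}\subseteq\mathcal{B}(H,K)$ with $\mathcal{M}^*\mathcal{T}\mathcal{M}\subseteq\overline{\mathcal{S}}$ and $\mathcal{M}\mathcal{S}\mathcal{M}^*\subseteq\overline{\mathcal{T}}$. Operator systems are $\Delta$-equivalent if they have unital complete order embeddings with TRO-equivalent images. *)

(* Defs.v *)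
From HB Require Import structures.
From mathcomp Require Import all_boot all_order all_algebra.
From mathcomp Require Import sesquilinear.
From mathcomp Require Import complex.
From mathcomp Require Import all_classical all_reals topology normedtype.

Set Implicit Arguments.
Unset Strict Implicit.
Unset Printing Implicit Defensive.

Import Order.TTheory GRing.Theory Num.Theory.
Import numFieldNormedType.Exports.

Local Open Scope classical_set_scope.
Local Open Scope ring_scope.
Local Open Scope complex_scope.

(* Complex Hilbert spaces; the inner product is linear in its first argument. *)
HB.mixin Record CompleteNormedModule_isHilbert (R : realType) (H : Type)
    & CompleteNormedModule R[i] H := {
  inner : {dot H for Num.conj};
  inner_norm : forall x : H, inner x x = `|x| ^+ 2
}.

#[short(type="hilbertType")]
HB.structure Definition Hilbert (R : realType) :=
  {H of CompleteNormedModule R[i] H & CompleteNormedModule_isHilbert R H}.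

Notation "''[' x , y ]" := (inner x y) : ring_scope.

Section Operators.
Context {R : realType}.
Implicit Types H K L : hilbertType R.

Definition bounded_op H K : set (H -> K) := [set f | linear f /\ continuous f].

(* The adjoint of a bounded operator, i.e. the unique operator with
   this property; the default value 0 is never reached on bounded operators. *)
Definition adj H K (f : H -> K) : K -> H :=
  xget 0 [set g : K -> H | forall x y, '[f x, y] = '[x, g y]].

Definition subspace (V : lmodType R[i]) (X : set V) : Prop :=
  X 0 /\ forall (a : R[i]) x y, X x -> X y -> X (a *: x + y).

Definition lin_span (V : lmodType R[i]) : set V -> set V := smallest (@subspace V).

(* closure in the operator norm *)
Definition op_closure H K (X : set (H -> K)) : set (H -> K) :=
  [set f | bounded_op f /\ forall e : R[i], 0 < e ->
     exists2 g, X g & forall x, `|f x - g x| <= e * `|x|].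

End Operators.

Section Projections.
Context {R : realType}.

Record projection (H : hilbertType R) := Projection {
  proj_fun :> {linear H -> H};
  proj_continuous : continuous proj_fun;
  proj_idem : forall x, proj_fun (proj_fun x) = proj_fun x;
  proj_selfadj : forall x y, '[proj_fun x, y] = '[x, proj_fun y] }.

End Projections.

Section ProjectionRange.
Context {R : realType} {H : hilbertType R} (p : projection H).

Definition prange_pred : {pred H} := [pred x | p x == x].

Lemma prange_submod : submod_closed prange_pred.
Proof.
split; first by rewrite inE linear0.
by move=> a x y; rewrite !inE => /eqP px /eqP py; rewrite linearP px py.
Qed.

HB.instance Definition _ :=
  GRing.isSubmodClosed.Build R[i] H prange_pred prange_submod.

Record prange := PRange { prange_val :> H; prange_valP : prange_val \in prange_pred }.

HB.instance Definition _ := [isSub for prange_val].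
HB.instance Definition _ := [Choice of prange by <:].
HB.instance Definition _ := [SubChoice_isSubLmodule of prange by <:].

Lemma prange_ler_normD (x y : prange) : `|val (x + y)| <= `|val x| + `|val y|.
Proof. by rewrite raddfD ler_normD. Qed.

Lemma prange_normrZ (l : R[i]) (x : prange) : `|val (l *: x)| = `|l| * `|val x|.
Proof. by rewrite linearZ normrZ. Qed.

Lemma prange_normr0_eq0 (x : prange) : `|val x| = 0 -> x = 0.
Proof. by move=> /normr0_eq0 x0; apply: val_inj; rewrite x0 raddf0. Qed.

HB.instance Definition _ := Lmodule_isNormed.Build R[i] prange
  prange_ler_normD prange_normrZ prange_normr0_eq0.

Lemma prange_normE (x : prange) : `|x| = `|val x|.
Proof. by []. Qed.

Lemma pproj_subproof (x : H) : p x \in prange_pred.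
Proof. by rewrite inE proj_idem. Qed.

Definition pproj (x : H) : prange := PRange (pproj_subproof x).

Lemma pprojK (x : prange) : pproj (val x) = x.
Proof. by apply: val_inj; apply/eqP; exact: (valP x). Qed.

Lemma prange_complete (F : set_system prange) :
  ProperFilter F -> cauchy F -> cvg F.
Proof.
move=> FF /cauchyP Fc.
have Gc : cauchy (val @ F).
  apply/cauchyP => e e0; have [x Fx] := Fc e e0.
  exists (val x); change (F (val @^-1` ball (val x) e)).
  apply: filterS Fx => y.
  have E : `|x - y| = `|val x - val y| by rewrite prange_normE raddfB.
  by rewrite -!ball_normE; change (`|x - y| < e -> `|val x - val y| < e); rewrite E.
have /cvg_ex [l Gl] : cvg (val @ F) by exact: cauchy_cvg.
have lp : val (pproj l) = l.
  have pl : (p \o val) x @[x --> F] --> p l.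
    by apply: continuous_cvg => //; exact: proj_continuous.
  have pval : (p \o val : prange -> H) = val.
    by apply/funext => x; exact/eqP/(valP x).
  rewrite pval in pl.
  exact: (cvg_unique _ pl Gl).
apply/cvg_ex; exists (pproj l).
apply/cvgrPdist_lt => e e0.
have : \forall x \near F, `|l - val x| < e by move/cvgrPdist_lt: Gl; apply.
apply: filterS => x; suff -> : `|pproj l - x| = `|l - val x| by [].
by rewrite prange_normE raddfB; congr `|_ - _|.
Qed.

HB.instance Definition _ := Uniform_isComplete.Build prange prange_complete.

Definition prange_inner (x y : prange) : R[i] := '[val x, val y].


Lemma prange_inner_bilinear :
  bilinear_for *%R (Num.conj \; *%R) prange_inner.
Proof.
split=> u a x y; rewrite /prange_inner.
  by rewrite [val (_ + _)]linearP linearPl.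
rewrite [val (_ + _)]linearP. by rewrite linearD linearZ.
Qed.

HB.instance Definition _ := bilinear_isBilinear.Build R[i] prange prange R[i]
  *%R (Num.conj \; *%R) prange_inner prange_inner_bilinear.

Lemma prange_inner_hermitian (x y : prange) :
  prange_inner x y = (-1) ^+ false * Num.conj (prange_inner y x).
Proof. exact: hermitian_subproof. Qed.

HB.instance Definition _ := isHermitianSesquilinear.Build R[i] prange false
  Num.conj prange_inner prange_inner_hermitian.

Lemma prange_inner_gt0 (x : prange) : x != 0 -> 0 < prange_inner x x.
Proof.
move=> x0; apply: neq0_dnorm_gt0; apply: contra x0 => /eqP x0.
by apply/eqP/val_inj; rewrite x0 raddf0.
Qed.

HB.instance Definition _ := isDotProduct.Build R[i] prange prange_inner
  prange_inner_gt0.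

Lemma prange_inner_norm (x : prange) : prange_inner x x = `|x| ^+ 2.
Proof. exact: inner_norm. Qed.

HB.instance Definition _ := CompleteNormedModule_isHilbert.Build R prange
  prange_inner_norm.

End ProjectionRange.

Section OperatorSystems.
Context {R : realType}.
Implicit Types H K L U : hilbertType R.

Definition operator_system H (S : set (H -> H)) : Prop :=
  [/\ S `<=` @bounded_op R H H, subspace S, S idfun &
      forall f, S f -> S (adj f)].

Definition linear_on H K (S : set (H -> H)) (phi : (H -> H) -> (K -> K)) : Prop :=
  forall (a : R[i]) f g, S f -> S g -> phi (a *: f + g) = a *: phi f + phi g.

(* positivity of a matrix of operators on H, as an operator on H^n *)
Definition mx_pos H n (A : 'M[H -> H]_n) : Prop :=
  forall x : 'I_n -> H, 0 <= \sum_i \sum_j '[A i j (x j), x i].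

(* unital complete order embedding of S in B(K); only the values of phi on S
   matter *)
Definition ucoe H K (S : set (H -> H)) (phi : (H -> H) -> (K -> K)) : Prop :=
  [/\ forall f, S f -> bounded_op (phi f), linear_on S phi, phi idfun = idfun &
      forall n (A : 'M[H -> H]_n), (forall i j, S (A i j)) ->
        (mx_pos (map_mx phi A) <-> mx_pos A)].

Definition tro H K (M : set (H -> K)) : Prop :=
  [/\ M `<=` @bounded_op R H K, subspace M &
      forall a b c, M a -> M b -> M c -> M (a \o adj b \o c)].

Definition tro_nondegenerate H K (M : set (H -> K)) : Prop :=
  op_closure (lin_span [set adj a \o b | a in M & b in M]) idfun /\
  op_closure (lin_span [set a \o adj b | a in M & b in M]) idfun.

Definition tro_equivalent H K (S : set (H -> H)) (T : set (K -> K)) : Prop :=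
  exists M : set (H -> K), [/\ tro M, tro_nondegenerate M,
    forall a t b, M a -> T t -> M b -> op_closure S (adj a \o t \o b) &
    forall a s b, M a -> S s -> M b -> op_closure T (a \o s \o adj b)].

Definition delta_equivalent H K (S : set (H -> H)) (T : set (K -> K)) : Prop :=
  exists (H' K' : hilbertType R)
    (phi : (H -> H) -> (H' -> H')) (psi : (K -> K) -> (K' -> K')),
    [/\ ucoe S phi, ucoe T psi & tro_equivalent (phi @` S) (psi @` T)].

Definition unital_cstar_subalgebra H (A : set (H -> H)) : Prop :=
  [/\ operator_system A, forall f g, A f -> A g -> A (f \o g) &
      op_closure A `<=` A].

Definition cstar_generated H : set (H -> H) -> set (H -> H) :=
  smallest (@unital_cstar_subalgebra H).

Definition unital_star_hom H K (A : set (H -> H)) (pi : (H -> H) -> (K -> K)) :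
    Prop :=
  [/\ forall f, A f -> bounded_op (pi f), linear_on A pi, pi idfun = idfun,
      forall f g, A f -> A g -> pi (f \o g) = pi f \o pi g &
      forall f, A f -> pi (adj f) = adj (pi f)].

(* The C*-envelope of T is the C*-algebra generated by iota(T), where iota is
   a unital complete order embedding and every other unital C*-cover of T maps
   onto it compatibly with the embeddings of T. It is unique up to a
   *-isomorphism fixing T, and is taken faithfully represented on L. *)
Definition cstar_envelope H L (T : set (H -> H))
    (iota : (H -> H) -> (L -> L)) : Prop :=
  ucoe T iota /\
  forall (K : hilbertType R) (phi : (H -> H) -> (K -> K)), ucoe T phi ->
    exists pi : (K -> K) -> (L -> L),
      [/\ unital_star_hom (cstar_generated (phi @` T)) pi,
          pi @` cstar_generated (phi @` T) = cstar_generated (iota @` T) &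
          forall t, T t -> pi (phi t) = iota t].

Definition state H (A : set (H -> H)) (f : (H -> H) -> R[i]) : Prop :=
  [/\ forall (c : R[i]) a b, A a -> A b -> f (c *: a + b) = c * f a + f b,
      forall a, A a -> 0 <= f (adj a \o a) & f idfun = 1].

(* sigma : A -> B(U) is the universal representation of A, i.e. the direct sum
   of the GNS representations of all the states of A: Xi consists of one cyclic
   vector for each state (states being identified when they agree on A), the
   cyclic subspaces [sigma(A) xi], for xi in Xi, are mutually orthogonal, and
   they span a dense subspace of U. This determines (U, sigma) up to unitary
   equivalence; the bicommutant of sigma(A) in B(U) is the double dual of A,
   the inclusion of A in it being sigma. *)
Definition universal_rep H U (A : set (H -> H))
    (sigma : (H -> H) -> (U -> U)) : Prop :=
  unital_star_hom A sigma /\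
  exists Xi : set U,
    [/\ forall xi, Xi xi -> state A (fun a => '[sigma a xi, xi]),
        forall f, state A f -> exists! xi, Xi xi /\
          forall a, A a -> f a = '[sigma a xi, xi],
        forall xi eta, Xi xi -> Xi eta -> xi <> eta ->
          forall a b, A a -> A b -> '[sigma a xi, sigma b eta] = 0 &
        closure (lin_span [set sigma a xi | a in A & xi in Xi]) = setT].

Definition commutant H (W : set (H -> H)) : set (H -> H) :=
  [set f | bounded_op f /\ forall w, W w -> f \o w = w \o f].

(* p[W] : the operators p w, for w in W, acting on the range of p *)
Definition compression H (p : projection H) (W : set (H -> H)) :
    set (prange p -> prange p) :=
  [set (fun x : prange p => pproj p (w (val x))) | w in W].

Arguments compression {H} p W.

Definition delta_env_embeds H K (S : set (H -> H)) (T : set (K -> K)) : Prop :=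
  exists (L U : hilbertType R)
    (iota : (K -> K) -> (L -> L)) (sigma : (L -> L) -> (U -> U)),
    [/\ cstar_envelope T iota, universal_rep (cstar_generated (iota @` T)) sigma &
      let iota2 := sigma \o iota in
      exists p : projection U,
        commutant (iota2 @` T) p /\
        delta_equivalent S (compression p (iota2 @` T))].

End OperatorSystems.

(* Main.v *)
(* Fix a unital complete order embedding iota of T with C*_env(T) the C*-algebra of
   iota(T).  First, S Delta_env-embeds in T as soon as S is Delta-equivalent to
   rho(iota(T)) for some unital *-homomorphism rho of C*_env(T): the span of the cyclic
   subspaces of the universal representation sigma whose states are vector states of rho
   is the range of a projection p commuting with sigma, and p sigma and rho induce the same
   matrix order.
   Second, if S is Delta-equivalent to X, then phi(S) and tau(X) are TRO-equivalent (written
   ~) for some complete order embedding phi of S and some *-homomorphism tau of C*(X): given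
   another complete order embedding psi of X, dilating alternately along the identity and psi
   and passing to the limit gives one complete order embedding of X that extends to
   *-homomorphisms of both C*(X) and C*(psi(X)), and *-homomorphisms can be carried across a
   TRO by Rieffel induction.
   Now let S2 and S1 be Delta-equivalent to rho2(iota2(S3)) and rho1(iota1(S2)); this gives
   phi2(S2) ~ tau2(rho2(iota2(S3))) and phi1(S1) ~ tau1(rho1(iota1(S2))).  The universal property of the
   envelope gives pi from C*(phi2(S2)) onto C*_env(S2), and inducing tau1 rho1 pi across the
   first relation shows tau1(rho1(iota1(S2))) ~ theta(tau2(rho2(iota2(S3)))).  TRO-equivalence
   is transitive, so phi1(S1) is TRO-equivalent to the image of iota2(S3) under a
   *-homomorphism of C*_env(S3). *)

Require Import Defs.
From HB Require Import structures.
From mathcomp Require Import all_boot all_order all_algebra sesquilinear.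
From mathcomp Require Import complex lra ring.
From mathcomp Require Import all_classical all_reals topology normedtype sequences.
Set Implicit Arguments.
Unset Strict Implicit.
Unset Printing Implicit Defensive.
Import Order.TTheory GRing.Theory Num.Theory.
Import numFieldNormedType.Exports.
Import Defs.
Local Open Scope classical_set_scope.
Local Open Scope ring_scope.
Local Open Scope complex_scope.

(** The two embeddings in a Delta-equivalence need not extend to the generated C*-algebras, whereas
    what can be induced across a TRO is a homomorphism of such an algebra; the common cover bridges
    this gap. Its dilations are Stinespring spaces of a functional on formal sums in B(H) (x) K (x)
    K, found by M. Riesz extension: the unit of the operator system makes the system cofinal for the
    cone of positive kernels. Compressions to increasing stages converge strongly, so the two
    alternating subsequences have one limit. A TRO M relating P and Q need not be a module over the
    algebras generated by P and Q; induction therefore runs on a larger bimodule of operators. For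
    the same reason a product of two TROs has to be filled up with words between its factors. The
    homomorphisms involved may have kernels. They are compared only through the order on matrices,
    read as nonnegativity of real parts of forms; for matrices over a represented algebra it
    suffices to test families b_i z coming from one vector z, which ties the order to vector
    states. *)

Notation Re := complex.Re.
Notation Im := complex.Im.

(** Inequalities are proved in [R]: [rc], [cabs], [nm] and [Re] carry norms and positivity from
    [R[i]] to [R], so that [lra] and [nra] apply. *)
Definition rc {R : realType} (r : R) : R[i] := r +i* 0.
Notation "x %:rc" := (rc x) : ring_scope.
Definition cj {R : realType} (z : R[i]) : R[i] := Re z -i* Im z.

(** * Complex scalars *)

Section Scalars.
Context {R : realType}.
Implicit Types (z w : R[i]) (r s : R).

Definition cabs z : R := Re `|z|.

Lemma rcD r s : (r + s)%:rc = r%:rc + s%:rc :> R[i].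
Proof. by rewrite /rc; simpc. Qed.
Lemma rcN r : (- r)%:rc = - r%:rc :> R[i].
Proof. by rewrite /rc; simpc. Qed.
Lemma rcB r s : (r - s)%:rc = r%:rc - s%:rc :> R[i].
Proof. by rewrite rcD rcN. Qed.
Lemma rcM r s : (r * s)%:rc = r%:rc * s%:rc :> R[i].
Proof. by rewrite /rc; simpc. Qed.
Lemma rcX r n : (r ^+ n)%:rc = r%:rc ^+ n :> R[i].
Proof. by elim: n => [//|n IH]; rewrite !exprS rcM IH. Qed.
Lemma rc0 : (0 : R)%:rc = 0 :> R[i]. Proof. by []. Qed.
Lemma rc1 : (1 : R)%:rc = 1 :> R[i]. Proof. by []. Qed.
Lemma rc_inj : injective (@rc R). Proof. by move=> r s []. Qed.
Lemma rc_le r s : (r%:rc <= s%:rc) = (r <= s). Proof. exact: lecR. Qed.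
Lemma rc_lt r s : (r%:rc < s%:rc) = (r < s). Proof. exact: ltcR. Qed.
Lemma rc_ge0 r : (0 <= r%:rc) = (0 <= r). Proof. exact: ler0c. Qed.

Lemma cabsE z : `|z| = (cabs z)%:rc.
Proof. by rewrite /cabs normc_def. Qed.

Lemma cabs_ge0 z : 0 <= cabs z.
Proof. by rewrite /cabs normc_def /= sqrtr_ge0. Qed.

Lemma cabs_sqr z : cabs z ^+ 2 = Re z ^+ 2 + Im z ^+ 2.
Proof. by rewrite /cabs normc_def /= sqr_sqrtr // addr_ge0 ?sqr_ge0. Qed.

Lemma cabsM z w : cabs (z * w) = cabs z * cabs w.
Proof. by apply: rc_inj; rewrite rcM -!cabsE normrM. Qed.

Lemma cabsD z w : cabs (z + w) <= cabs z + cabs w.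
Proof. by rewrite -rc_le rcD -!cabsE ler_normD. Qed.

Lemma cabsN z : cabs (- z) = cabs z.
Proof. by rewrite /cabs normrN. Qed.

Lemma cjE z : cj z = conjc z. Proof. by case: z. Qed.
Lemma cjK z : cj (cj z) = z. Proof. by case: z => a b; rewrite /cj /= opprK. Qed.
Lemma cjD z w : cj (z + w) = cj z + cj w. Proof. by rewrite !cjE rmorphD. Qed.
Lemma cjN z : cj (- z) = - cj z. Proof. by rewrite !cjE rmorphN. Qed.
Lemma cjM z w : cj (z * w) = cj z * cj w. Proof. by rewrite !cjE rmorphM. Qed.
Lemma cj_rc r : cj r%:rc = r%:rc. Proof. by rewrite /cj /rc /= oppr0. Qed.
Lemma cj0 : cj 0 = 0 :> R[i]. Proof. exact: cj_rc. Qed.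
Lemma cj1 : cj 1 = 1 :> R[i]. Proof. exact: cj_rc. Qed.
Lemma cj_sum I (r : seq I) (F : I -> R[i]) :
  cj (\sum_(i <- r) F i) = \sum_(i <- r) cj (F i).
Proof. exact: (big_morph cj cjD cj0). Qed.
Lemma cabsC z : cabs (cj z) = cabs z.
Proof. by rewrite cjE /cabs normcJ. Qed.

Lemma cabs0 : cabs 0 = 0. Proof. by rewrite /cabs normr0. Qed.
Lemma cabs1 : cabs 1 = 1. Proof. by rewrite /cabs normr1. Qed.

Lemma cabs_eq0 z : cabs z = 0 -> z = 0.
Proof. by move=> z0; apply: normr0_eq0; rewrite cabsE z0. Qed.

Lemma cabs_real r : cabs r%:rc = `|r|.
Proof. by rewrite /cabs normc_def /= expr0n addr0 sqrtr_sqr. Qed.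

Lemma Re_le_cabs z : Re z <= cabs z.
Proof.
have := cabs_sqr z; have := cabs_ge0 z; have := sqr_ge0 (Im z).
by move=> ? ? ?; nra.
Qed.

Lemma Re_geN_cabs z : - cabs z <= Re z.
Proof. by have := Re_le_cabs (- z); rewrite cabsN; case: z => a b /=; lra. Qed.

Lemma ReD z w : Re (z + w) = Re z + Re w. Proof. by case: z; case: w. Qed.
Lemma ImD z w : Im (z + w) = Im z + Im w. Proof. by case: z; case: w. Qed.
Lemma ReN z : Re (- z) = - Re z. Proof. by case: z. Qed.
Lemma ImN z : Im (- z) = - Im z. Proof. by case: z. Qed.
Lemma ReC z : Re (cj z) = Re z. Proof. by case: z. Qed.
Lemma ImC z : Im (cj z) = - Im z. Proof. by case: z. Qed.
Lemma ReZ r z : Re (r%:rc * z) = r * Re z.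
Proof. by case: z => a b /=; rewrite mul0r subr0. Qed.
Lemma ImZ r z : Im (r%:rc * z) = r * Im z.
Proof. by case: z => a b /=; rewrite mul0r addr0. Qed.
Lemma ReiM z : Re ('i * z) = - Im z.
Proof. by case: z => a b /=; rewrite mul0r mul1r sub0r. Qed.
Lemma Re_sum I (r : seq I) (P : pred I) (F : I -> R[i]) :
  Re (\sum_(i <- r | P i) F i) = \sum_(i <- r | P i) Re (F i).
Proof. by apply: (big_morph (@Re R)) => // x y; rewrite ReD. Qed.

Lemma cplx_ext z w : Re z = Re w -> Im z = Im w -> z = w.
Proof. by case: z; case: w => a b c d /= -> ->. Qed.

Lemma mul_conjc z : z * cj z = (cabs z ^+ 2)%:rc.
Proof. by rewrite cjE -sqr_normc cabsE rcX. Qed.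

Lemma cabs_sum I (r : seq I) (F : I -> R[i]) :
  cabs (\sum_(i <- r) F i) <= \sum_(i <- r) cabs (F i).
Proof.
elim/big_ind2 : _ => //; first by rewrite cabs0.
by move=> a b c d ab cd; apply: (le_trans (cabsD _ _)); apply: lerD.
Qed.

Lemma rc_two : (2 : R[i]) = 2%:rc.
Proof. by rewrite -[2]natr1 rcD. Qed.
Lemma rc_half : (2^-1 : R[i]) = (2^-1)%:rc.
Proof.
apply: (@mulfI _ 2); first by rewrite pnatr_eq0.
by rewrite mulfV ?pnatr_eq0 // rc_two -rcM mulfV // pnatr_eq0.
Qed.
Lemma cj_i : cj 'i = - 'i :> R[i].
Proof. by rewrite cjE; apply: cplx_ext; rewrite /= ?oppr0. Qed.
Lemma cabs_i : cabs ('i : R[i]) = 1.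
Proof. by apply/eqP; rewrite -(@eqrXn2 _ 2) ?cabs_ge0 // cabs_sqr /= expr0n add0r. Qed.
Lemma i_neq0 : ('i : R[i]) != 0.
Proof. by rewrite eq_complex /= oner_eq0 andbF. Qed.

(* Discriminant form of the Cauchy-Schwarz inequality. *)
Lemma cauchy_schwarz_scalar (A B : R) (b : R[i]) : 0 <= B ->
  (forall c : R[i], 0 <= A + 2 * Re (c * b) + cabs c ^+ 2 * B) ->
  cabs b ^+ 2 <= A * B.
Proof.
move=> B0 H.
have H' (t : R) : 0 <= A - 2 * t * cabs b ^+ 2 + t ^+ 2 * cabs b ^+ 2 * B.
  (* For [c = - t * cj b] the product [c * b] is the real number [- t * cabs b ^+ 2], which leaves a
     real quadratic in [t]. *)
  have := H ((- t)%:rc * cj b); rewrite -mulrA [cj _ * _]mulrC mul_conjc ReZ /=.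
  by rewrite cabsM cabsC cabs_real exprMn real_normK ?num_real // sqrrN; lra.
have s0 : 0 <= cabs b ^+ 2 by apply: sqr_ge0.
set s := cabs b ^+ 2 in H' s0 *.
move: B0; rewrite le_eqVlt => /orP[/eqP B0|B0]; last first.
  have := H' B^-1; rewrite expr2.
  have -> : A - 2 * B^-1 * s + B^-1 * B^-1 * s * B = A - B^-1 * s.
    by field; rewrite gt_eqF.
  by rewrite subr_ge0 mulrC ler_pdivrMr.
rewrite -B0 mulr0 leNgt; apply/negP => sp.
(* For [B = 0] the polynomial is affine in [t] with slope [- 2 * s]; at this [t] its value is -1. *)
have := H' ((A + 1) / (2 * s)); rewrite -B0 mulr0 addr0.
have -> : A - 2 * ((A + 1) / (2 * s)) * s = -1.
  by field; rewrite gt_eqF.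
by lra.
Qed.

End Scalars.

Section Tends.
Context {R : realType}.
Implicit Types u v : nat -> R.

(** One-sided: convergence is expressed by applying it to norms of differences, so an upper bound
    suffices and comparison asks for no signs. *)
Definition tends0 u := forall e : R, 0 < e ->
  exists N, forall n, (N <= n)%N -> u n <= e.

Lemma tends0D u v : tends0 u -> tends0 v -> tends0 (fun n => u n + v n).
Proof.
move=> hu hv e e0; have e2 : 0 < e / 2 by lra.
have [N HN] := hu _ e2; have [M HM] := hv _ e2.
exists (maxn N M) => n; rewrite geq_max => /andP[/HN ? /HM ?]; lra.
Qed.

Lemma tends0_le u v : tends0 v -> (forall n, u n <= v n) -> tends0 u.
Proof.
move=> hv uv e e0; have [N HN] := hv _ e0.
by exists N => n /HN; apply: le_trans.
Qed.

Lemma tends0Z c u : 0 <= c -> tends0 u -> tends0 (fun n => c * u n).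
Proof.
move=> c0 hu e e0; have c1 : 0 < c + 1 by lra.
have [N HN] := hu (e / (c + 1)) (divr_gt0 e0 c1).
exists N => n /HN un; apply: (@le_trans _ _ (c * (e / (c + 1)))).
  by rewrite ler_wpM2l.
by rewrite mulrA ler_pdivrMr // mulrC ler_wpM2l; lra.
Qed.

Lemma tends0_sqr u : (forall n, 0 <= u n) -> tends0 (fun n => u n ^+ 2) -> tends0 u.
Proof.
move=> u0 hu e e0; have [N HN] := hu (e ^+ 2) (exprn_gt0 _ e0).
exists N => n /HN; rewrite ler_sqr ?nnegrE //; exact: ltW.
Qed.

Lemma tends0_inv : tends0 (fun n => n.+1%:R^-1).
Proof.
move=> e e0; exists (Num.truncn e^-1) => n Nn.
rewrite -[leRHS]invrK lef_pV2 ?posrE ?invr_gt0 ?ltr0n //.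
have := truncnS_gt e^-1 => /ltW/le_trans; apply.
by rewrite ler_nat ltnS.
Qed.

Lemma tends0_const_le c u : tends0 u -> (forall n, c <= u n) -> c <= 0.
Proof.
move=> hu cu; rewrite leNgt; apply/negP => c0.
have [N /(_ N (leqnn _))] := hu (c / 2) (divr_gt0 c0 (ltr0Sn _ _)).
by have := cu N; lra.
Qed.

End Tends.

(** * Hilbert spaces *)

Section HilbertBasics.
Context {R : realType}.
Implicit Types H K : hilbertType R.

Section Inner.
Variable H : hilbertType R.
Implicit Types (x y z : H) (a : R[i]).

Lemma innerDl x y z : '[x + y, z] = '[x, z] + '[y, z].
Proof. exact: linearDl. Qed.
Lemma innerDr x y z : '[x, y + z] = '[x, y] + '[x, z].
Proof. exact: linearDr. Qed.
Lemma innerZl a x y : '[a *: x, y] = a * '[x, y].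
Proof. exact: linearZl_LR. Qed.
Lemma innerZr a x y : '[x, a *: y] = cj a * '[x, y].
Proof. by rewrite cjE; exact: linearZr_LR. Qed.
Lemma innerNl x y : '[- x, y] = - '[x, y].
Proof. exact: linearNl. Qed.
Lemma innerNr x y : '[x, - y] = - '[x, y].
Proof. exact: linearNr. Qed.
Lemma innerBl x y z : '[x - y, z] = '[x, z] - '[y, z].
Proof. by rewrite innerDl innerNl. Qed.
Lemma innerBr x y z : '[x, y - z] = '[x, y] - '[x, z].
Proof. by rewrite innerDr innerNr. Qed.
Lemma inner0l x : '[0, x] = 0. Proof. exact: linear0l. Qed.
Lemma inner0r x : '[x, 0] = 0. Proof. exact: linear0r. Qed.
Lemma innerC x y : '[y, x] = cj '[x, y].
Proof. by rewrite (hermC (eps:=false)) expr0 mul1r cjE. Qed.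
Lemma inner_suml I (r : seq I) (F : I -> H) y :
  '[\sum_(i <- r) F i, y] = \sum_(i <- r) '[F i, y].
Proof.
elim/big_ind2 : _ => //; first exact: inner0l.
by move=> u v u' v' <- <-; rewrite innerDl.
Qed.
Lemma inner_sumr I (r : seq I) (F : I -> H) y :
  '[y, \sum_(i <- r) F i] = \sum_(i <- r) '[y, F i].
Proof.
elim/big_ind2 : _ => //; first exact: inner0r.
by move=> u v u' v' <- <-; rewrite innerDr.
Qed.

Definition nm x : R := Re `|x|.

Lemma nmE x : `|x| = (nm x)%:rc.
Proof.
have := normr_ge0 x; rewrite lecE /nm => /andP[/eqP bE _].
exact: cplx_ext.
Qed.

Lemma nm_ge0 x : 0 <= nm x.
Proof. by rewrite -rc_ge0 -nmE. Qed.

Lemma inner_nm x : '[x, x] = (nm x ^+ 2)%:rc.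
Proof. by rewrite inner_norm nmE rcX. Qed.

Lemma Re_inner_nm x : Re '[x, x] = nm x ^+ 2.
Proof. by rewrite inner_nm. Qed.

Lemma nm0 : nm (0 : H) = 0. Proof. by rewrite /nm normr0. Qed.
Lemma nm_eq0 x : nm x = 0 -> x = 0.
Proof. by move=> x0; apply: normr0_eq0; rewrite nmE x0. Qed.
Lemma nmN x : nm (- x) = nm x. Proof. by rewrite /nm normrN. Qed.
Lemma nmZ a x : nm (a *: x) = cabs a * nm x.
Proof. by apply: rc_inj; rewrite rcM -!nmE -cabsE normrZ. Qed.
Lemma nmD x y : nm (x + y) <= nm x + nm y.
Proof. by rewrite -rc_le rcD -!nmE ler_normD. Qed.
Lemma nmB x y : nm (x - y) = nm (y - x).
Proof. by rewrite -nmN opprB. Qed.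
Lemma nm_tri z x y : nm (x - y) <= nm (x - z) + nm (z - y).
Proof. by apply: le_trans (nmD _ _); rewrite addrA subrK. Qed.
Lemma nm_leD x y : nm x <= nm (x - y) + nm y.
Proof. by apply: le_trans (nmD _ _); rewrite subrK. Qed.

Lemma nm_sqrD x y : nm (x + y) ^+ 2 = nm x ^+ 2 + 2 * Re '[x, y] + nm y ^+ 2.
Proof.
rewrite -!Re_inner_nm innerDl !innerDr !ReD (innerC x y) ReC; lra.
Qed.

Lemma nm_sqrB x y : nm (x - y) ^+ 2 = nm x ^+ 2 - 2 * Re '[x, y] + nm y ^+ 2.
Proof. by rewrite nm_sqrD nmN innerNr ReN; lra. Qed.

Lemma cauchy_schwarz x y : cabs '[x, y] <= nm x * nm y.
Proof.
rewrite -ler_sqr ?nnegrE ?cabs_ge0 ?mulr_ge0 ?nm_ge0 // exprMn [leRHS]mulrC.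
apply: cauchy_schwarz_scalar; first exact: sqr_ge0.
move=> c; have := sqr_ge0 (nm (y + c *: x)).
rewrite nm_sqrD innerZr (innerC x y) nmZ exprMn.
by rewrite -cjM ReC.
Qed.

Lemma Re_inner_le x y : Re '[x, y] <= nm x * nm y.
Proof. exact: le_trans (Re_le_cabs _) (cauchy_schwarz _ _). Qed.

Lemma parallelogram x y :
  nm (x + y) ^+ 2 + nm (x - y) ^+ 2 = 2 * nm x ^+ 2 + 2 * nm y ^+ 2.
Proof. by rewrite nm_sqrD nm_sqrB; lra. Qed.

Lemma inner_extl x y : (forall z, '[x, z] = '[y, z]) -> x = y.
Proof.
move=> E; apply/eqP; rewrite -subr_eq0; apply/eqP/nm_eq0/eqP.
by rewrite -sqrf_eq0 -Re_inner_nm innerBl E subrr.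
Qed.

Lemma inner_extr x y : (forall z, '[z, x] = '[z, y]) -> x = y.
Proof. by move=> E; apply: inner_extl => z; rewrite innerC E -innerC. Qed.

Definition cvgs (u : nat -> H) (l : H) := tends0 (fun n => nm (u n - l)).

Lemma cauchy_cvgs (u : nat -> H) :
  (forall e : R, 0 < e -> exists N, forall n m, (N <= n)%N -> (N <= m)%N ->
     nm (u n - u m) <= e) -> exists l, cvgs u l.
Proof.
move=> Cu.
have /cauchy_cvgP/cvg_ex[l ul] : cauchy (u @ \oo).
  apply/cauchyP => e /[dup] e0; rewrite ltcE => /andP[/eqP Ime Ree].
  have ree : e = (Re e)%:rc by apply: cplx_ext.
  have [|N HN] := Cu (Re e / 2); first by apply: divr_gt0.
  exists (u N); exists N => // n /= Nn; rewrite -ball_normE /= nmE ree rc_lt.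
  apply: (@le_lt_trans _ _ (Re e / 2)); first exact: HN.
  by rewrite ltr_pdivrMr // ltr_pMr // ltr1n.
exists l => e e0.
have : \forall n \near \oo, `|l - u n| < e%:rc.
  by move/cvgrPdist_lt: ul; apply; rewrite -rc0 rc_lt.
case=> N _ HN; exists N => n Nn; rewrite nmB -rc_le -nmE; apply: ltW.
exact: HN.
Qed.

Lemma cvgs_uniq (u : nat -> H) l l' : cvgs u l -> cvgs u l' -> l = l'.
Proof.
move=> h h'; apply/eqP; rewrite -subr_eq0; apply/eqP/nm_eq0/eqP.
rewrite eq_le nm_ge0 andbT; apply: tends0_const_le (tends0D h h') _ => n.
by rewrite (nmB (u n)); exact: nm_tri.
Qed.

Definition sclosed (E : set H) :=
  forall x, (forall e : R, 0 < e -> exists2 y, E y & nm (x - y) <= e) -> E x.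

Lemma sclosed_cvgs E u l : sclosed E -> (forall n, E (u n)) -> cvgs u l -> E l.
Proof.
move=> cE Eu ul; apply: cE => e /ul[N HN].
by exists (u N) => //; rewrite nmB; exact: HN.
Qed.

End Inner.

Section Subspaces.
Variable (V : lmodType R[i]) (E : set V).
Hypothesis sE : subspace E.
Lemma subspace0 : E 0. Proof. by case: sE. Qed.
Lemma subspaceZ a x : E x -> E (a *: x).
Proof. by case: sE => E0 EP Ex; rewrite -[_ *: _]addr0; exact: EP. Qed.
Lemma subspaceD x y : E x -> E y -> E (x + y).
Proof. by case: sE => E0 EP Ex; rewrite -[x]scale1r; exact: EP. Qed.
Lemma subspaceN x : E x -> E (- x).
Proof. by move=> Ex; rewrite -scaleN1r; exact: subspaceZ. Qed.
Lemma subspaceB x y : E x -> E y -> E (x - y).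
Proof. by move=> Ex Ey; apply: subspaceD => //; exact: subspaceN. Qed.
Lemma subspace_sum I (r : seq I) (P : pred I) (F : I -> V) :
  (forall i, P i -> E (F i)) -> E (\sum_(i <- r | P i) F i).
Proof. by move=> EF; apply: big_ind => //; [exact: subspace0|exact: subspaceD]. Qed.
End Subspaces.

Section LinSpan.
Variable (V : lmodType R[i]).

Lemma lin_span_subspace (X : set V) : subspace (lin_span X).
Proof.
split=> [|a x y hx hy] E [sE XE]; first exact: subspace0.
by apply: (subspaceD sE); [apply: (subspaceZ sE); exact: hx|exact: hy].
Qed.

Lemma sub_lin_span (X : set V) x : X x -> lin_span X x.
Proof. by move=> Xx E [_]; apply. Qed.

Lemma lin_span_ind (X E : set V) : subspace E -> X `<=` E -> lin_span X `<=` E.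
Proof. by move=> sE XE x; apply. Qed.

End LinSpan.

Section Linear.
Variables (H K : lmodType R[i]) (f : H -> K).
Hypothesis lf : linear f.
Lemma linD x y : f (x + y) = f x + f y.
Proof. by have := lf 1 x y; rewrite !scale1r. Qed.
Lemma lin0 : f 0 = 0.
Proof. by apply/(addrI (f 0)); rewrite -linD !addr0. Qed.
Lemma linZ a x : f (a *: x) = a *: f x.
Proof. by have := lf a x 0; rewrite lin0 !addr0. Qed.
Lemma linN x : f (- x) = - f x.
Proof. by rewrite -scaleN1r linZ scaleN1r. Qed.
Lemma linB x y : f (x - y) = f x - f y.
Proof. by rewrite linD linN. Qed.
Lemma lin_sum I (r : seq I) (F : I -> H) :
  f (\sum_(i <- r) F i) = \sum_(i <- r) f (F i).
Proof. by apply: (big_morph f linD lin0). Qed.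
End Linear.

Section Riesz.
Variables (H : hilbertType R) (E : set H) (phi : H -> R[i]) (c : R).
Hypotheses (sE : subspace E) (cE : sclosed E).
Hypothesis phiP : forall a x y, E x -> E y -> phi (a *: x + y) = a * phi x + phi y.
Hypothesis phi_bnd : forall x, E x -> cabs (phi x) <= c * nm x.

Let J x := nm x ^+ 2 - 2 * Re (phi x).

Let J_ge x : E x -> - c ^+ 2 <= J x.
Proof.
move=> /phi_bnd b; have := Re_le_cabs (phi x); have := sqr_ge0 (nm x - c).
by rewrite /J; move: b; nra.
Qed.

Let phi0 : phi 0 = 0.
Proof.
have := @phiP 1 0 0 (subspace0 sE) (subspace0 sE); rewrite scale1r addr0 mul1r.
by move=> E0; apply/(addrI (phi 0)); rewrite addr0 -E0.
Qed.
Let phiZ a x : E x -> phi (a *: x) = a * phi x.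
Proof. by move=> Ex; rewrite -[a *: x]addr0 phiP ?phi0 ?addr0 //; exact: subspace0. Qed.
Let phiD x y : E x -> E y -> phi (x + y) = phi x + phi y.
Proof. by move=> Ex Ey; rewrite -[x in LHS]scale1r phiP // mul1r. Qed.

(* The representing vector minimises |x|^2 - 2 Re (phi x) over E. *)
Lemma riesz_subspace : exists2 u, E u & forall w, E w -> phi w = '[w, u].
Proof.
pose A := [set J x | x in E].
have hA : has_inf A.
  split; first by exists (J 0), 0 => //; exact: subspace0.
  by exists (- c ^+ 2) => _ [x Ex <-]; exact: J_ge.
pose m := inf A.
have mJ x : E x -> m <= J x.
  by move=> Ex; apply: ge_inf; [case: hA|exists x].
have /choice[u uP] n : exists x, E x /\ J x <= m + n.+1%:R^-1.
  have e0 : (0 : R) < n.+1%:R^-1 by rewrite invr_gt0 ltr0n.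
  by have [_ [x Ex <-] /ltW] := inf_adherent e0 hA; exists x.
have Eu n : E (u n) by case: (uP n).
(* Parallelogram law at the midpoint of two almost minimisers: [J] is at least [m] there, so the two
   are close. *)
have ubnd n k : nm (u n - u k) ^+ 2 <= 2 * (n.+1%:R^-1 + k.+1%:R^-1).
  have := mJ (2^-1 *: (u n + u k)) (subspaceZ sE _ (subspaceD sE (Eu n) (Eu k))).
  have := (uP n).2; have := (uP k).2; rewrite /J.
  rewrite phiZ; last by apply: subspaceD.
  rewrite phiD // nmZ exprMn; rewrite rc_half.
  rewrite cabs_real ReZ ReD ger0_norm ?invr_ge0 ?ler0n //.
  have -> : (2^-1 : R) ^+ 2 = 4^-1 by field. have := parallelogram (u n) (u k).
  by move: (n.+1%:R^-1) (k.+1%:R^-1) => p q; lra.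
have [l ul] : exists l, cvgs u l.
  apply: cauchy_cvgs => e e0.
  have [N HN] := @tends0_inv R (e ^+ 2 / 4) (divr_gt0 (exprn_gt0 _ e0) (ltr0Sn _ _)).
  exists N => n k /HN hn /HN hk; rewrite -ler_sqr ?nnegrE ?nm_ge0 ?(ltW e0) //.
  apply: (le_trans (ubnd _ _)).
  by move: (n.+1%:R^-1) (k.+1%:R^-1) hn hk => p q; lra.
exists l; first exact: (sclosed_cvgs cE Eu).
move=> w Ew; apply/eqP; rewrite eq_sym -subr_eq0; apply/eqP/cabs_eq0/eqP.
rewrite -sqrf_eq0 eq_le sqr_ge0 andbT.
(* First variation at the limit [l]: moving it by [b *: w] cannot bring [J] below [m], and the
   discriminant inequality with [A = 0] forces the difference of [phi w] and ['[w, l]] to vanish. *)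
rewrite -[leRHS](mul0r (nm w ^+ 2)).
apply: cauchy_schwarz_scalar => [|b]; first exact: sqr_ge0.
have T : tends0 (fun n => n.+1%:R^-1 + 2 * (cabs b * nm w) * nm (u n - l)).
  apply: tends0D (tends0_inv) (tends0Z _ ul).
  by rewrite !mulr_ge0 ?cabs_ge0 ?nm_ge0.
rewrite -oppr_le0; apply: tends0_const_le T _ => n.
have := mJ _ (subspaceD sE (Eu n) (subspaceZ sE b Ew)); have := (uP n).2.
rewrite /J nm_sqrD phiD // ?phiZ //; last exact: subspaceZ.
rewrite ReD nmZ exprMn innerZr.
have -> : Re (cj b * '[u n, w]) = Re (b * '[w, l]) + Re (b * '[w, u n - l]).
  rewrite -ReD -mulrDr -innerDr addrC subrK (innerC w) -cjM ReC; by [].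
rewrite mulrBr ReD ReN.
have := Re_le_cabs (b * '[w, u n - l]); rewrite cabsM.
have := ler_wpM2l (cabs_ge0 b) (cauchy_schwarz w (u n - l)).
by move: (n.+1%:R^-1) => p; lra.
Qed.

End Riesz.
End HilbertBasics.

(** * Bounded operators *)

Section Operators.
Context {R : realType}.
Implicit Types H K L : hilbertType R.

Definition bnd H K (f : H -> K) (c : R) := forall x, nm (f x) <= c * nm x.

Lemma bnd_le H K (f : H -> K) c d : c <= d -> bnd f c -> bnd f d.
Proof. by move=> cd fc x; apply: (le_trans (fc x)); rewrite ler_wpM2r ?nm_ge0. Qed.

Lemma bopP H K (f : H -> K) :
  bounded_op f <-> linear f /\ exists2 c, 0 <= c & bnd f c.
Proof.
split=> [[lf cf]|[lf [c c0 fc]]]; split=> //; last first.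
  move=> x; apply/cvgrPdist_lt => e /[dup] e0; rewrite ltcE => /andP[/eqP Ime Ree].
  have ree : e = (Re e)%:rc by apply: cplx_ext.
  have c1 : 0 < c + 1 by lra.
  have : nbhs x (ball x (Re e / (c + 1))%:rc).
    by apply: nbhsx_ballx; rewrite -rc0 rc_lt divr_gt0.
  apply: filterS => y; rewrite -ball_normE /= -(linB lf) !nmE ree !rc_lt => xy.
  apply: (le_lt_trans (fc _)); apply: (@le_lt_trans _ _ ((c + 1) * nm (x - y))).
    by rewrite ler_wpM2r ?nm_ge0; lra.
  by rewrite mulrC -ltr_pdivlMr.
have /cvgrPdist_lt /(_ 1 ltr01) : f x @[x --> 0] --> f 0 by exact: cf.
rewrite -nbhs_ballE (lin0 lf) => -[e /= e0 eB].
have := e0; rewrite ltcE => /andP[/eqP Ime Ree].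
have ree : e = (Re e)%:rc by apply: cplx_ext.
have {}eB x : nm x < Re e -> nm (f x) < 1.
  move=> xe; have := eB x; rewrite -ball_normE /= !sub0r !normrN !nmE ree rc_lt.
  by move=> /(_ xe); rewrite -rc1 rc_lt.
move: Ree => /= Ree.
exists (2 / Re e); first by rewrite divr_ge0 // ltW.
move=> x; have [x0|x0] := eqVneq (nm x) 0.
  by rewrite (nm_eq0 x0) (lin0 lf) !nm0 mulr0.
have xp : 0 < nm x by rewrite lt_def x0 nm_ge0.
pose t := Re e / (2 * nm x).
have t0 : 0 < t by rewrite divr_gt0 // mulr_gt0.
have := eB (t%:rc *: x); rewrite (linZ lf) !nmZ cabs_real gtr0_norm //.
have -> : t * nm x = Re e / 2 by rewrite /t; field; rewrite x0.
move=> /(_ ltac:(lra))/ltW h.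
have -> : 2 / Re e * nm x = t^-1 by rewrite /t; field; rewrite x0 gt_eqF.
by rewrite -[leRHS]mul1r ler_pdivlMr // mulrC.
Qed.

Lemma bop_lin H K (f : H -> K) : bounded_op f -> linear f.
Proof. by case. Qed.

Lemma bop_bnd H K (f : H -> K) : bounded_op f -> exists2 c, 0 <= c & bnd f c.
Proof. by move/bopP => []. Qed.

Lemma bop_bnd_gt0 H K (f : H -> K) : bounded_op f -> exists2 c, 0 < c & bnd f c.
Proof.
move/bop_bnd => [c c0 fc]; exists (c + 1); first lra.
by apply: bnd_le fc; lra.
Qed.

Lemma bop_id H : bounded_op (@idfun H).
Proof. by apply/bopP; split=> //; exists 1 => // x; rewrite mul1r. Qed.

Lemma lin_comp (U V W : lmodType R[i]) (f : V -> W) (g : U -> V) :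
  linear f -> linear g -> linear (f \o g).
Proof. by move=> lf lg a x y /=; rewrite lg lf. Qed.

Lemma bnd_comp H K L (f : K -> L) (g : H -> K) c d :
  0 <= c -> bnd f c -> bnd g d -> bnd (f \o g) (c * d).
Proof.
move=> c0 fc gd x /=; apply: (le_trans (fc _)).
by rewrite -mulrA ler_wpM2l.
Qed.

Lemma bop_comp H K L (f : K -> L) (g : H -> K) :
  bounded_op f -> bounded_op g -> bounded_op (f \o g).
Proof.
move=> /bopP[lf [c c0 fc]] /bopP[lg [d d0 gd]]; apply/bopP; split.
  exact: lin_comp.
by exists (c * d); [exact: mulr_ge0|exact: bnd_comp].
Qed.

Lemma bnd_lincomb H K a (f g : H -> K) c d : bnd f c -> bnd g d ->
  bnd (a *: f + g) (cabs a * c + d).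
Proof.
move=> fc gd x; rewrite mulrDl; apply: (le_trans (nmD _ _)); apply: lerD => //.
by rewrite nmZ -mulrA ler_wpM2l ?cabs_ge0.
Qed.

Lemma bnd_opp H K (f : H -> K) c : bnd f c -> bnd (- f) c.
Proof. by move=> fc x; rewrite nmN. Qed.

Lemma bndD H K (f g : H -> K) c d : bnd f c -> bnd g d -> bnd (f + g) (c + d).
Proof. by move=> fc gd x; rewrite mulrDl; apply: (le_trans (nmD _ _)); exact: lerD. Qed.

Lemma bop0 H K : bounded_op (0 : H -> K).
Proof.
apply/bopP; split; first by move=> a x y; rewrite /= scaler0 addr0.
by exists 0 => // x; rewrite nm0 mul0r.
Qed.

Lemma bop_subspace H K : subspace (@bounded_op R H K).
Proof.
split=> [|a f g /bopP[lf [c c0 fc]] /bopP[lg [d d0 gd]]]; first exact: bop0.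
apply/bopP; split.
  move=> b x y; change (a *: f (b *: x + y) + g (b *: x + y) =
    b *: (a *: f x + g x) + (a *: f y + g y)).
  by rewrite lf lg !scalerDr !scalerA (mulrC a b) addrACA.
exists (cabs a * c + d); last exact: bnd_lincomb.
by rewrite addr_ge0 // mulr_ge0 ?cabs_ge0.
Qed.

Section Adjoint.
Variables (H K : hilbertType R) (f : H -> K).
Hypothesis bf : bounded_op f.

Lemma adj_exists : exists g : K -> H, forall x y, '[f x, y] = '[x, g y].
Proof.
have /bopP[lf [c c0 fc]] := bf.
suff /choice[g gP] y : exists u, forall x, '[f x, y] = '[x, u].
  by exists g => x y; exact: gP.
have [||||u _ uP] := @riesz_subspace _ H setT (fun x => '[f x, y]) (c * nm y).
- by [].
- by move=> x _.
- by move=> a x x' _ _; rewrite lf innerDl innerZl.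
- move=> x _; apply: (le_trans (cauchy_schwarz _ _)).
  by rewrite mulrAC ler_wpM2r ?nm_ge0.
by exists u => x; exact: uP.
Qed.

Lemma adjP x y : '[f x, y] = '[x, adj f y].
Proof. by rewrite /adj; case: xgetP => [g _ ->//|no]; have [g gP] := adj_exists; case: (no g). Qed.

Lemma adjPr x y : '[adj f y, x] = '[y, f x].
Proof. by rewrite innerC -adjP -innerC. Qed.

Lemma adj_uniq g : (forall x y, '[f x, y] = '[x, g y]) -> adj f = g.
Proof. by move=> gP; apply/funext => y; apply: inner_extr => x; rewrite -adjP gP. Qed.

Lemma bnd_adj c : 0 <= c -> bnd f c -> bnd (adj f) c.
Proof.
move=> c0 fc y; have [y0|y0] := eqVneq (nm (adj f y)) 0.
  by rewrite y0 mulr_ge0 ?nm_ge0.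
have yp : 0 < nm (adj f y) by rewrite lt_def y0 nm_ge0.
rewrite -(ler_pM2l yp) -expr2 -Re_inner_nm -adjP.
apply: (le_trans (Re_inner_le _ _)).
by rewrite mulrA [_ * c]mulrC ler_wpM2r ?nm_ge0.
Qed.

Lemma bop_adj : bounded_op (adj f).
Proof.
have /bopP[lf [c c0 fc]] := bf; apply/bopP; split; last by exists c => //; exact: bnd_adj.
move=> a x y; apply: inner_extr => z.
by rewrite innerDr innerZr -!adjP innerDr innerZr.
Qed.

End Adjoint.

Lemma adjK H K (f : H -> K) : bounded_op f -> adj (adj f) = f.
Proof.
move=> bf; apply: adj_uniq; first exact: bop_adj.
by move=> x y; rewrite adjPr.
Qed.

Lemma adj_comp H K L (f : K -> L) (g : H -> K) :
  bounded_op f -> bounded_op g -> adj (f \o g) = adj g \o adj f.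
Proof.
move=> bf bg; apply: adj_uniq; first exact: bop_comp.
by move=> x y /=; rewrite !adjP.
Qed.

Lemma adj_lincomb H K a (f g : H -> K) : bounded_op f -> bounded_op g ->
  adj (a *: f + g) = cj a *: adj f + adj g.
Proof.
move=> bf bg; apply: adj_uniq; first exact: (bop_subspace _ _).2.
move=> x y; rewrite {1}/GRing.scale /GRing.add /= !innerDl innerDr innerZl innerZr !adjP //.
by rewrite cjK.
Qed.

Lemma adj_id H : adj (@idfun H) = idfun.
Proof. by apply: adj_uniq => //; exact: bop_id. Qed.

Lemma bounded_opD H K (f g : H -> K) : bounded_op f -> bounded_op g -> bounded_op (f + g).
Proof. exact: (subspaceD (@bop_subspace H K)). Qed.
Lemma bounded_opB H K (f g : H -> K) : bounded_op f -> bounded_op g -> bounded_op (f - g).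
Proof. exact: (subspaceB (@bop_subspace H K)). Qed.
Lemma bounded_opZ H K a (f : H -> K) : bounded_op f -> bounded_op (a *: f).
Proof. exact: (subspaceZ (@bop_subspace H K)). Qed.

Lemma adjD H K (f g : H -> K) : bounded_op f -> bounded_op g ->
  adj (f + g) = adj f + adj g.
Proof. by move=> bf bg; have := adj_lincomb 1 bf bg; rewrite cj1 !scale1r. Qed.
Lemma adj0 H K : adj (0 : H -> K) = 0.
Proof. by apply: adj_uniq; [exact: bop0|move=> x y; rewrite inner0l inner0r]. Qed.
Lemma adjZ H K a (f : H -> K) : bounded_op f -> adj (a *: f) = cj a *: adj f.
Proof.
by move=> bf; have := adj_lincomb a bf (@bop0 H K); rewrite !addr0 adj0 addr0.
Qed.

Lemma bounded_opN H K (f : H -> K) : bounded_op f -> bounded_op (- f).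
Proof. exact: (subspaceN (@bop_subspace H K)). Qed.
Lemma adjN H K (f : H -> K) : bounded_op f -> adj (- f) = - adj f.
Proof. by move=> bf; rewrite -scaleN1r adjZ // cjN cj1 scaleN1r. Qed.
Lemma adjB H K (f g : H -> K) : bounded_op f -> bounded_op g ->
  adj (f - g) = adj f - adj g.
Proof. by move=> bf bg; rewrite adjD ?adjN //; exact: bounded_opN. Qed.

Lemma op_closureP H K (X : set (H -> K)) f : op_closure X f <->
  bounded_op f /\ forall e : R, 0 < e -> exists2 g, X g & bnd (f - g) e.
Proof.
split=> -[bf hf]; split=> // e e0.
  have [|g Xg fg] := hf e%:rc; first by rewrite -rc0 rc_lt.
  by exists g => // x; rewrite -rc_le rcM -!nmE; exact: fg.
have := e0; rewrite ltcE => /andP[/eqP Ime Ree].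
have ree : e = (Re e)%:rc by apply: cplx_ext.
have [g Xg fg] := hf _ Ree; exists g => // x.
by rewrite ree !nmE -rcM rc_le; exact: fg.
Qed.

Lemma op_closure_bop H K (X : set (H -> K)) f : op_closure X f -> bounded_op f.
Proof. by case. Qed.

Lemma bnd0 H K (e : R) : 0 <= e -> bnd (0 : H -> K) e.
Proof. by move=> e0 x; rewrite nm0 mulr_ge0 ?nm_ge0. Qed.

Lemma sub_op_closure H K (X : set (H -> K)) f : bounded_op f -> X f -> op_closure X f.
Proof.
move=> bf Xf; apply/op_closureP; split=> // e e0; exists f => //.
by rewrite subrr; apply/bnd0/ltW.
Qed.

Lemma op_closureS H K (X Y : set (H -> K)) : X `<=` Y -> op_closure X `<=` op_closure Y.
Proof.
move=> XY f /op_closureP[bf hf]; apply/op_closureP; split=> // e /hf[g Xg fg].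
by exists g => //; exact: XY.
Qed.

Lemma bnd_sub_trans H K (f g h : H -> K) c d :
  bnd (f - g) c -> bnd (g - h) d -> bnd (f - h) (c + d).
Proof. by move=> a b; have := bndD a b; rewrite addrA subrK. Qed.

Lemma op_closure_idem H K (X : set (H -> K)) f :
  op_closure (op_closure X) f -> op_closure X f.
Proof.
move=> /op_closureP[bf hf]; apply/op_closureP; split=> // e e0.
have e2 : 0 < e / 2 by lra.
have [g /op_closureP[_ hg] fg] := hf _ e2; have [h Xh gh] := hg _ e2.
by exists h => //; have := bnd_sub_trans fg gh; rewrite -splitr.
Qed.

Lemma op_closure_subspace H K (X : set (H -> K)) : subspace X -> subspace (op_closure X).
Proof.
move=> sX; split=> [|a f g /op_closureP[bf hf] /op_closureP[bg hg]].
  by apply: sub_op_closure; [exact: bop0|exact: subspace0].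
apply/op_closureP; split=> [|e e0]; first exact: (bop_subspace _ _).2.
have a1 : 0 < cabs a + 1 by have := cabs_ge0 a; lra.
have e2 : 0 < e / (cabs a + 1) by rewrite divr_gt0.
have [f' Xf ff] := hf _ (divr_gt0 e2 (ltr0Sn _ 1)).
have [g' Xg gg] := hg (e / 2) (divr_gt0 e0 (ltr0Sn _ 1)).
exists (a *: f' + g'); first exact: sX.2.
have := bnd_lincomb a ff gg; rewrite scalerBr addrACA -opprD; apply: bnd_le.
rewrite [leRHS]splitr lerD2r mulrA ler_wpM2r ?invr_ge0 ?ler0n //.
by rewrite mulrA ler_pdivrMr // mulrC ler_wpM2l ?(ltW e0) //; lra.
Qed.

(* Continuity of [f |-> g f h] for the operator norm, as a statement about closures. *)
Lemma op_closure_comp H K H' K' (X : set (H -> K)) (Y : set (H' -> K'))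
    (g : K -> K') (h : H' -> H) f :
  bounded_op g -> bounded_op h ->
  (forall x, X x -> op_closure Y (g \o x \o h)) ->
  op_closure X f -> op_closure Y (g \o f \o h).
Proof.
move=> bg bh XY /op_closureP[bf hf]; apply/op_closure_idem/op_closureP; split.
  by apply: bop_comp => //; exact: bop_comp.
move=> e e0; have [c c0 gc] := bop_bnd_gt0 bg; have [d d0 hd] := bop_bnd_gt0 bh.
have [x Xx fx] := hf (e / (c * d)) (divr_gt0 e0 (mulr_gt0 c0 d0)).
exists (g \o x \o h); first exact: XY.
have -> : (g \o f \o h) - (g \o x \o h) = (g \o (f - x)) \o h.
  by apply/funext => y; rewrite /= (linB (bop_lin bg)).
have ec : 0 <= e / (c * d) by rewrite divr_ge0 ?mulr_ge0 // ltW.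
have := bnd_comp (mulr_ge0 (ltW c0) ec) (bnd_comp (ltW c0) gc fx) hd.
by apply: bnd_le; rewrite mulrAC mulrCA mulfV ?mulr1 // mulf_neq0 // gt_eqF.
Qed.

Lemma op_closure_adj H K (X : set (H -> K)) (Y : set (K -> H)) f :
  (forall x, X x -> bounded_op x) -> (forall x, X x -> Y (adj x)) ->
  op_closure X f -> op_closure Y (adj f).
Proof.
move=> bX XY /op_closureP[bf hf]; apply/op_closureP; split; first exact: bop_adj.
move=> e e0; have [g Xg fg] := hf _ e0; exists (adj g); first exact: XY.
have bg := bX _ Xg.
by rewrite -adjB //; apply: bnd_adj => //; [exact: bounded_opB|exact: ltW].
Qed.

(** [p x] is the vector of [E] that represents ['[_, x]] on [E]; symmetry follows from this
    representation, and linearity from symmetry. *)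
Lemma projection_exists H (E : set H) : subspace E -> sclosed E ->
  exists p : projection H, (forall x, E (p x)) /\ (forall x, E x -> p x = x).
Proof.
move=> sE cE.
have /choice[f fP] x : exists u, E u /\ forall w, E w -> '[w, x] = '[w, u].
  have [||u Eu uP] := @riesz_subspace _ H E (fun w => '[w, x]) (nm x) sE cE.
  - by move=> a y z _ _; rewrite innerDl innerZl.
  - by move=> w _; rewrite mulrC; exact: cauchy_schwarz.
  by exists u.
have Ef x : E (f x) by case: (fP x).
have fi w x : E w -> '[w, x] = '[w, f x] by case: (fP x) => _; apply.
have fid x : E x -> f x = x.
  move=> Ex; apply/eqP; rewrite -subr_eq0; apply/eqP/nm_eq0/eqP.
  rewrite -sqrf_eq0 -Re_inner_nm innerBr -fi ?subrr //.
  by apply: subspaceB.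
have sa x y : '[f x, y] = '[x, f y].
  by rewrite fi // innerC -fi // -innerC.
have lf : linear f.
  by move=> a x y; apply: inner_extl => z; rewrite sa innerDl innerZl innerDl innerZl !sa.
have fb : bnd f 1.
  move=> x; rewrite mul1r; have [->|x0] := eqVneq (nm (f x)) 0; first exact: nm_ge0.
  have xp : 0 < nm (f x) by rewrite lt_def x0 nm_ge0.
  by rewrite -(ler_pM2l xp) -expr2 -Re_inner_nm -fi //; exact: Re_inner_le.
have [_ cf] : bounded_op f by apply/bopP; split=> //; exists 1.
pose lf' := GRing.isLinear.Build R[i] H H *:%R f lf.
pose F : {linear H -> H} := HB.pack f lf'.
exists (@Projection _ _ F cf (fun x => fid _ (Ef x)) sa); split=> // x; exact: fid.
Qed.

End Operators.

(** * Hilbert spaces of positive definite kernels *)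

Section ComplexLimits.
Context {R : realType}.
Implicit Types s t : nat -> R[i].

Lemma real_cauchy (u : nat -> R) :
  (forall e : R, 0 < e -> exists N, forall n m, (N <= n)%N -> (N <= m)%N ->
     `|u n - u m| <= e) -> exists l, tends0 (fun n => `|u n - l|).
Proof.
move=> Cu.
have /cauchy_cvgP/cvg_ex[l ul] : cauchy (u @ \oo).
  apply/cauchyP => e e0; have [N HN] := Cu _ (divr_gt0 e0 (ltr0Sn _ 1)).
  exists (u N); exists N => // n /= Nn; rewrite -ball_normE /=.
  by apply: (le_lt_trans (HN _ _ _ Nn)) => //; lra.
exists l => e e0.
have : \forall n \near \oo, `|l - u n| < e by move/cvgrPdist_lt: ul; apply.
by case=> N _ HN; exists N => n Nn; rewrite distrC ltW //; exact: HN.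
Qed.

Definition ccvg s l := tends0 (fun n => cabs (s n - l)).

Lemma cabs_le_ReIm (z : R[i]) : cabs z <= `|Re z| + `|Im z|.
Proof.
rewrite -ler_sqr ?nnegrE ?cabs_ge0 ?addr_ge0 // cabs_sqr.
rewrite -[Re z ^+ 2]real_normK ?num_real // -[Im z ^+ 2]real_normK ?num_real //.
by rewrite sqrrD; have := normr_ge0 (Re z); have := normr_ge0 (Im z); nra.
Qed.

Lemma normRe_le (z : R[i]) : `|Re z| <= cabs z.
Proof. by rewrite ler_norml Re_le_cabs Re_geN_cabs. Qed.

Lemma normIm_le (z : R[i]) : `|Im z| <= cabs z.
Proof.
have := normRe_le ('i * z); rewrite ReiM normrN cabsM.
by rewrite cabs_i mul1r.
Qed.

Lemma ccauchy s :
  (forall e : R, 0 < e -> exists N, forall n m, (N <= n)%N -> (N <= m)%N ->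
     cabs (s n - s m) <= e) -> exists l, ccvg s l.
Proof.
move=> Cs.
have [e e0|a ha] := real_cauchy (u := fun n => Re (s n)).
  have [N HN] := Cs _ e0; exists N => n m hn hm; apply: le_trans (HN _ _ hn hm).
  by rewrite -ReN -ReD normRe_le.
have [e e0|b hb] := real_cauchy (u := fun n => Im (s n)).
  have [N HN] := Cs _ e0; exists N => n m hn hm; apply: le_trans (HN _ _ hn hm).
  by rewrite -ImN -ImD normIm_le.
exists (a +i* b); apply: tends0_le (tends0D ha hb) _ => n.
by apply: (le_trans (cabs_le_ReIm _)); rewrite ReD ImD ReN ImN.
Qed.

Lemma ccvg_uniq s l l' : ccvg s l -> ccvg s l' -> l = l'.
Proof.
move=> h h'; apply/eqP; rewrite -subr_eq0; apply/eqP/cabs_eq0/eqP.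
rewrite eq_le cabs_ge0 andbT; apply: tends0_const_le (tends0D h h') _ => n.
rewrite -(cabsN (s n - l)); apply: le_trans (cabsD _ _).
by rewrite opprB addrA subrK.
Qed.

Lemma ccvgD s t l m : ccvg s l -> ccvg t m -> ccvg (fun n => s n + t n) (l + m).
Proof.
move=> h h'; apply: tends0_le (tends0D h h') _ => n.
by rewrite opprD addrACA cabsD.
Qed.

Lemma ccvgZ a s l : ccvg s l -> ccvg (fun n => a * s n) (a * l).
Proof.
move=> h; apply: tends0_le (tends0Z (cabs_ge0 a) h) _ => n.
by rewrite -mulrBr cabsM.
Qed.

Lemma ccvg_cj s l : ccvg s l -> ccvg (fun n => cj (s n)) (cj l).
Proof. by move=> h; apply: tends0_le h _ => n; rewrite -cjN -cjD cabsC. Qed.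

Lemma ccvg_const (l : R[i]) : ccvg (fun=> l) l.
Proof. by move=> e e0; exists 0%N => n _; rewrite subrr cabs0 ltW. Qed.

Lemma ccvg_Re_ge0 s l : ccvg s l -> (forall n, 0 <= Re (s n)) -> 0 <= Re l.
Proof.
move=> h s0; rewrite -oppr_le0; apply: tends0_const_le h _ => n.
have := Re_le_cabs (s n - l); rewrite ReD ReN; have := s0 n; lra.
Qed.

Lemma ccvg_Re_le s l c : ccvg s l ->
  (exists N, forall n, (N <= n)%N -> Re (s n) <= c) -> Re l <= c.
Proof.
move=> h [N HN]; rewrite -subr_le0 leNgt; apply/negP => lc.
have [M HM] := h ((Re l - c) / 2) (divr_gt0 lc (ltr0Sn _ 1)).
have := HN (maxn N M) (leq_maxl _ _); have := HM (maxn N M) (leq_maxr _ _).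
set z := s _; have := Re_geN_cabs (z - l); rewrite ReD ReN; lra.
Qed.

End ComplexLimits.

(** * Semi-inner products on sets with bare operations *)

Section PsdForm.
Context {R : realType} {E : Type}.
Variables (pl : E -> E -> E) (sc : R[i] -> E -> E) (s : E -> E -> R[i]).
Hypothesis sD : forall x y z, s (pl x y) z = s x z + s y z.
Hypothesis sZ : forall a x z, s (sc a x) z = a * s x z.
Hypothesis sC : forall x y, s y x = cj (s x y).
Hypothesis s0 : forall x, 0 <= Re (s x x).

(** [pl] and [sc] obey no vector space laws because the form must also live on lists of formal
    combinations, with concatenation as sum; the properties of [s] alone give Cauchy-Schwarz. *)
Definition sn x : R := Num.sqrt (Re (s x x)).

Lemma sn_ge0 x : 0 <= sn x. Proof. exact: sqrtr_ge0. Qed.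
Lemma sn_sqr x : sn x ^+ 2 = Re (s x x). Proof. by rewrite sqr_sqrtr. Qed.
Lemma sDr x y z : s z (pl x y) = s z x + s z y.
Proof. by rewrite sC sD cjD -!sC. Qed.
Lemma sZr a x z : s z (sc a x) = cj a * s z x.
Proof. by rewrite sC sZ cjM -sC. Qed.

Lemma sn_sqrD x y : sn (pl x y) ^+ 2 = sn x ^+ 2 + 2 * Re (s x y) + sn y ^+ 2.
Proof. rewrite !sn_sqr sD !sDr !ReD (sC x y) ReC; lra. Qed.

Lemma snZ a x : sn (sc a x) = cabs a * sn x.
Proof.
apply/eqP; rewrite -(@eqrXn2 _ 2) ?mulr_ge0 ?cabs_ge0 ?sn_ge0 // exprMn !sn_sqr.
by rewrite sZ sZr mulrA mul_conjc ReZ.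
Qed.

Lemma psd_cauchy_schwarz x y : cabs (s x y) <= sn x * sn y.
Proof.
rewrite -ler_sqr ?nnegrE ?cabs_ge0 ?mulr_ge0 ?sn_ge0 // exprMn [leRHS]mulrC.
apply: cauchy_schwarz_scalar; first exact: sqr_ge0.
move=> c; have := sqr_ge0 (sn (pl y (sc c x))).
by rewrite sn_sqrD sZr (sC x y) snZ exprMn -cjM ReC.
Qed.

Lemma sn_triangle x y : sn (pl x y) <= sn x + sn y.
Proof.
rewrite -ler_sqr ?nnegrE ?addr_ge0 ?sn_ge0 // sn_sqrD sqrrD.
have := Re_le_cabs (s x y); have := psd_cauchy_schwarz x y; lra.
Qed.

End PsdForm.

Section KernelSpace.
Context {R : realType} {X : Type}.
Variable k : X -> X -> R[i].

Definition comb : Type := seq (R[i] * X).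
Implicit Types l m : comb.

Definition kform l m : R[i] :=
  \sum_(a <- l) \sum_(b <- m) a.1 * cj b.1 * k a.2 b.2.
Definition scomb (a : R[i]) l : comb := [seq (a * p.1, p.2) | p <- l].

Hypothesis kC : forall x y, k y x = cj (k x y).
Hypothesis kpos : forall l, 0 <= Re (kform l l).

Lemma kformD l l' m : kform (l ++ l') m = kform l m + kform l' m.
Proof. by rewrite /kform big_cat. Qed.
Lemma kformZ a l m : kform (scomb a l) m = a * kform l m.
Proof.
rewrite /kform big_map mulr_sumr; apply: eq_bigr => p _.
by rewrite mulr_sumr; apply: eq_bigr => r _; rewrite /= !mulrA.
Qed.
Lemma kformC l m : kform m l = cj (kform l m).
Proof.
rewrite /kform exchange_big cj_sum; apply: eq_bigr => p _.
rewrite cj_sum; apply: eq_bigr => r _.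
by rewrite !cjM cjK (kC p.2 r.2) [r.1 * _]mulrC.
Qed.

Let kD l l' m : kform (l ++ l') m = kform l m + kform l' m := kformD l l' m.
Let kDr := sDr kD kformC.
Let kZr := sZr kformZ kformC.
Definition qn : comb -> R := sn kform.
Let qn_ge0 : forall l, 0 <= qn l := sn_ge0 kform.
Let qn_sqr l : qn l ^+ 2 = Re (kform l l). Proof. exact: sn_sqr. Qed.
Let qnZ a l : qn (scomb a l) = cabs a * qn l.
Proof. exact: (snZ kformZ kformC kpos). Qed.
Let qCS l m : cabs (kform l m) <= qn l * qn m.
Proof. exact: (psd_cauchy_schwarz kD kformZ kformC kpos). Qed.
Let qnD l m : qn (l ++ m) <= qn l + qn m.
Proof. exact: (sn_triangle kD kformZ kformC kpos). Qed.

Definition csub l m : comb := l ++ scomb (-1) m.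
Lemma kformBl l l' m : kform (csub l l') m = kform l m - kform l' m.
Proof. by rewrite kformD kformZ mulN1r. Qed.
Lemma kformBr l l' m : kform m (csub l l') = kform m l - kform m l'.
Proof. by rewrite kDr kZr cjN cj1 mulN1r. Qed.

Definition cdist l m := qn (csub l m).
Lemma qn_le_cdist l m : qn l <= cdist l m + qn m.
Proof.
suff -> : qn l = qn (csub l m ++ m) by exact: qnD.
rewrite /qn /sn; congr (Num.sqrt (Re _)).
by rewrite !(kformBl, kformBr, kD, kDr); ring.
Qed.

Definition ccau (u : nat -> comb) := forall e : R, 0 < e ->
  exists N, forall n n' : nat, (N <= n)%N -> (N <= n')%N -> cdist (u n) (u n') <= e.

Lemma ccau_qn_bnd u : ccau u -> exists2 M, 0 < M &
  exists N, forall n, (N <= n)%N -> qn (u n) <= M.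
Proof.
move=> /(_ 1 ltr01)[N HN]; exists (1 + qn (u N)).
  by have := qn_ge0 (u N); lra.
exists N => n Nn; apply: (le_trans (qn_le_cdist _ (u N))).
by rewrite lerD2r HN.
Qed.

Lemma kform_cauchy u v : ccau u -> ccau v -> exists c, ccvg (fun n => kform (u n) (v n)) c.
Proof.
move=> cu cv; have [Mu Mu0 [Nu hu]] := ccau_qn_bnd cu.
have [Mv Mv0 [Nv hv]] := ccau_qn_bnd cv.
apply: ccauchy => e e0.
have [N1 h1] := cu (e / (2 * Mv)) (divr_gt0 e0 (mulr_gt0 (ltr0Sn _ 1) Mv0)).
have [N2 h2] := cv (e / (2 * Mu)) (divr_gt0 e0 (mulr_gt0 (ltr0Sn _ 1) Mu0)).
exists (maxn (maxn Nu Nv) (maxn N1 N2)) => n m.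
rewrite !geq_max => /andP[/andP[a1 a2] /andP[a3 a4]] /andP[/andP[b1 b2] /andP[b3 b4]].
have -> : kform (u n) (v n) - kform (u m) (v m) =
  kform (csub (u n) (u m)) (v n) + kform (u m) (csub (v n) (v m)).
  by rewrite kformBl kformBr; ring.
apply: (le_trans (cabsD _ _)); rewrite [leRHS]splitr; apply: lerD.
  apply: (le_trans (qCS _ _)); apply: (@le_trans _ _ (e / (2 * Mv) * Mv)).
    by apply: ler_pM => //; [exact: h1|exact: hv].
  by rewrite le_eqVlt; apply/orP; left; apply/eqP; field; rewrite gt_eqF.
apply: (le_trans (qCS _ _)); apply: (@le_trans _ _ (Mu * (e / (2 * Mu)))).
  by apply: ler_pM => //; [exact: hu|exact: h2].
by rewrite le_eqVlt; apply/orP; left; apply/eqP; field; rewrite gt_eqF.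
Qed.

(* Elements of the completion are functions on X: f stands for the limit of a Cauchy
   sequence u of formal combinations, and f x for its inner product with x. *)
Definition krep (f : X -> R[i]) u := ccau u /\
  forall x, ccvg (fun n => kform (u n) [:: (1, x)]) (f x).

Lemma krep_comb f u l : krep f u ->
  ccvg (fun n => kform (u n) l) (\sum_(a <- l) cj a.1 * f a.2).
Proof.
move=> [_ fu]; elim: l => [|[a x] l IH].
  rewrite big_nil; under [fun n => _]eq_fun => n.
    rewrite (_ : kform (u n) [::] = 0); last first.
      by rewrite /kform big1 // => p _; rewrite big_nil.
  over.
  exact: ccvg_const.
rewrite big_cons /=; apply: (tends0_le (ccvgD (ccvgZ (cj a) (fu x)) IH)) => n.
rewrite -kZr -kDr /=.
by rewrite mulr1.
Qed.

Lemma ccau_sub u v : ccau u -> ccau v -> ccau (fun n => csub (u n) (v n)).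
Proof.
move=> cu cv e e0; have e2 : 0 < e / 2 by lra.
have [N h] := cu _ e2; have [M h'] := cv _ e2.
exists (maxn N M) => n m; rewrite !geq_max => /andP[a1 a2] /andP[b1 b2].
suff : cdist (csub (u n) (v n)) (csub (u m) (v m)) <= cdist (u n) (u m) + cdist (v n) (v m).
  by have := h _ _ a1 b1; have := h' _ _ a2 b2; lra.
have -> : cdist (csub (u n) (v n)) (csub (u m) (v m)) =
  qn (csub (u n) (u m) ++ scomb (-1) (csub (v n) (v m))).
  rewrite /cdist /qn /sn; congr (Num.sqrt (Re _)).
  by rewrite !(kformBl, kformBr, kformZ, kZr, kD, kDr) cjN cj1; ring.
by apply: (le_trans (qnD _ _)); rewrite qnZ cabsN cabs1 mul1r.
Qed.

(** The difference [w] of the two sequences is Cauchy and tends to 0 against each fixed combination;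
    splitting [kform (w n) (w n)] at one late term [w N2] makes it small. *)
Lemma krep_uniq f u v : krep f u -> krep f v -> tends0 (fun n => cdist (u n) (v n)).
Proof.
move=> fu fv; pose w n := csub (u n) (v n).
have cw : ccau w by apply: ccau_sub; [case: fu|case: fv].
have w0 l : ccvg (fun n => kform (w n) l) 0.
  rewrite -[0](subrr (\sum_(a <- l) cj a.1 * f a.2)) -[X in _ - X]mul1r -mulNr.
  apply: (tends0_le (ccvgD (krep_comb l fu) (ccvgZ (-1) (krep_comb l fv)))) => n.
  by rewrite kformBl !mulN1r.
apply: tends0_sqr => [n|e e0]; first exact: qn_ge0.
have [M M0 [N1 h1]] := ccau_qn_bnd cw.
have [N2 h2] := cw (e / (2 * M)) (divr_gt0 e0 (mulr_gt0 (ltr0Sn _ 1) M0)).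
have [N3 h3] := w0 (w N2) (e / 2) (divr_gt0 e0 (ltr0Sn _ 1)).
exists (maxn N1 (maxn N2 N3)) => n; rewrite !geq_max => /andP[n1 /andP[n2 n3]].
rewrite /cdist -/(w n) qn_sqr.
have -> : kform (w n) (w n) = kform (w n) (csub (w n) (w N2)) + kform (w n) (w N2).
  by rewrite kformBr; ring.
rewrite ReD [leRHS]splitr; apply: lerD.
  apply: (le_trans (Re_le_cabs _)); apply: (le_trans (qCS _ _)).
  apply: (@le_trans _ _ (M * (e / (2 * M)))).
    by apply: ler_pM => //; [exact: h1|exact: h2].
  by rewrite le_eqVlt; apply/orP; left; apply/eqP; field; rewrite gt_eqF.
by apply: (le_trans (Re_le_cabs _)); have := h3 _ n3; rewrite subr0.
Qed.

Definition kip (f g : X -> R[i]) : R[i] :=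
  xget 0 [set c | forall u v, krep f u -> krep g v ->
    ccvg (fun n => kform (u n) (v n)) c].

(** Sequences representing the same function are asymptotically equal by [krep_uniq], so
    Cauchy-Schwarz makes the limit in [kip] independent of the choice. *)
Lemma kipP f g u v : krep f u -> krep g v ->
  ccvg (fun n => kform (u n) (v n)) (kip f g).
Proof.
move=> fu gv; rewrite /kip; case: xgetP => [c _ hc|no]; first exact: hc.
have [c hc] := kform_cauchy fu.1 gv.1.
case: (no c) => u' v' fu' gv'.
have [Mu Mu0 [Nu hu]] := ccau_qn_bnd fu'.1.
have [Mv Mv0 [Nv hv]] := ccau_qn_bnd gv.1.
move=> e e0.
have [N1 h1] := hc (e / 3) (divr_gt0 e0 (ltr0Sn _ 2)).
have [N2 h2] := krep_uniq fu' fu (divr_gt0 e0 (mulr_gt0 (ltr0Sn _ 2) Mv0)).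
have [N3 h3] := krep_uniq gv' gv (divr_gt0 e0 (mulr_gt0 (ltr0Sn _ 2) Mu0)).
exists (maxn (maxn Nu Nv) (maxn N1 (maxn N2 N3))) => n; rewrite !geq_max.
move=> /andP[/andP[a1 a2] /andP[a3 /andP[a4 a5]]].
have -> : kform (u' n) (v' n) - c = kform (csub (u' n) (u n)) (v n)
  + kform (u' n) (csub (v' n) (v n)) + (kform (u n) (v n) - c).
  by rewrite kformBl kformBr; ring.
have A : cabs (kform (csub (u' n) (u n)) (v n)) <= e / 3.
  apply: (le_trans (qCS _ _)); apply: (@le_trans _ _ (e / (3 * Mv) * Mv)).
    by apply: ler_pM => //; [exact: h2|exact: hv].
  by rewrite le_eqVlt; apply/orP; left; apply/eqP; field; rewrite gt_eqF.
have B : cabs (kform (u' n) (csub (v' n) (v n))) <= e / 3.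
  apply: (le_trans (qCS _ _)); apply: (@le_trans _ _ (Mu * (e / (3 * Mu)))).
    by apply: ler_pM => //; [exact: hu|exact: h3].
  by rewrite le_eqVlt; apply/orP; left; apply/eqP; field; rewrite gt_eqF.
apply: (le_trans (cabsD _ _)); have := h1 _ a3.
by have := cabsD (kform (csub (u' n) (u n)) (v n)) (kform (u' n) (csub (v' n) (v n))); lra.
Qed.

End KernelSpace.

Record pdkernel (R : realType) (X : Type) := PDKernel {
  kfun :> X -> X -> R[i];
  kherm : forall x y, kfun y x = cj (kfun x y);
  kpsd : forall l, 0 <= Re (kform kfun l l) }.

Section KernelHilbert.
Context {R : realType} {X : Type} (k : pdkernel R X).
Let kC := @kherm _ _ k.
Let kP := @kpsd _ _ k.

Definition kpred : {pred X -> R[i]} := [pred f | `[< exists u, krep k f u >]].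

Lemma kpredP f : reflect (exists u, krep k f u) (f \in kpred).
Proof. exact: asboolP. Qed.

Lemma krep_lin a f g u v : krep k f u -> krep k g v ->
  krep k (a *: f + g) (fun n => scomb a (u n) ++ v n).
Proof.
move=> [cu fu] [cv gv]; split; last first.
  move=> x; apply: (tends0_le (ccvgD (ccvgZ a (fu x)) (gv x))) => n.
  by rewrite kformD kformZ.
move=> e e0; have a1 : 0 < cabs a + 1 by have := cabs_ge0 a; lra.
have [N h] := cu (e / 2 / (cabs a + 1)) (divr_gt0 (divr_gt0 e0 (ltr0Sn _ 1)) a1).
have [M h'] := cv (e / 2) (divr_gt0 e0 (ltr0Sn _ 1)).
exists (maxn N M) => n m; rewrite !geq_max => /andP[a2 a3] /andP[b2 b3].
have -> : cdist k (scomb a (u n) ++ v n) (scomb a (u m) ++ v m) =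
  qn k (scomb a (csub (u n) (u m)) ++ csub (v n) (v m)).
  rewrite /cdist /qn /sn; congr (Num.sqrt (Re _)).
  by rewrite !(kformBl, kformBr kC, kformZ, sZr (kformZ k) (kformC kC), kformD,
     sDr (kformD k) (kformC kC)); ring.
apply: (le_trans (sn_triangle (kformD k) (kformZ k) (kformC kC) kP _ _)).
rewrite (snZ (kformZ k) (kformC kC) kP) [leRHS]splitr.
apply: lerD; last exact: h'.
apply: (@le_trans _ _ (cabs a * (e / 2 / (cabs a + 1)))).
  by rewrite ler_wpM2l ?cabs_ge0 //; exact: h.
by rewrite mulrA ler_pdivrMr // mulrC ler_wpM2l ?divr_ge0 ?(ltW e0) //; lra.
Qed.

Definition kemb_fun (l : comb) : X -> R[i] := fun x => kform k l [:: (1, x)].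

Lemma krep_emb l : krep k (kemb_fun l) (fun=> l).
Proof.
split=> [e e0|x]; last exact: ccvg_const.
exists 0%N => n m _ _; rewrite /cdist /qn /sn !kformBl subrr sqrtr0; exact: ltW.
Qed.

Lemma kpred_submod : submod_closed kpred.
Proof.
split=> [|a f g /kpredP[u fu] /kpredP[v gv]]; apply/kpredP.
  exists (fun=> [::]); suff -> : 0 = kemb_fun [::] by exact: krep_emb.
  by apply/funext => x; rewrite /kemb_fun /kform big_nil.
by exists (fun n => scomb a (u n) ++ v n); exact: krep_lin.
Qed.

HB.instance Definition _ :=
  GRing.isSubmodClosed.Build R[i] (X -> R[i]) kpred kpred_submod.

Record kspace := KSpace { kspace_val :> X -> R[i]; kspace_valP : kspace_val \in kpred }.

HB.instance Definition _ := [isSub for kspace_val].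
HB.instance Definition _ := [Choice of kspace by <:].
HB.instance Definition _ := [SubChoice_isSubLmodule of kspace by <:].

Definition kinner (f g : kspace) : R[i] := kip k (val f) (val g).

Lemma kspace_rep (f : kspace) : exists u, krep k (val f) u.
Proof. exact/kpredP/(valP f). Qed.

Lemma kinnerP (f g : kspace) u v : krep k (val f) u -> krep k (val g) v ->
  ccvg (fun n => kform k (u n) (v n)) (kinner f g).
Proof. exact: (kipP kC kP). Qed.

Lemma kinnerPl a (f g h : kspace) :
  kinner (a *: f + g) h = a * kinner f h + kinner g h.
Proof.
have [u fu] := kspace_rep f; have [v gv] := kspace_rep g.
have [w hw] := kspace_rep h.
have fgu : krep k (val (a *: f + g)) (fun n => scomb a (u n) ++ v n).
  by rewrite [val _]linearP; exact: krep_lin.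
apply: (ccvg_uniq (kinnerP fgu hw)).
apply: (tends0_le (ccvgD (ccvgZ a (kinnerP fu hw)) (kinnerP gv hw))) => n.
by rewrite kformD kformZ.
Qed.

Lemma kinnerC (f g : kspace) : kinner g f = cj (kinner f g).
Proof.
have [u fu] := kspace_rep f; have [v gv] := kspace_rep g.
apply: (ccvg_uniq (kinnerP gv fu)).
apply: (tends0_le (ccvg_cj (kinnerP fu gv))) => n.
by rewrite (kformC kC).
Qed.

Lemma kinner_ge0 (f : kspace) : 0 <= Re (kinner f f).
Proof. by have [u fu] := kspace_rep f; apply: (ccvg_Re_ge0 (kinnerP fu fu)). Qed.

Lemma kinnerD (f g h : kspace) : kinner (f + g) h = kinner f h + kinner g h.
Proof. by rewrite -[f]scale1r kinnerPl mul1r scale1r. Qed.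
Lemma kinner0 (h : kspace) : kinner 0 h = 0.
Proof. by apply/(addrI (kinner 0 h)); rewrite -kinnerD !addr0. Qed.
Lemma kinnerZ a (f h : kspace) : kinner (a *: f) h = a * kinner f h.
Proof. by rewrite -[a *: f]addr0 kinnerPl kinner0 addr0. Qed.

Definition kemb (l : comb) : kspace :=
  @KSpace (kemb_fun l) (introT (kpredP _) (ex_intro _ _ (krep_emb l))).

Lemma kinner_emb l m : kinner (kemb l) (kemb m) = kform k l m.
Proof. exact: (ccvg_uniq (kinnerP (f := kemb l) (g := kemb m) (krep_emb l) (krep_emb m))
  (ccvg_const _)). Qed.

Lemma kinner_embx (f : kspace) x : kinner f (kemb [:: (1, x)]) = val f x.
Proof.
have [u fu] := kspace_rep f.
exact: (ccvg_uniq (kinnerP (g := kemb _) fu (krep_emb _)) (fu.2 x)).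
Qed.

Lemma kemb_nil : kemb [::] = 0.
Proof.
by apply: val_inj; rewrite [val 0]raddf0; apply/funext => x; rewrite /= /kemb_fun /kform big_nil.
Qed.

Lemma kemb_cons a x l : kemb ((a, x) :: l) = a *: kemb [:: (1, x)] + kemb l.
Proof.
apply: val_inj; rewrite [val (_ + _)]linearP; apply/funext => z.
rewrite /= /kemb_fun /kform big_cons; congr (_ + _).
rewrite /GRing.scale /= /kemb_fun /kform !big_seq1 /= ?mul1r ?cj1 ?mulr1.
by change (a * k x z = a * (1 * k x z)); rewrite mul1r.
Qed.

Definition knorm (f : kspace) : R := sn kinner f.

Lemma knorm_eq0 f : knorm f = 0 -> f = 0.
Proof.
move=> f0; apply: val_inj; apply/funext => x; rewrite -kinner_embx.
rewrite [val 0]raddf0; apply: cabs_eq0; apply/eqP; rewrite eq_le cabs_ge0 andbT.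
have := psd_cauchy_schwarz kinnerD kinnerZ kinnerC kinner_ge0 f (kemb [:: (1, x)]).
by rewrite -/(knorm f) f0 mul0r.
Qed.

Lemma kspace_ler_normD (f g : kspace) :
  (knorm (f + g))%:rc <= (knorm f)%:rc + (knorm g)%:rc.
Proof. by rewrite -rcD rc_le; exact: (sn_triangle kinnerD kinnerZ kinnerC kinner_ge0). Qed.

Lemma kspace_normrZ (a : R[i]) (f : kspace) : (knorm (a *: f))%:rc = `|a| * (knorm f)%:rc.
Proof. by rewrite /knorm (snZ kinnerZ kinnerC kinner_ge0) rcM cabsE. Qed.

Lemma kspace_normr0_eq0 (f : kspace) : (knorm f)%:rc = 0 -> f = 0.
Proof. by rewrite -rc0 => /rc_inj/knorm_eq0. Qed.

HB.instance Definition _ := Lmodule_isNormed.Build R[i] kspace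
  kspace_ler_normD kspace_normrZ kspace_normr0_eq0.

Lemma kspace_normE (f : kspace) : `|f| = (knorm f)%:rc.
Proof. by []. Qed.

Lemma knormD (f g : kspace) : knorm (f + g) <= knorm f + knorm g.
Proof. by have := kspace_ler_normD f g; rewrite -rcD rc_le. Qed.
Lemma knorm_sub (f g : kspace) : knorm (f - g) = knorm (g - f).
Proof. by apply: rc_inj; rewrite -!kspace_normE distrC. Qed.
Lemma knorm_tri (f g h : kspace) : knorm (f - h) <= knorm (f - g) + knorm (g - h).
Proof. by apply: le_trans (knormD _ _); rewrite addrA subrK. Qed.

Lemma kinnerBB (f f' g g' : kspace) : kinner (f - f') (g - g') =
  kinner f g - kinner f g' - kinner f' g + kinner f' g'.
Proof.
have N h h' : kinner (- h) h' = - kinner h h' by rewrite -scaleN1r kinnerZ mulN1r.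
have Nr h h' : kinner h' (- h) = - kinner h' h.
  by rewrite kinnerC N cjN -kinnerC.
have Dr h h' h'' : kinner h (h' + h'') = kinner h h' + kinner h h''.
  by rewrite kinnerC kinnerD cjD -!kinnerC.
by rewrite kinnerD N !Dr !Nr; ring.
Qed.

Lemma knorm_emb l m : knorm (kemb l - kemb m) = cdist k l m.
Proof.
rewrite /knorm /cdist /qn /sn; congr (Num.sqrt (Re _)).
by rewrite kinnerBB !kinner_emb !(kformBl, kformBr kC); ring.
Qed.

Lemma knorm_emb_cvg (f : kspace) u : krep k (val f) u -> forall e : R, 0 < e ->
  exists N, forall n, (N <= n)%N -> knorm (f - kemb (u n)) <= e.
Proof.
move=> fu e e0; have [N h] := fu.1 _ e0; exists N => n Nn.
rewrite -ler_sqr ?nnegrE ?sqrtr_ge0 ?(ltW e0) //.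
rewrite /knorm sn_sqr; last exact: kinner_ge0.
have E : krep k (val (kemb (u n))) (fun=> u n) by exact: krep_emb.
have c : ccvg (fun m => kform k (csub (u m) (u n)) (csub (u m) (u n)))
           (kinner (f - kemb (u n)) (f - kemb (u n))).
  rewrite kinnerBB.
  have := ccvgD (ccvgD (ccvgD (kinnerP fu fu) (ccvgZ (-1) (kinnerP fu E)))
     (ccvgZ (-1) (kinnerP E fu))) (kinnerP E E).
  rewrite !mulN1r => h1; apply: (tends0_le h1) => m.
  by rewrite !(kformBl, kformBr kC) !mulN1r opprB addrA [X in cabs (X - _)]addrAC.
apply: (ccvg_Re_le c); exists N => m Nm.
rewrite -(sn_sqr kP) ler_sqr ?nnegrE ?sqrtr_ge0 ?(ltW e0) //.
exact: h.
Qed.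

Lemma kspace_complete (F : set_system kspace) : ProperFilter F -> cauchy F -> cvg F.
Proof.
move=> FF /cauchyP Fc.
(* A formal combination within [1 / (n + 1)] of a set of the filter; the sequence of these
   combinations is itself Cauchy and represents the limit. *)
have ex n : exists l, F [set f | knorm (kemb l - f) <= n.+1%:R^-1].
  have e0 : (0 : R) < n.+1%:R^-1 / 2 by rewrite divr_gt0 // invr_gt0 ltr0n.
  have [|f Ff] := Fc (n.+1%:R^-1 / 2)%:rc; first by rewrite -rc0 rc_lt.
  have [u fu] := kspace_rep f; have [N h] := knorm_emb_cvg fu e0.
  exists (u N); apply: filterS Ff => g; rewrite -ball_normE /= kspace_normE rc_lt.
  move=> fg; apply: (le_trans (knorm_tri _ f _)).
  have := h _ (leqnn _); rewrite knorm_sub.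
  move: fg; move: (n.+1%:R^-1) => p; lra.
have [u uP] := choice ex.
have cu : ccau k u.
  move=> e e0; have [N h] := @tends0_inv R (e / 2) (divr_gt0 e0 (ltr0Sn _ 1)).
  exists N => n m Nn Nm; rewrite -knorm_emb.
  have [f [fn fm]] := @filter_ex _ F _ _ (filterI (uP n) (uP m)).
  apply: (le_trans (knorm_tri _ f _)); rewrite [knorm (f - _)]knorm_sub.
  have := h _ Nn; have := h _ Nm; move: fn fm => /=.
  by move: (n.+1%:R^-1) (m.+1%:R^-1) => p q; lra.
have /choice[lf lfP] x : exists c, ccvg (fun n => kform k (u n) [:: (1, x)]) c.
  exact: (kform_cauchy kC kP cu (krep_emb _).1).
have lr : krep k lf u by split.
pose l := @KSpace lf (introT (kpredP _) (ex_intro _ _ lr)).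
apply/cvg_ex; exists l; apply/cvgrPdist_lt => e /[dup] e0.
rewrite ltcE => /andP[/eqP Ime Ree].
have ree : e = (Re e)%:rc by apply: cplx_ext.
move: Ree => /= Ree.
have e3 : 0 < Re e / 3 by lra.
have [N h] := @knorm_emb_cvg l u lr _ e3; have [M h'] := @tends0_inv R _ e3.
apply: filterS (uP (maxn N M)) => f /= hf.
change (`|l - f| < e); rewrite kspace_normE ree rc_lt.
apply: (le_lt_trans (knorm_tri _ (kemb (u (maxn N M))) _)).
have := h _ (leq_maxl N M); have := h' _ (leq_maxr N M).
by move: hf; move: ((maxn N M).+1%:R^-1) => p; lra.
Qed.

HB.instance Definition _ := Uniform_isComplete.Build kspace kspace_complete.

Lemma kinner_bilinear : bilinear_for *%R (Num.conj \; *%R) kinner.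
Proof.
split=> u a x y; first exact: kinnerPl.
rewrite kinnerC kinnerPl cjD cjM -!kinnerC /=.
by rewrite cjE.
Qed.

HB.instance Definition _ := bilinear_isBilinear.Build R[i] kspace kspace R[i]
  *%R (Num.conj \; *%R) kinner kinner_bilinear.

Lemma kinner_hermitian (x y : kspace) :
  kinner x y = (-1) ^+ false * Num.conj (kinner y x).
Proof. by rewrite expr0 mul1r kinnerC cjE. Qed.

HB.instance Definition _ := isHermitianSesquilinear.Build R[i] kspace false
  Num.conj kinner kinner_hermitian.

Lemma kinner_norm (x : kspace) : kinner x x = `|x| ^+ 2.
Proof.
rewrite kspace_normE -rcX /knorm (sn_sqr kinner_ge0); apply: cplx_ext => //.
by have := congr1 (@Im R) (kinnerC x x); rewrite ImC /=; lra.
Qed.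

Lemma kinner_gt0 (x : kspace) : x != 0 -> 0 < kinner x x.
Proof.
move=> x0; rewrite kinner_norm; apply: exprn_gt0.
by rewrite normr_gt0.
Qed.

HB.instance Definition _ := isDotProduct.Build R[i] kspace kinner kinner_gt0.

HB.instance Definition _ := CompleteNormedModule_isHilbert.Build R kspace kinner_norm.

End KernelHilbert.

Definition combo {R : realType} {X : Type} {V : lmodType R[i]} (e : X -> V)
  (l : seq (R[i] * X)) : V := \sum_(a <- l) a.1 *: e a.2.

Definition total {R : realType} {X : Type} (Y : hilbertType R) (e : X -> Y) :=
  forall y (eps : R), 0 < eps -> exists l, nm (y - combo e l) <= eps.

Lemma inner_combo {R : realType} {X : Type} (Y : hilbertType R) (e : X -> Y)
    (k : X -> X -> R[i]) : (forall x y, '[e x, e y] = k x y) ->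
  forall l m, '[combo e l, combo e m] = kform k l m.
Proof.
move=> ek l m; rewrite /combo /kform inner_suml; apply: eq_bigr => p _.
rewrite inner_sumr; apply: eq_bigr => r _.
by rewrite innerZl innerZr ek mulrA.
Qed.

(** Kolmogorov decomposition (Moore-Aronszajn). The completion consists of functions on [X], so
    combinations of norm 0 are identified automatically. Dilation spaces, direct limits and induced
    modules all arise from it. *)
Theorem kernel_hilbert {R : realType} {X : Type} (k : X -> X -> R[i]) :
  (forall x y, k y x = cj (k x y)) ->
  (forall l, 0 <= Re (kform k l l)) ->
  exists (Y : hilbertType R) (e : X -> Y),
    (forall x y, '[e x, e y] = k x y) /\ total e.
Proof.
move=> kC kP; pose K := PDKernel kC kP.
pose e x : kspace K := kemb K [:: (1, x)].
have ek x y : '[e x, e y] = k x y.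
  transitivity (kinner (e x) (e y)); first by [].
  by rewrite kinner_emb /kform !big_seq1 /= mul1r cj1 mul1r.
exists (kspace K : hilbertType R), e; split=> // y eps eps0.
have [u yu] := kspace_rep y; have [N h] := knorm_emb_cvg yu eps0.
exists (u N); have := h _ (leqnn N).
suff -> : combo e (u N) = kemb K (u N) by [].
elim: (u N) => [|[a x] l IH]; first by rewrite /combo big_nil kemb_nil.
by rewrite kemb_cons /combo big_cons -/(combo e l) IH.
Qed.

Section Combos.
Context {R : realType} {X : Type}.
Implicit Types l m : seq (R[i] * X).

Lemma combo_cat (V : lmodType R[i]) (e : X -> V) l m :
  combo e (l ++ m) = combo e l + combo e m.
Proof. by rewrite /combo big_cat. Qed.

Lemma combo_scomb (V : lmodType R[i]) (e : X -> V) a l :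
  combo e (scomb a l) = a *: combo e l.
Proof.
rewrite /combo big_map scaler_sumr; apply: eq_bigr => p _.
by rewrite scalerA.
Qed.

Lemma combo_csub (V : lmodType R[i]) (e : X -> V) l m :
  combo e (csub l m) = combo e l - combo e m.
Proof. by rewrite combo_cat combo_scomb scaleN1r. Qed.

Lemma combo1 (V : lmodType R[i]) (e : X -> V) x : combo e [:: (1, x)] = e x.
Proof. by rewrite /combo big_seq1 scale1r. Qed.

Lemma lin_combo (V W : lmodType R[i]) (f : V -> W) (e : X -> V) l :
  linear f -> f (combo e l) = combo (f \o e) l.
Proof.
move=> lf; rewrite /combo (lin_sum lf); apply: eq_bigr => p _.
by rewrite (linZ lf).
Qed.

Lemma nm_combo (Y : hilbertType R) (e : X -> Y) (k : X -> X -> R[i]) l :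
  (forall x y, '[e x, e y] = k x y) -> nm (combo e l) ^+ 2 = Re (kform k l l).
Proof. by move=> ek; rewrite -Re_inner_nm (inner_combo ek). Qed.

Lemma total_extr (Y : hilbertType R) (e : X -> Y) y y' : total e ->
  (forall x, '[y, e x] = '[y', e x]) -> y = y'.
Proof.
move=> te E; apply/eqP; rewrite -subr_eq0; apply/eqP.
set z := y - y'; have zE l : '[z, combo e l] = 0.
  rewrite /combo inner_sumr big1 // => p _.
  by rewrite innerZr innerBl E subrr mulr0.
apply: nm_eq0; apply/eqP; have [//|z0] := eqVneq (nm z) 0.
have zp : 0 < nm z by rewrite lt_def z0 nm_ge0.
have [l hl] := te z (nm z / 2) (divr_gt0 zp (ltr0Sn _ 1)).
have := Re_inner_le z (z - combo e l).
rewrite innerBr zE subr0 Re_inner_nm expr2 ler_pM2l //; lra.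
Qed.

Lemma total_ext (Y Z : hilbertType R) (e : X -> Y) (f g : Y -> Z) : total e ->
  bounded_op f -> bounded_op g -> (forall x, f (e x) = g (e x)) -> f = g.
Proof.
move=> te bf bg fg; apply/funext => y; apply: inner_extl => z.
rewrite !adjP //; suff -> : adj f z = adj g z by [].
by apply: (total_extr te) => x; rewrite !adjPr // fg.
Qed.

Section ExtendOperator.
Variables (Y Z : hilbertType R) (e : X -> Y) (g : X -> Z) (c : R).
Hypotheses (te : total e) (c0 : 0 <= c).
Hypothesis ge : forall l, nm (combo g l) <= c * nm (combo e l).

Let graph y z := forall eps : R, 0 < eps ->
  exists l, nm (y - combo e l) <= eps /\ nm (z - combo g l) <= eps.

Let graph_total y : exists z, graph y z.
Proof.
have /choice[u uP] n : exists l, nm (y - combo e l) <= n.+1%:R^-1.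
  by apply: te; rewrite invr_gt0 ltr0n.
have [|z zP] := @cauchy_cvgs _ Z (fun n => combo g (u n)).
  move=> eps eps0; have c1 : 0 < 2 * (c + 1) by move: c0; lra.
  have [N h] := @tends0_inv R _ (divr_gt0 eps0 c1).
  exists N => n m Nn Nm; rewrite -combo_csub; apply: (le_trans (ge _)).
  rewrite combo_csub; apply: (@le_trans _ _ (c * (n.+1%:R^-1 + m.+1%:R^-1))).
    rewrite ler_wpM2l //; apply: (le_trans (nm_tri y _ _)); apply: lerD => //.
    by rewrite nmB.
  have := h _ Nn; have := h _ Nm; rewrite !ler_pdivlMr //.
  have P i : (0 : R) <= i.+1%:R^-1 by rewrite invr_ge0 ler0n.
  by move: (P n) (P m); move: (n.+1%:R^-1) (m.+1%:R^-1) => p q; lra.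
exists z => eps eps0; have [N h] := @tends0_inv R _ eps0.
have [M h'] := zP _ eps0; exists (u (maxn N M)); split.
  by apply: (le_trans (uP _)); exact: h (leq_maxl _ _).
by rewrite nmB; exact: h' (leq_maxr _ _).
Qed.

Let graph_lin a y z y' z' : graph y z -> graph y' z' -> graph (a *: y + y') (a *: z + z').
Proof.
move=> yz yz' eps eps0; have a1 : 0 < cabs a + 1 by have := cabs_ge0 a; lra.
have e2 : 0 < eps / 2 by lra.
have [l [h1 h2]] := yz _ (divr_gt0 e2 a1); have [m [k1 k2]] := yz' _ e2.
exists (scomb a l ++ m); rewrite !combo_cat !combo_scomb.
have E t : cabs a * (eps / 2 / (cabs a + 1)) <= t -> cabs a * (eps / 2 / (cabs a + 1)) <= t by [].
have B : cabs a * (eps / 2 / (cabs a + 1)) <= eps / 2.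
  by rewrite mulrA ler_pdivrMr // mulrC ler_wpM2l ?(ltW e2) //; lra.
split; rewrite opprD addrACA -scalerBr; apply: (le_trans (nmD _ _));
  rewrite nmZ [leRHS]splitr; apply: lerD => //; apply: le_trans B;
  by rewrite ler_wpM2l ?cabs_ge0.
Qed.

Let graph_bnd y z : graph y z -> nm z <= c * nm y.
Proof.
move=> yz; rewrite leNgt; apply/negP => lt.
have c1 : 0 < c + 1 by move: c0; lra.
(* The approximation bounds [nm z - c * nm y] by [(c + 1) * eps], which is half of its value. *)
pose eps := (nm z - c * nm y) / (2 * (c + 1)).
have eps0 : 0 < eps by rewrite divr_gt0 ?mulr_gt0 // subr_gt0.
have [l [h1 h2]] := yz _ eps0.
have E : eps * (2 * (c + 1)) = nm z - c * nm y.
  by rewrite /eps mulfVK // gt_eqF // mulr_gt0.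
have := nm_leD z (combo g l); have := ge l; have := nm_leD (combo e l) y.
rewrite (nmB (combo e l)); move: h1 h2 E eps0 c0; nra.
Qed.

(** The operator is the closure of the relation between [combo e l] and [combo g l]; the bound [ge]
    makes that closure single-valued, although the vectors [e x] may be linearly dependent. *)
Lemma extend_operator : exists G : Y -> Z,
  [/\ bounded_op G, bnd G c & forall x, G (e x) = g x].
Proof.
have uniq y z z' : graph y z -> graph y z' -> z = z'.
  move=> h h'; have := graph_lin (-1) h h'; rewrite !scaleN1r addNr => /graph_bnd.
  rewrite nm0 mulr0 => z0; apply/eqP; rewrite eq_sym -subr_eq0 addrC; apply/eqP/nm_eq0/eqP.
  by rewrite eq_le z0 nm_ge0.
have [G GP] := choice graph_total.
have lG : linear G by move=> a x y; exact: (uniq _ _ _ (GP _) (graph_lin a (GP x) (GP y))).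
have bG : bnd G c by move=> y; exact: graph_bnd.
exists G; split=> //; first by apply/bopP; split=> //; exists c.
move=> x; apply: (uniq _ _ _ (GP _)) => eps eps0; exists [:: (1, x)].
by rewrite !combo1 !subrr !nm0 ltW.
Qed.

End ExtendOperator.
End Combos.

(** * Matrix positivity *)

Section Positivity.
Context {R : realType}.
Implicit Types H K : hilbertType R.

Definition opform H (I : finType) (A : I -> I -> H -> H) (x : I -> H) : R[i] :=
  \sum_i \sum_j '[A i j (x j), x i].

(** Asking only for real parts allows matrices that are not hermitian and keeps limits in [R];
    [mx_pos_repos] recovers the order of [R[i]]. General finite index types admit the dependent sums
    of [opform_sigma]. *)
Definition repos H (I : finType) (A : I -> I -> H -> H) :=
  forall x, 0 <= Re (opform A x).

Lemma repos_reindex H (I J : finType) (h : J -> I) (A : I -> I -> H -> H) :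
  bijective h -> repos A <-> repos (fun i j => A (h i) (h j)).
Proof.
move=> bh; have E x : opform A x = opform (fun i j => A (h i) (h j)) (x \o h).
  rewrite /opform (reindex h) /=; last exact: onW_bij.
  by apply: eq_bigr => i _; rewrite (reindex h) //=; exact: onW_bij.
split=> hA x; last by rewrite E.
have [h' hK h'K] := bh.
have -> : x = (x \o h') \o h by apply/funext => i /=; rewrite hK.
by rewrite -E.
Qed.

Lemma opformD H (I : finType) (A B : I -> I -> H -> H) x :
  opform (fun i j => A i j + B i j) x = opform A x + opform B x.
Proof.
rewrite /opform -big_split; apply: eq_bigr => i _; rewrite -big_split.
by apply: eq_bigr => j _; exact: innerDl.
Qed.

Lemma opformZ H (I : finType) a (A : I -> I -> H -> H) x :
  opform (fun i j => a *: A i j) x = a * opform A x.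
Proof.
rewrite /opform mulr_sumr; apply: eq_bigr => i _; rewrite mulr_sumr.
by apply: eq_bigr => j _; exact: innerZl.
Qed.

Lemma opform_adj H (I : finType) (A : I -> I -> H -> H) x :
  (forall i j, bounded_op (A i j)) ->
  opform (fun i j => adj (A j i)) x = cj (opform A x).
Proof.
move=> bA; rewrite /opform exchange_big cj_sum; apply: eq_bigr => i _.
rewrite cj_sum; apply: eq_bigr => j _.
by rewrite adjPr // -innerC.
Qed.

Lemma mx_posE H n (A : 'M[H -> H]_n) :
  mx_pos A <-> forall x, Im (opform (fun i j => A i j) x) = 0 /\
                       0 <= Re (opform (fun i j => A i j) x).
Proof.
split=> hA x; last by have [a b] := hA x; rewrite lecE; apply/andP; split=> //; apply/eqP.
by have := hA x; rewrite lecE => /andP[/eqP ? ?].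
Qed.

(** Nonnegative real parts for both ['i *: A] and [- 'i *: A] say that the form of [A] has imaginary
    part 0. *)
Lemma mx_pos_repos H n (A : 'M[H -> H]_n) : mx_pos A <->
  [/\ repos (fun i j => A i j), repos (fun i j => 'i *: A i j) &
      repos (fun i j => (- 'i) *: A i j)].
Proof.
rewrite mx_posE; split=> [hA|[h1 h2 h3] x].
  by split=> x; have [a b] := hA x; rewrite ?opformZ ?mulNr ?ReN ?ReiM ?a ?oppr0.
split=> //; have := h2 x; have := h3 x; rewrite !opformZ mulNr ReN ReiM; lra.
Qed.

(** Polarisation: the real values at [x + y] and at [x + 'i *: y] give the imaginary and the real
    part of the identity. *)
Lemma real_form_selfadj H (T : H -> H) : linear T ->
  (forall x, Im '[T x, x] = 0) -> forall x y, '[T x, y] = '[x, T y].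
Proof.
move=> lT rT x y; rewrite (innerC (T y)).
have := rT (x + y); rewrite (linD lT) innerDl !innerDr !ImD !rT.
have := rT (x + 'i *: y); rewrite (linD lT) (linZ lT) innerDl !innerDr !innerZl !innerZr !ImD.
rewrite cj_i mulrA mulrN -expr2 sqr_i opprK mul1r !rT.
have Imi (z : R[i]) : Im ('i * z) = Re z by case: z => a b /=; rewrite mul0r mul1r add0r.
rewrite mulNr ImN !Imi => h1 h2; apply: cplx_ext; rewrite ?ReC ?ImC; lra.
Qed.

Section LinearOn.
Variables (H K : hilbertType R) (S : set (H -> H)) (phi : (H -> H) -> (K -> K)).
Hypotheses (sS : subspace S) (lphi : linear_on S phi).

Lemma linear_onD f g : S f -> S g -> phi (f + g) = phi f + phi g.
Proof. by move=> Sf Sg; have := lphi 1 Sf Sg; rewrite !scale1r. Qed.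
Lemma linear_on0 : phi 0 = 0.
Proof.
have S0 := subspace0 sS.
by apply/(addrI (phi 0)); rewrite -linear_onD // !addr0.
Qed.
Lemma linear_onZ a f : S f -> phi (a *: f) = a *: phi f.
Proof.
move=> Sf; have S0 := subspace0 sS.
by rewrite -[a *: f]addr0 lphi // linear_on0 addr0.
Qed.
Lemma linear_onB f g : S f -> S g -> phi (f - g) = phi f - phi g.
Proof.
move=> Sf Sg; rewrite linear_onD //; last exact: subspaceN.
by rewrite -scaleN1r linear_onZ // scaleN1r.
Qed.
Lemma linear_on_sum (I : Type) (r : seq I) (F : I -> H -> H) :
  (forall i, S (F i)) -> phi (\sum_(i <- r) F i) = \sum_(i <- r) phi (F i).
Proof.
move=> SF; elim: r => [|i r IH]; first by rewrite !big_nil linear_on0.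
by rewrite !big_cons linear_onD ?IH //; apply: subspace_sum.
Qed.
End LinearOn.

Section Ucoe.
Variables (H K : hilbertType R) (S : set (H -> H)) (phi : (H -> H) -> (K -> K)).
Hypothesis oS : operator_system S.

Lemma opsys_bop f : S f -> bounded_op f. Proof. by case: oS => b _ _ _; exact: b. Qed.
Lemma opsys_subspace : subspace S. Proof. by case: oS. Qed.
Lemma opsys_id : S idfun. Proof. by case: oS. Qed.
Lemma opsys_adj f : S f -> S (adj f). Proof. by case: oS => _ _ _; apply. Qed.
Let sS := opsys_subspace.

(** If [h] is selfadjoint with bound [c], then [c + h] is positive; hence the form of [phi h] is
    real and [phi h] is selfadjoint. The general case combines [f + adj f] and
    ['i *: (f - adj f)]. *)
Lemma ucoe_adj f : ucoe S phi -> S f -> phi (adj f) = adj (phi f).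
Proof.
move=> [bphi lphi phi1 pos] Sf.
have sa h : S h -> adj h = h -> forall x y, '[phi h x, y] = '[x, phi h y].
  move=> Sh ah; have [c c0 hc] := bop_bnd (opsys_bop Sh).
  have Sch : S (c%:rc *: idfun + h) by apply: sS.2 => //; exact: opsys_id.
  have /pos[_ p] : forall i j : 'I_1, S ((const_mx (c%:rc *: idfun + h) : 'M_1) i j).
    by move=> i j; rewrite mxE.
  have /p/mx_posE{}p : mx_pos (const_mx (c%:rc *: idfun + h) : 'M_1).
    apply/mx_posE => x; rewrite /opform !big_ord1 mxE.
    set y := x _; have -> : (c%:rc *: idfun + h) y = c%:rc *: y + h y by [].
    rewrite innerDl innerZl ImD ReD ImZ ReZ inner_nm mulr0 add0r; split.
      have := congr1 (@Im R) (innerC (h y) y); rewrite ImC adjP ?ah; last exact: opsys_bop.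
      by move=> E; lra.
    have := Re_geN_cabs '[h y, y]; have := cauchy_schwarz (h y) y.
    have := ler_wpM2r (nm_ge0 y) (hc y); rewrite /= -mulrA -expr2; lra.
  apply: real_form_selfadj => [|y]; first by case: (bphi _ Sh).
  have [] := p (fun=> y); rewrite /opform !big_ord1 !mxE (linear_onD lphi) //; last first.
    by apply: (subspaceZ sS); exact: opsys_id.
  rewrite (linear_onZ sS lphi) ?phi1; last exact: opsys_id.
  have -> : (c%:rc *: idfun + phi h) y = c%:rc *: y + phi h y by [].
  by rewrite innerDl innerZl inner_nm ImD ImZ mulr0 add0r.
have bf := opsys_bop Sf; have Saf := opsys_adj Sf.
have ba := bop_adj bf.
pose a := f + adj f; pose b := 'i *: (f - adj f).
have Sa : S a by exact: subspaceD.
have Sb : S b by apply: (subspaceZ sS); exact: subspaceB.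
have ci : cj 'i = - 'i :> R[i] := cj_i.
have aa : adj a = a by rewrite adjD // adjK // addrC.
have ab : adj b = b.
  rewrite adjZ; last exact: bounded_opB.
  by rewrite adjB // adjK // ci scaleNr -scalerN opprB.
have pa : phi a = phi f + phi (adj f) by rewrite (linear_onD lphi).
have pb : phi b = 'i *: (phi f - phi (adj f)).
  by rewrite (linear_onZ sS lphi) ?(linear_onB sS lphi) //; exact: subspaceB.
apply/esym/adj_uniq => [|x y]; first exact: bphi.
have := sa _ Sa aa x y; have := sa _ Sb ab x y; rewrite pa pb.
change ('['i *: (phi f x - phi (adj f) x), y] = '[x, 'i *: (phi f y - phi (adj f) y)] ->
  '[phi f x + phi (adj f) x, y] = '[x, phi f y + phi (adj f) y] ->
  '[phi f x, y] = '[x, phi (adj f) y]).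
rewrite innerZl innerZr innerBl innerBr innerDl innerDr ci mulNr -mulrN opprB.
move=> /(mulfI i_neq0) E1 E2; have := congr2 (fun u v => u + v) E1 E2.
rewrite /=; move: ('[phi f x, y]) '[phi (adj f) x, y] => u v.
move: ('[x, phi f y]) '[x, phi (adj f) y] => s t E3.
have i2 : (2 : R[i]) != 0 by rewrite pnatr_eq0.
apply: (mulfI i2); transitivity (u - v + (u + v)); first by ring.
by rewrite E3; ring.
Qed.

(** The sum of [A] and its adjoint transpose has as form twice the real part of the form of [A],
    which reduces [repos] to [mx_pos]. *)
Lemma ucoe_repos (I : finType) (A : I -> I -> H -> H) : ucoe S phi ->
  (forall i j, S (A i j)) -> repos A <-> repos (fun i j => phi (A i j)).
Proof.
move=> u SA; have [bphi lphi phi1 pos] := u.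
pose h : 'I_#|I| -> I := enum_val.
have bh : bijective h by exact: enum_val_bij.
rewrite (repos_reindex _ bh) (repos_reindex (fun i j => phi (A i j)) bh).
pose B : 'M[H -> H]_#|I| := \matrix_(i, j) (A (h i) (h j) + adj (A (h j) (h i))).
have SB i j : S (B i j).
  by rewrite mxE; apply: (subspaceD sS) => //; exact: opsys_adj.
have key (L : hilbertType R) (D : 'M[L -> L]_#|I|) (C : 'I_#|I| -> 'I_#|I| -> L -> L) :
    (forall i j, bounded_op (C i j)) ->
    (forall i j, D i j = C i j + adj (C j i)) -> mx_pos D <-> repos C.
  move=> bC DC; rewrite mx_posE.
  have E x : opform (fun i j => D i j) x = opform C x + cj (opform C x).
    rewrite -(opform_adj _ bC) -opformD; apply: eq_bigr => i _.
    by apply: eq_bigr => j _; rewrite DC.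
  split=> hC x; first by have [_] := hC x; rewrite E ReD ReC; lra.
  rewrite E ReD ImD ReC ImC subrr; split=> //; have := hC x; lra.
rewrite -(key _ B) => [|i j|i j]; last 2 first.
- exact: opsys_bop.
- by rewrite mxE.
rewrite -(key _ (map_mx phi B)) => [|i j|i j]; last 2 first.
- exact: bphi.
- by rewrite !mxE (linear_onD lphi) ?ucoe_adj //; exact: opsys_adj.
by have := pos _ _ SB; split=> ?; apply/pos.
Qed.

Lemma ucoe_intro : (forall f, S f -> bounded_op (phi f)) -> linear_on S phi ->
  phi idfun = idfun ->
  (forall n (A : 'I_n -> 'I_n -> H -> H), (forall i j, S (A i j)) ->
     repos A <-> repos (fun i j => phi (A i j))) -> ucoe S phi.
Proof.
move=> bphi lphi phi1 rp; split=> // n A SA.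
have E a : repos (fun i j => a *: A i j) <-> repos (fun i j => a *: map_mx phi A i j).
  rewrite rp => [|i j]; last exact: (subspaceZ sS).
  suff -> : (fun i j => a *: map_mx phi A i j) = (fun i j => phi (a *: A i j)) by [].
  apply/funext => i; apply/funext => j.
  by rewrite mxE (linear_onZ sS lphi).
have E1 : repos (fun i j => A i j) <-> repos (fun i j => map_mx phi A i j).
  rewrite rp //.
  suff -> : (fun i j => map_mx phi A i j) = (fun i j => phi (A i j)) by [].
  by apply/funext => i; apply/funext => j; rewrite mxE.
by split=> /mx_pos_repos[/E1 h1 /E h2 /E h3]; apply/mx_pos_repos; split.
Qed.

End Ucoe.
End Positivity.

(** * C*-algebras and *-homomorphisms *)

Section OperatorAlgebras.
Context {R : realType}.
Implicit Types H K Z : hilbertType R.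

Lemma bnd_eq0 H K (f : H -> K) : (forall e : R, 0 < e -> bnd f e) -> f = 0.
Proof.
move=> hf; apply/funext => x; apply: nm_eq0; apply/eqP.
rewrite eq_le nm_ge0 andbT leNgt; apply/negP => fx.
have x1 : 0 < nm x + 1 by have := nm_ge0 x; lra.
have := hf (nm (f x) / 2 / (nm x + 1)) (divr_gt0 (divr_gt0 fx (ltr0Sn _ 1)) x1) x.
rewrite mulrAC ler_pdivlMr // mulrDr.
have := nm_ge0 x; nra.
Qed.

Lemma op_complete H K (u : nat -> H -> K) : (forall n, bounded_op (u n)) ->
  (forall e : R, 0 < e -> exists N, forall n m, (N <= n)%N -> (N <= m)%N ->
     bnd (u n - u m) e) ->
  exists2 L, bounded_op L &
    forall e : R, 0 < e -> exists N, forall n, (N <= n)%N -> bnd (u n - L) e.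
Proof.
move=> bu cu.
have /choice[L LP] x : exists l, cvgs (fun n => u n x) l.
  apply: cauchy_cvgs => e e0; have x1 : 0 < nm x + 1 by have := nm_ge0 x; lra.
  have [N h] := cu _ (divr_gt0 e0 x1); exists N => n m Nn Nm.
  apply: (le_trans (h _ _ Nn Nm x)); rewrite mulrAC ler_pdivrMr //.
  by rewrite ler_wpM2l ?(ltW e0) //; lra.
have conv (e : R) : 0 < e -> exists N, forall n, (N <= n)%N -> bnd (u n - L) e.
  move=> e0; have [N h] := cu _ e0; exists N => n Nn x.
  change (nm (u n x - L x) <= e * nm x); apply/ler_addgt0Pr => d d0.
  have [M h'] := LP x _ d0; pose m := maxn N M.
  apply: (le_trans (nm_tri (u m x) _ _)); apply: lerD.
    exact: (h _ _ Nn (leq_maxl N M) x).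
  exact: h' (leq_maxr N M).
exists L => //.
have lL : linear L.
  move=> a x y; apply: (cvgs_uniq (LP _)).
  apply: tends0_le (tends0D (tends0Z (cabs_ge0 a) (LP x)) (LP y)) _ => n.
  rewrite (bop_lin (bu n)) opprD addrACA -scalerBr -nmZ; exact: nmD.
apply/bopP; split=> //; have [N /(_ _ (leqnn _)) h] := conv 1 ltr01.
have [c c0 uc] := bop_bnd (bu N); exists (1 + c); first lra.
have := bndD (bnd_opp h) uc.
by rewrite opprB subrK.
Qed.

Section CStar.
Variables (H : hilbertType R) (A : set (H -> H)).
Hypothesis cA : unital_cstar_subalgebra A.

Lemma cstar_opsys : operator_system A. Proof. by case: cA. Qed.
Lemma cstar_bop f : A f -> bounded_op f. Proof. exact: (opsys_bop cstar_opsys). Qed.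
Lemma cstar_subspace : subspace A. Proof. exact: (opsys_subspace cstar_opsys). Qed.
Lemma cstar_id : A idfun. Proof. exact: (opsys_id cstar_opsys). Qed.
Lemma cstar_adj f : A f -> A (adj f). Proof. exact: (opsys_adj cstar_opsys). Qed.
Lemma cstar_comp f g : A f -> A g -> A (f \o g).
Proof. by case: cA => _ m _; exact: m. Qed.
Lemma cstar_closed : op_closure A `<=` A. Proof. by case: cA. Qed.

Section SquareRoot.
Variable x : H -> H.
Hypotheses (Ax : A x) (sx : adj x = x) (x1 : bnd x 1).

(** A fixed point [y] satisfies [(1 - y)^2 = 1 - x]. The iterates are polynomials in [x], so they
    lie in [A] and commute with each other. *)
Fixpoint sqrt_seq n : H -> H :=
  if n is n.+1 then 2^-1 *: (x + (sqrt_seq n \o sqrt_seq n)) else 0.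
Fixpoint sqrt_rate n : R :=
  if n is n.+1 then 2^-1 * (1 + sqrt_rate n ^+ 2) else 0.

Let y := sqrt_seq.
Let r := sqrt_rate.
Let half : cj (2^-1 : R[i]) = 2^-1 /\ cabs (2^-1 : R[i]) = 2^-1.
Proof.
by rewrite rc_half cj_rc cabs_real ger0_norm // invr_ge0.
Qed.

Lemma sqrt_seq_mem n : A (y n).
Proof.
elim: n => [|n IH]; first exact: (subspace0 cstar_subspace).
apply: (subspaceZ cstar_subspace); apply: (subspaceD cstar_subspace) => //.
exact: cstar_comp.
Qed.
Let by_ n : bounded_op (y n). Proof. exact/cstar_bop/sqrt_seq_mem. Qed.

Lemma sqrt_seq_adj n : adj (y n) = y n.
Proof.
have bx := cstar_bop Ax.
elim: n => [|n IH]; first exact: adj0.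
have bn := bop_comp (by_ n) (by_ n).
rewrite /= adjZ; last exact: bounded_opD.
by rewrite half.1 adjD // adj_comp // IH sx.
Qed.

Lemma sqrt_seq_comm (t : H -> H) n : linear t -> t \o x = x \o t -> t \o y n = y n \o t.
Proof.
move=> lt tx; elim: n => [|n IH]; first by apply/funext => v; rewrite /= (lin0 lt).
apply/funext => v /=.
change (t (2^-1 *: (x v + y n (y n v))) = 2^-1 *: (x (t v) + y n (y n (t v)))).
rewrite (linZ lt) (linD lt); congr (_ *: (_ + _)); first exact: (congr1 (@^~ v) tx).
have E w : t (y n w) = y n (t w) by exact: (congr1 (@^~ w) IH).
by rewrite !E.
Qed.

Lemma sqrt_rate_bnd n : 0 <= r n <= 1.
Proof.
elim: n => [|n /andP[a b]]; first by rewrite lexx ler01.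
change (0 <= 2^-1 * (1 + r n ^+ 2) <= 1); have := exprn_ge0 2 a; have := exprn_ile1 2 a b.
by move=> h1 h2; apply/andP; split; lra.
Qed.

Lemma sqrt_rate_mono n : r n <= r n.+1.
Proof.
have /andP[a b] := sqrt_rate_bnd n; change (r n <= 2^-1 * (1 + r n ^+ 2)).
by have := sqr_ge0 (1 - r n); rewrite sqrrB; lra.
Qed.

Lemma sqrt_seq_bnd n : bnd (y n) (r n).
Proof.
elim: n => [|n IH]; first exact: bnd0.
have /andP[r0 _] := sqrt_rate_bnd n.
move=> v; change (nm (2^-1 *: (x v + y n (y n v))) <= 2^-1 * (1 + r n ^+ 2) * nm v).
rewrite nmZ half.2 -mulrA ler_wpM2l ?invr_ge0 // mulrDl.
apply: (le_trans (nmD _ _)); apply: lerD; first exact: x1.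
by have := bnd_comp r0 IH IH v; rewrite -expr2.
Qed.

(** As the iterates commute, the next difference is half of [y n.+1 + y n] times [y n.+1 - y n]; the
    scalar rates satisfy the same identity, so the bound propagates by induction. *)
Lemma sqrt_seq_step n : bnd (y n.+1 - y n) (r n.+1 - r n).
Proof.
elim: n => [|n IH].
  move=> v; change (nm (2^-1 *: (x v + 0) - 0) <= (2^-1 * (1 + 0 ^+ 2) - 0) * nm v).
  rewrite expr2 mul0r subr0 !addr0 mulr1 subr0 nmZ half.2 ler_wpM2l ?invr_ge0 //.
  by have := x1 v; rewrite mul1r.
have cyy w : y n.+1 (y n w) = y n (y n.+1 w).
  apply: (congr1 (@^~ w) (sqrt_seq_comm _ _ _)); first exact: bop_lin.
  by apply/esym/sqrt_seq_comm => //; exact/bop_lin/cstar_bop.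
have ln := bop_lin (by_ n); have lm := bop_lin (by_ n.+1).
have E v : (y n.+2 - y n.+1) v = 2^-1 *: ((y n.+1 + y n) ((y n.+1 - y n) v)).
  change (2^-1 *: (x v + y n.+1 (y n.+1 v)) - 2^-1 *: (x v + y n (y n v)) =
    2^-1 *: (y n.+1 (y n.+1 v - y n v) + y n (y n.+1 v - y n v))).
  rewrite -scalerBr; congr (_ *: _); rewrite (linB ln) (linB lm) cyy.
  by rewrite [RHS]addrA subrK opprD addrACA subrr add0r.
move=> v; rewrite E nmZ half.2.
have -> : r n.+2 - r n.+1 = 2^-1 * ((r n.+1 + r n) * (r n.+1 - r n)).
  transitivity (2^-1 * (1 + r n.+1 ^+ 2) - 2^-1 * (1 + r n ^+ 2)); first by [].
  by move: (r n.+1) (r n) => p q; ring.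
rewrite -mulrA ler_wpM2l ?invr_ge0 //.
have /andP[a _] := sqrt_rate_bnd n; have /andP[b _] := sqrt_rate_bnd n.+1.
exact: (bnd_comp (addr_ge0 b a) (bndD (sqrt_seq_bnd n.+1) (sqrt_seq_bnd n)) IH v).
Qed.

Lemma sqrt_seq_dist n k : bnd (y (n + k)%N - y n) (r (n + k)%N - r n).
Proof.
elim: k => [|k IH]; first by rewrite addn0 !subrr; exact: bnd0.
rewrite addnS; have := bnd_sub_trans (sqrt_seq_step (n + k)%N) IH.
by rewrite addrA subrK.
Qed.

Lemma sqrt_rate_le n m : (n <= m)%N -> r n <= r m.
Proof.
move=> nm; rewrite -(subnKC nm); elim: (m - n)%N => [|k IH]; first by rewrite addn0.
by rewrite addnS; exact: le_trans IH (sqrt_rate_mono _).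
Qed.

(* The operators y_n converge in norm, at the rate of the scalar iteration
   started from the upper bound 1 of x, to a solution of 2y = x + y^2. *)
Lemma cstar_sqrt : exists w, [/\ A w, adj w = w & w \o w = idfun - x].
Proof.
have cr (e : R) : 0 < e -> exists N, forall n m, (N <= n)%N -> (N <= m)%N -> `|r n - r m| <= e.
  move=> e0; have : has_sup (range r).
    split; first by exists (r 0%N), 0%N.
    by exists 1 => _ [n _ <-]; have /andP[] := sqrt_rate_bnd n.
  move=> hs; have [_ [N _ <-] hN] := sup_adherent e0 hs.
  have ub n : r n <= sup (range r) by apply: ub_le_sup; [case: hs|exists n].
  exists N => n m /sqrt_rate_le Nn /sqrt_rate_le Nm.
  by rewrite ler_norml; have := ub n; have := ub m => um un; apply/andP; split; lra.
have [|L bL Ly] := op_complete by_.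
  move=> e e0; have [N h] := cr _ e0; exists N => n m.
  wlog nm : n m / (m <= n)%N => [W Nn Nm|Nn Nm].
    have [/W|/ltnW/W h'] := leqP m n; first exact.
    by rewrite -opprB; apply: bnd_opp; exact: h'.
  rewrite -(subnKC nm); apply: bnd_le (sqrt_seq_dist _ _).
  by rewrite subnKC //; apply: le_trans (h _ _ Nn Nm); exact: ler_norm.
have AL : A L.
  apply/cstar_closed/op_closureP; split=> // e /Ly[N /(_ _ (leqnn _)) h].
  exists (y N); first exact: sqrt_seq_mem.
  by rewrite -opprB; exact: bnd_opp.
have aL : adj L = L.
  apply/eqP; rewrite -subr_eq0; apply/eqP/bnd_eq0 => e e0.
  have [N /(_ _ (leqnn _)) h] := Ly _ (divr_gt0 e0 (ltr0Sn _ 1)).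
  have h' : bnd (adj L - y N) (e / 2).
    rewrite -sqrt_seq_adj -adjB //; apply: bnd_adj; first exact: bounded_opB.
      by lra.
    by rewrite -opprB; exact: bnd_opp.
  by have := bnd_sub_trans h' h; rewrite -splitr.
have lL := bop_lin bL.
have EL : 2%:R *: L = x + (L \o L).
  apply/eqP; rewrite -subr_eq0; apply/eqP/bnd_eq0 => e e0.
  have [c c0 Lc] := bop_bnd bL.
  (* In the weight [c + 3], 2 pays for twice [y N.+1 - L], 1 for [y N \o (y N - L)] with [y N]
     contractive, and [c] for [(y N - L) \o L]. *)
  have ed : 0 < e / (c + 3) by rewrite divr_gt0 //; lra.
  have [N h] := Ly _ ed; have hN := h N (leqnn _); have hN1 := h N.+1 (leqnSn _).
  have ly := bop_lin (by_ N).
  have E v : (2%:R *: L - (x + (L \o L))) v = - (2%:R *: (y N.+1 - L) v)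
      + (y N ((y N - L) v) + (y N - L) (L v)).
    change (2%:R *: L v - (x v + L (L v)) = - (2%:R *: (2^-1 *: (x v + y N (y N v)) - L v))
      + (y N (y N v - L v) + (y N (L v) - L (L v)))).
    rewrite (linB ly); apply: inner_extl => z.
    by rewrite !(innerDl, innerNl, innerZl); field.
  move=> v; rewrite E; apply: (le_trans (nmD _ _)); rewrite nmN nmZ.
  have -> : cabs (2%:R : R[i]) = 2 by rewrite rc_two cabs_real ger0_norm.
  have /andP[r0 r1] := sqrt_rate_bnd N.
  have B1 := hN1 v; have B2 := sqrt_seq_bnd N ((y N - L) v).
  have B3 := hN v; have B4 := hN (L v); have B5 := Lc v.
  have B6 := nmD (y N ((y N - L) v)) ((y N - L) (L v)).
  have B7 : nm (y N ((y N - L) v)) <= e / (c + 3) * nm v.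
    by apply: (le_trans B2); rewrite -[leRHS]mul1r; apply: ler_pM; rewrite ?nm_ge0.
  have B8 : nm ((y N - L) (L v)) <= e / (c + 3) * (c * nm v).
    by apply: (le_trans B4); rewrite ler_wpM2l // ltW.
  have -> : e * nm v = e / (c + 3) * ((c + 3) * nm v).
    by rewrite mulrA mulfVK // gt_eqF //; lra.
  by move: B1 B6 B7 B8; move: (e / (c + 3)) => d; lra.
exists (idfun - L); split.
- by apply: (subspaceB cstar_subspace) => //; exact: cstar_id.
- by rewrite adjB ?adj_id ?aL //; exact: bop_id.
apply/funext => v; change (v - L v - L (v - L v) = v - x v).
have := congr1 (@^~ v) EL; change (2%:R *: L v = x v + L (L v) -> v - L v - L (v - L v) = v - x v).
move=> E2; rewrite (linB lL); apply: inner_extl => z.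
have := congr1 (fun u => '[u, z]) E2; rewrite /= !(innerDl, innerNl, innerZl) => E3.
by rewrite opprB addrA [RHS](_ : _ = '[v, z] - ('[x v, z] + '[L (L v), z]) + '[L (L v), z]);
  [rewrite -E3; ring|ring].
Qed.

End SquareRoot.
End CStar.
End OperatorAlgebras.

Section OpformContinuity.
Context {R : realType}.

Lemma opform_continuous (H : hilbertType R) (I : finType) (A : I -> I -> H -> H) x (e : R) :
  (forall i j, bounded_op (A i j)) -> 0 < e ->
  exists2 d : R, 0 < d & forall y, (forall i, nm (x i - y i) <= d) ->
    cabs (opform A x - opform A y) <= e.
Proof.
move=> bA e0.
have /choice[c cP] (p : I * I) : exists c : R, 0 <= c /\ bnd (A p.1 p.2) c.
  by have [c c0 cA] := bop_bnd (bA p.1 p.2); exists c.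
pose C := \sum_p c p; pose M := 1 + \sum_i nm (x i).
have C0 : 0 <= C by apply: sumr_ge0 => p _; case: (cP p).
have cC p : c p <= C.
  rewrite /C (bigD1 p) //= lerDl; apply: sumr_ge0 => q _; by case: (cP q).
have S0 : 0 <= \sum_i nm (x i) by apply: sumr_ge0 => i _; exact: nm_ge0.
have M1 : 1 <= M by rewrite /M; lra.
have xM i : nm (x i) + 1 <= M.
  rewrite /M addrC lerD2l (bigD1 i) //= lerDl; apply: sumr_ge0 => q _; exact: nm_ge0.
pose N : R := (#|I| * #|I|)%:R.
have N0 : 0 <= N by rewrite ler0n.
pose D := N * (2 * C * M) + 1.
have D0 : 0 < D by rewrite ltr_wpDl // !mulr_ge0 //; lra.
(* The bound 1 keeps the components of [y] below [M]; [e / D] then lets each of the [N] entries move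
   by at most [2 * C * M * (e / D)]. *)
exists (Num.min 1 (e / D)); first by rewrite lt_min ltr01 divr_gt0.
move=> y hy.
have hy1 i : nm (x i - y i) <= 1 by apply: (le_trans (hy i)); rewrite ge_min lexx.
have hye i : nm (x i - y i) <= e / D by apply: (le_trans (hy i)); rewrite ge_min lexx orbT.
have yM i : nm (y i) <= M.
  by have := nm_leD (y i) (x i); rewrite nmB; have := xM i; have := hy1 i; lra.
have T i j : cabs ('[A i j (x j), x i] - '[A i j (y j), y i]) <= 2 * C * M * (e / D).
  have [c0 cA] := cP (i, j); rewrite /= in cA.
  have -> : '[A i j (x j), x i] - '[A i j (y j), y i] =
    '[A i j (x j - y j), x i] + '[A i j (y j), x i - y i].
    by rewrite (linB (bop_lin (bA i j))) innerBl innerBr; ring.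
  apply: (le_trans (cabsD _ _)).
  have eD : 0 <= e / D by rewrite divr_ge0 // ltW.
  have -> : 2 * C * M * (e / D) = C * (e / D) * M + C * M * (e / D) by ring.
  apply: lerD; apply: (le_trans (cauchy_schwarz _ _)); apply: ler_pM; rewrite ?nm_ge0 //.
  - by apply: (le_trans (cA _)); apply: ler_pM; rewrite ?nm_ge0.
  - by have := xM i; lra.
  - by apply: (le_trans (cA _)); apply: ler_pM; rewrite ?nm_ge0.
apply: (@le_trans _ _ (N * (2 * C * M * (e / D)))).
  rewrite /opform -sumrB.
  have -> : N * (2 * C * M * (e / D)) = \sum_(i : I) \sum_(j : I) 2 * C * M * (e / D).
    by rewrite !sumr_const /N mulr_natl mulrnA.
  apply: (le_trans (cabs_sum _ _)); apply: ler_sum => i _.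
  by rewrite -sumrB; apply: (le_trans (cabs_sum _ _)); apply: ler_sum => j _.
rewrite !mulrA ler_pdivrMr // -[leRHS]mulrC ler_wpM2r ?(ltW e0) //.
by rewrite /D !mulrA lerDl.
Qed.

Lemma repos_dense (H : hilbertType R) (I : finType) (A : I -> I -> H -> H) (E : set H) :
  (forall i j, bounded_op (A i j)) ->
  (forall x, (forall i, E (x i)) -> 0 <= Re (opform A x)) ->
  forall x, (forall i (e : R), 0 < e -> exists2 y, E y & nm (x i - y) <= e) ->
  0 <= Re (opform A x).
Proof.
move=> bA pE x hx; rewrite leNgt; apply/negP => x0.
have e0 : 0 < - Re (opform A x) / 2 by lra.
have [d d0 h] := opform_continuous x bA e0.
have /choice[y yP] i : exists y, E y /\ nm (x i - y) <= d.
  by have [y ? ?] := hx i d d0; exists y.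
have := h y (fun i => (yP i).2); have := pE y (fun i => (yP i).1).
have := Re_geN_cabs (opform A x - opform A y); rewrite ReD ReN; lra.
Qed.

End OpformContinuity.

Section StarAlgebras.
Context {R : realType}.
Implicit Types H K Z : hilbertType R.

(** Norm closedness is left out because images of homomorphisms and [tro_words] are used before any
    closure is taken. *)
Definition star_algebra H (D : set (H -> H)) :=
  operator_system D /\ forall f g, D f -> D g -> D (f \o g).

Lemma sclosure_closed H (E : set H) :
  sclosed [set x | forall e : R, 0 < e -> exists2 y, E y & nm (x - y) <= e].
Proof.
move=> x hx e e0; have e2 : 0 < e / 2 by lra.
have [y hy xy] := hx _ e2; have [z Ez yz] := hy _ e2.
exists z => //; apply: (le_trans (nm_tri y _ _)); lra.
Qed.

Lemma sclosure_subspace H (E : set H) : subspace E ->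
  subspace [set x | forall e : R, 0 < e -> exists2 y, E y & nm (x - y) <= e].
Proof.
move=> sE; split=> [e e0|a x y hx hy e e0].
  by exists 0; [exact: subspace0|rewrite subrr nm0 ltW].
have a1 : 0 < cabs a + 1 by have := cabs_ge0 a; lra.
have e2 : 0 < e / 2 by lra.
have [x' Ex xx] := hx _ (divr_gt0 e2 a1); have [y' Ey yy] := hy _ e2.
exists (a *: x' + y'); first exact: sE.2.
rewrite opprD addrACA -scalerBr; apply: (le_trans (nmD _ _)).
rewrite nmZ [leRHS]splitr; apply: lerD => //.
apply: (@le_trans _ _ (cabs a * (e / 2 / (cabs a + 1)))).
  by rewrite ler_wpM2l ?cabs_ge0.
by rewrite mulrA ler_pdivrMr // mulrC ler_wpM2l ?(ltW e2) //; lra.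
Qed.

Lemma sclosure_image H K (f : H -> K) (E : set H) (F : set K) x : bounded_op f ->
  (forall y, E y -> F (f y)) ->
  (forall e : R, 0 < e -> exists2 y, E y & nm (x - y) <= e) ->
  forall e : R, 0 < e -> exists2 y, F y & nm (f x - y) <= e.
Proof.
move=> bf EF hx e e0; have [c c0 fc] := bop_bnd_gt0 bf.
have [y Ey xy] := hx _ (divr_gt0 e0 c0); exists (f y); first exact: EF.
rewrite -(linB (bop_lin bf)); apply: (le_trans (fc _)).
by rewrite mulrC -ler_pdivlMr.
Qed.

Section Cyclic.
Variables (Z : hilbertType R) (D : set (Z -> Z)) (I : finType) (A : I -> I -> Z -> Z).
Hypotheses (sD : star_algebra D) (DA : forall i j, D (A i j)).

Let positive_on (E : set Z) := [/\ subspace E, sclosed E,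
  forall d x, D d -> E x -> E (d x) &
  forall x, (forall i, E (x i)) -> 0 <= Re (opform A x)].

Let DB d : D d -> bounded_op d. Proof. exact: (opsys_bop sD.1). Qed.

(* Adjoining to E the cyclic subspace of the component of v orthogonal to E. *)
Let positive_on_extend E v :
  (forall z (b : I -> Z -> Z), (forall i, D (b i)) -> 0 <= Re (opform A (fun i => b i z))) ->
  positive_on E -> exists F, [/\ positive_on F, E `<=` F & F v].
Proof.
move=> cyc [sE cE iE pE]; have [p [Ep pid]] := projection_exists sE cE.
pose v' := v - p v.
have ov w : E w -> '[w, v'] = 0.
  by move=> Ew; rewrite innerBr -proj_selfadj pid // subrr.
pose E' := [set x | exists e d, [/\ E e, D d & x = e + d v']].
have sE' : subspace E'.
  split; first exists 0, 0.
    split; [exact: subspace0|exact: (subspace0 (opsys_subspace sD.1))|].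
    by rewrite addr0.
  move=> a x y [e [d [Ee Dd ->]]] [e' [d' [Ee' Dd' ->]]].
  exists (a *: e + e'), (a *: d + d'); split; first exact: sE.2.
    exact: (opsys_subspace sD.1).2.
  change (a *: (e + d v') + (e' + d' v') = a *: e + e' + (a *: d v' + d' v')).
  by rewrite scalerDr addrACA.
have EE' : E `<=` E'.
  move=> x Ex; exists x, 0; split=> //; first exact: (subspace0 (opsys_subspace sD.1)).
  by rewrite addr0.
have sub : E' `<=` [set x | forall e : R, 0 < e -> exists2 y, E' y & nm (x - y) <= e].
  by move=> x Ex e e0; exists x => //; rewrite subrr nm0 ltW.
exists [set x | forall e : R, 0 < e -> exists2 y, E' y & nm (x - y) <= e]; split.
- split; [exact: sclosure_subspace|exact: sclosure_closed| |].
    move=> d x Dd /= hx; apply: (sclosure_image (DB Dd) _ hx) => y [e [d' [Ee Dd' ->]]].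
    exists (d e), (d \o d'); split; [exact: iE|exact: sD.2|].
    by rewrite (linD (bop_lin (DB Dd))).
  apply: repos_dense => [i j|x hx]; first exact/DB/DA.
  have /choice[e eP] i : exists e, exists d, [/\ E e, D d & x i = e + d v'] by exact: hx.
  have /choice[d dP] := eP.
  have Ed i : E (e i) by case: (dP i).
  have Dd i : D (d i) by case: (dP i).
  have xE i : x i = e i + d i v' by case: (dP i).
  have -> : opform A x = opform A e + opform A (fun i => d i v').
    rewrite /opform -big_split; apply: eq_bigr => i _.
    rewrite -big_split; apply: eq_bigr => j _ /=.
    rewrite !xE (linD (bop_lin (DB (DA i j)))) innerDl !innerDr.
    rewrite [X in _ + X + _](_ : _ = 0) ?addr0; last first.
      rewrite -adjPr; last exact: DB.
      by rewrite ov //; apply: (iE); [exact: (opsys_adj sD.1)|exact: iE].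
    rewrite [X in _ + (X + _)](_ : _ = 0) ?add0r //.
    rewrite adjP; last exact: DB.
    rewrite adjP; last exact: DB.
    rewrite innerC ov ?cj0 //; apply: (iE); first exact: (opsys_adj sD.1).
    by apply: (iE); first exact: (opsys_adj sD.1).
  by rewrite ReD; apply: addr_ge0; [exact: (pE)|exact: (cyc)].
- by move=> x Ex; exact/sub/EE'.
apply: sub; exists (p v), idfun; split=> //; first exact: (opsys_id sD.1).
by rewrite /= addrC subrK.
Qed.

(** A finite family of vectors lies in a closed invariant subspace reached by adjoining finitely
    many cyclic subspaces, each orthogonal to the previous ones, and the form of a matrix over [D]
    splits along them. Positivity is thus tested on one vector at a time. *)
Lemma repos_cyclic :
  (forall z (b : I -> Z -> Z), (forall i, D (b i)) -> 0 <= Re (opform A (fun i => b i z))) ->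
  repos A.
Proof.
move=> cyc x.
suff H (s : seq Z) : exists E, positive_on E /\ forall z, z \in s -> E z.
  have [E [[_ _ _ pE] sE]] := H [seq x i | i <- enum I].
  by apply: pE => i; apply: sE; apply/mapP; exists i; rewrite ?mem_enum.
elim: s => [|v s [E [pE sE]]].
  exists [set 0]; split=> //; split=> [| |d x' Dd ->|y hy].
  - by split=> // a ? ? -> ->; rewrite scaler0 addr0.
  - move=> y hy; apply: nm_eq0; apply/eqP; rewrite eq_le nm_ge0 andbT.
    apply/ler_addgt0Pr => e /hy[z ->]; by rewrite subr0 add0r.
  - by rewrite (lin0 (bop_lin (DB Dd))).
  rewrite /opform big1 // => i _; rewrite big1 // => j _.
  by rewrite hy (lin0 (bop_lin (DB (DA i j)))) inner0l.
have [F [pF EF Fv]] := positive_on_extend v cyc pE.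
by exists F; split=> // z; rewrite inE => /orP[/eqP -> //|/sE/EF].
Qed.

End Cyclic.

Section StarHom.
Variables (H Z : hilbertType R) (A : set (H -> H)) (kappa : (H -> H) -> (Z -> Z)).
Hypotheses (cA : unital_cstar_subalgebra A) (hk : unital_star_hom A kappa).

Lemma hom_bop f : A f -> bounded_op (kappa f). Proof. by case: hk => b _ _ _ _; exact: b. Qed.
Lemma hom_lin : linear_on A kappa. Proof. by case: hk. Qed.
Lemma hom_id : kappa idfun = idfun. Proof. by case: hk. Qed.
Lemma hom_comp f g : A f -> A g -> kappa (f \o g) = kappa f \o kappa g.
Proof. by case: hk => _ _ _ m _; exact: m. Qed.
Lemma hom_adj f : A f -> kappa (adj f) = adj (kappa f).
Proof. by case: hk => _ _ _ _ a; exact: a. Qed.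
Let sA := cstar_subspace cA.
Lemma hom0 : kappa 0 = 0. Proof. exact: (linear_on0 sA hom_lin). Qed.
Lemma homD f g : A f -> A g -> kappa (f + g) = kappa f + kappa g.
Proof. exact: (linear_onD hom_lin). Qed.
Lemma homB f g : A f -> A g -> kappa (f - g) = kappa f - kappa g.
Proof. exact: (linear_onB sA hom_lin). Qed.
Lemma homZ a f : A f -> kappa (a *: f) = a *: kappa f.
Proof. exact: (linear_onZ sA hom_lin). Qed.

Lemma hom_image_star_algebra : star_algebra (kappa @` A).
Proof.
split; first split.
- by move=> _ [f Af <-]; exact: hom_bop.
- split; first by exists 0; [exact: subspace0|exact: hom0].
  move=> a _ _ [f Af <-] [g Ag <-]; exists (a *: f + g); first exact: sA.2.
  exact: hom_lin.
- by exists idfun; [exact: (cstar_id cA)|exact: hom_id].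
- by move=> _ [f Af <-]; exists (adj f); [exact: (cstar_adj cA)|exact: hom_adj].
move=> _ _ [f Af <-] [g Ag <-]; exists (f \o g); first exact: (cstar_comp cA).
exact: hom_comp.
Qed.

(** [c + adj c] is a positive multiple of the square of a selfadjoint [w] in [A], and [kappa]
    carries squares to squares; the form of [c + adj c] is twice the real part of that of [c]. *)
Lemma hom_pos c : A c -> (forall h, 0 <= Re '[c h, h]) -> forall z, 0 <= Re '[kappa c z, z].
Proof.
move=> Ac pc z; have bc := cstar_bop cA Ac.
have Aac := cstar_adj cA Ac; have bac := bop_adj bc.
pose c' := c + adj c.
have Ac' : A c' by exact: (subspaceD sA).
have bc' := cstar_bop cA Ac'.
have ac' : adj c' = c' by rewrite /c' adjD // adjK // addrC.
have qc' h : '[c' h, h] = (2 * Re '[c h, h])%:rc.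
  change ('[c h + adj c h, h] = (2 * Re '[c h, h])%:rc).
  rewrite innerDl adjPr // (innerC (c h)); apply: cplx_ext.
    by rewrite ReD ReC /=; lra.
  by rewrite ImD ImC subrr.
have [M M0 Mc] := bop_bnd_gt0 bc'.
pose x := idfun - M^-1%:rc *: c'.
have Ax : A x by apply: (subspaceB sA); [exact: (cstar_id cA)|exact: subspaceZ].
have bx := cstar_bop cA Ax.
have sx : adj x = x.
  by rewrite adjB ?adjZ ?cj_rc ?ac' ?adj_id //; [exact: bop_id|exact: bounded_opZ].
have qx h : '[x h, h] = (nm h ^+ 2 - M^-1 * (2 * Re '[c h, h]))%:rc.
  change ('[h - M^-1%:rc *: c' h, h] = (nm h ^+ 2 - M^-1 * (2 * Re '[c h, h]))%:rc).
  by rewrite innerBl innerZl qc' inner_nm -rcM -rcB.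
have Mi : 0 < M^-1 by rewrite invr_gt0.
have qx0 h : 0 <= Re '[x h, h].
  rewrite qx /= subr_ge0 ler_pdivrMl //.
  have := Re_inner_le (c' h) h; rewrite qc' /=; have := ler_wpM2r (nm_ge0 h) (Mc h).
  by rewrite -mulrA -expr2; lra.
have qx1 h : Re '[x h, h] <= nm h ^+ 2.
  by rewrite qx /= lerBlDr lerDl !mulr_ge0 // ltW.
(* Cauchy-Schwarz for the positive form ['[x u, v]] at [h] and [x h], whose seminorm is at most the
   norm. *)
have x1 : bnd x 1.
  move=> h; rewrite mul1r; pose s (u v : H) := '[x u, v].
  have sDl u v w : s (u + v) w = s u w + s v w by rewrite /s (linD (bop_lin bx)) innerDl.
  have sZl a u w : s (a *: u) w = a * s u w by rewrite /s (linZ (bop_lin bx)) innerZl.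
  have sC u v : s v u = cj (s u v) by rewrite /s -innerC adjP // sx.
  have := psd_cauchy_schwarz sDl sZl sC qx0 h (x h).
  have n1 u : sn s u <= nm u.
    rewrite -ler_sqr ?nnegrE ?nm_ge0 ?sqrtr_ge0 //.
    by rewrite (sn_sqr (s := s) qx0); exact: qx1.
  have := Re_le_cabs (s h (x h)); rewrite /s Re_inner_nm => A1 A2.
  have [->|hx] := eqVneq (nm (x h)) 0; first exact: nm_ge0.
  have xp : 0 < nm (x h) by rewrite lt_def hx nm_ge0.
  rewrite -(ler_pM2r xp) -expr2; apply: (le_trans A1); apply: (le_trans A2).
  by apply: ler_pM; rewrite ?sqrtr_ge0.
have [w [Aw aw ww]] := cstar_sqrt cA Ax sx x1.
have E : c' = M%:rc *: (w \o w).
  by rewrite ww /x opprB addrC subrK scalerA -rcM mulfV ?scale1r // gt_eqF.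
have Aww : A (w \o w) by exact: (cstar_comp cA).
have kc' : kappa c' = M%:rc *: (kappa w \o kappa w) by rewrite E homZ // (hom_comp Aw Aw).
have : '[kappa c' z, z] = (2 * Re '[kappa c z, z])%:rc.
  rewrite homD // hom_adj //.
  change ('[kappa c z + adj (kappa c) z, z] = (2 * Re '[kappa c z, z])%:rc).
  have bk := hom_bop Ac; rewrite innerDl adjPr // (innerC (kappa c z)); apply: cplx_ext.
    by rewrite ReD ReC /=; lra.
  by rewrite ImD ImC subrr.
have -> : '[kappa c' z, z] = '[M%:rc *: kappa w (kappa w z), z] by rewrite kc'.
have bw := hom_bop Aw.
rewrite innerZl adjP // -hom_adj // aw inner_nm -rcM => /rc_inj E2.
have : 0 <= M * nm (kappa w z) ^+ 2 by rewrite mulr_ge0 ?sqr_ge0 // ltW.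
by rewrite E2; lra.
Qed.

(** On a family [kappa (b i) z] the form collapses to the quadratic form of a single algebra
    element; this links [repos_cyclic] to [hom_pos], and matrix order to vector states. *)
Lemma opform_hom (I : finType) (a : I -> I -> H -> H) (b : I -> H -> H) z :
  (forall i j, A (a i j)) -> (forall i, A (b i)) ->
  opform (fun i j => kappa (a i j)) (fun i => kappa (b i) z) =
  '[kappa (\sum_i \sum_j (adj (b i) \o (a i j \o b j))) z, z].
Proof.
move=> Aa Ab.
have At i j : A (adj (b i) \o (a i j \o b j)).
  apply: (cstar_comp cA (cstar_adj cA (Ab i))); exact: (cstar_comp cA).
have sumE (L : hilbertType R) (F : I -> I -> L -> L) h :
    (\sum_i \sum_j F i j) h = \sum_i \sum_j F i j h.
  elim/big_ind2 : _ => // [? u ? v <- <- //|i _].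
  by elim/big_ind2 : _ => // ? u ? v <- <-.
rewrite (linear_on_sum sA hom_lin) => [|i]; last by apply: (subspace_sum sA).
under eq_bigr => i _ do rewrite (linear_on_sum sA hom_lin) //.
rewrite sumE inner_suml; apply: eq_bigr => i _.
rewrite inner_suml; apply: eq_bigr => j _.
have Aaj := cstar_adj cA (Ab i).
rewrite (hom_comp Aaj (cstar_comp cA (Aa i j) (Ab j))) (hom_comp (Aa i j) (Ab j)).
by rewrite (hom_adj (Ab i)) /= adjPr //; exact: hom_bop.
Qed.

End StarHom.

Lemma hom_idfun H (A : set (H -> H)) : unital_cstar_subalgebra A -> unital_star_hom A id.
Proof. by move=> cA; split=> // f Af; exact: (cstar_bop cA). Qed.

Section StarHomBound.
Variables (H Z : hilbertType R) (A : set (H -> H)) (kappa : (H -> H) -> (Z -> Z)).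
Hypotheses (cA : unital_cstar_subalgebra A) (hk : unital_star_hom A kappa).
Let sA := cstar_subspace cA.

Lemma hom_repos (I : finType) (a : I -> I -> H -> H) : (forall i j, A (a i j)) ->
  repos a -> repos (fun i j => kappa (a i j)).
Proof.
move=> Aa pa; apply: (repos_cyclic (hom_image_star_algebra cA hk)) => [i j|z b hb].
  by exists (a i j).
have /choice[b' bP] i : exists f, A f /\ kappa f = b i.
  by have [f Af <-] := hb i; exists f.
have Ab i := (bP i).1.
have -> : (fun i => b i z) = (fun i => kappa (b' i) z).
  by apply/funext => i; rewrite (bP i).2.
rewrite (opform_hom cA hk) //; apply: (hom_pos cA hk) => [|h].
  do 2!apply: (subspace_sum sA) => ? _.
  apply: (cstar_comp cA (cstar_adj cA (Ab _))); exact: (cstar_comp cA).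
by rewrite -(opform_hom cA (hom_idfun cA)).
Qed.

(** The form of [C ^+ 2 - adj a \o a] is nonnegative, and [hom_pos] transports this. *)
Lemma hom_bnd a (C : R) : A a -> 0 <= C -> bnd a C -> bnd (kappa a) C.
Proof.
move=> Aa C0 aC z.
have Aaa : A (adj a \o a) by apply: (cstar_comp cA) => //; exact: (cstar_adj cA).
have Ad : A ((C ^+ 2)%:rc *: idfun - (adj a \o a)).
  by apply: (subspaceB sA) => //; apply: (subspaceZ sA); exact: (cstar_id cA).
have ba := cstar_bop cA Aa; have bk := hom_bop hk Aa.
have E (L : hilbertType R) (t : L -> L) h : bounded_op t ->
    Re '[((C ^+ 2)%:rc *: idfun - (adj t \o t)) h, h] = C ^+ 2 * nm h ^+ 2 - nm (t h) ^+ 2.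
  move=> bt; change (Re '[(C ^+ 2)%:rc *: h - adj t (t h), h] = C ^+ 2 * nm h ^+ 2 - nm (t h) ^+ 2).
  by rewrite innerBl innerZl adjPr // !inner_nm -rcM -rcB.
have pos h : 0 <= Re '[((C ^+ 2)%:rc *: idfun - (adj a \o a)) h, h].
  by rewrite E // subr_ge0 -exprMn ler_sqr ?nnegrE ?nm_ge0 ?mulr_ge0 ?nm_ge0.
have := hom_pos cA hk Ad pos z.
have Ai := cstar_id cA; have AiC := subspaceZ sA (C ^+ 2)%:rc Ai.
rewrite (homB cA hk AiC Aaa) (homZ cA hk _ Ai) (hom_id hk).
rewrite (hom_comp hk (cstar_adj cA Aa) Aa) (hom_adj hk Aa).
by rewrite E // subr_ge0 -exprMn ler_sqr ?nnegrE ?nm_ge0 ?mulr_ge0 ?nm_ge0.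
Qed.

Lemma hom_closure (P : set (H -> H)) f : P `<=` A -> op_closure P f ->
  op_closure (kappa @` P) (kappa f).
Proof.
move=> PA /[dup] Pf /op_closureP[bf hf].
have Af : A f by apply: (cstar_closed cA); exact: op_closureS Pf.
apply/op_closureP; split=> [|e e0]; first exact: (hom_bop hk).
have [g Pg fg] := hf _ e0; exists (kappa g); first by exists g.
have Ag := PA _ Pg.
by rewrite -(homB cA hk) //; apply: hom_bnd => //; [exact: subspaceB|exact: ltW].
Qed.

End StarHomBound.

Section Generated.
Variables (H : hilbertType R) (S : set (H -> H)).

Lemma bop_cstar : unital_cstar_subalgebra (@bounded_op R H H).
Proof.
split; [split|exact: bop_comp|by move=> f; exact: op_closure_bop].
- by [].
- exact: bop_subspace.
- exact: bop_id.
- exact: bop_adj.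
Qed.

Lemma generated_cstar : S `<=` @bounded_op R H H -> unital_cstar_subalgebra (cstar_generated S).
Proof.
move=> bS; have bop f : cstar_generated S f -> bounded_op f.
  by apply; split=> //; exact: bop_cstar.
split; [split|move=> f g hf hg A [cA SA]|].
- exact: bop.
- split=> [A [cA SA]|a f g hf hg A [cA SA]]; first exact: (subspace0 (cstar_subspace cA)).
  by apply: (cstar_subspace cA).2; [exact: hf|exact: hg].
- by move=> A [cA SA]; exact: (cstar_id cA).
- by move=> f hf A [cA SA]; apply: (cstar_adj cA); exact: hf.
- by apply: (cstar_comp cA); [exact: hf|exact: hg].
move=> f hf A [cA SA]; apply: (cstar_closed cA).
by apply: op_closureS hf => g; apply.
Qed.

Lemma sub_generated f : S f -> cstar_generated S f.
Proof. by move=> Sf A [_]; apply. Qed.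

Lemma generated_sub (A : set (H -> H)) : unital_cstar_subalgebra A -> S `<=` A ->
  cstar_generated S `<=` A.
Proof. by move=> cA SA f; apply. Qed.

End Generated.
End StarAlgebras.

(** * Extension of positive functionals and dilations *)

Section RieszExtension.
Context {R : realType} (V : lmodType R[i]) (C : set V).
Hypothesis C0 : C 0.
Hypothesis CD : forall v w, C v -> C w -> C (v + w).
Hypothesis CZ : forall (r : R) v, 0 <= r -> C v -> C (r%:rc *: v).
Implicit Types G : set (V * R).

(* Graphs of real-linear functionals on real subspaces, nonnegative on the cone;
   they are single-valued because 0 lies in the cone. *)
Definition pos_graph G := [/\ G (0, 0),
  forall (r : R) p q, G p -> G q -> G (r%:rc *: p.1 + q.1, r * p.2 + q.2) &
  forall p, G p -> C p.1 -> 0 <= p.2].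

Section PosGraph.
Variable G : set (V * R).
Hypothesis pG : pos_graph G.
Lemma pos_graphD v w r s : G (v, r) -> G (w, s) -> G (v + w, r + s).
Proof. by case: pG => _ GP _ Gv Gw; have := GP 1 _ _ Gv Gw; rewrite rc1 scale1r mul1r. Qed.
Lemma pos_graphZ (t : R) v r : G (v, r) -> G (t%:rc *: v, t * r).
Proof. by case: pG => G0 GP _ Gv; have := GP t _ _ Gv G0; rewrite /= !addr0. Qed.
Lemma pos_graphN v r : G (v, r) -> G (- v, - r).
Proof. by move=> /(pos_graphZ (-1)); rewrite rcN scaleN1r mulN1r. Qed.
Lemma pos_graph_ge0 v r : G (v, r) -> C v -> 0 <= r.
Proof. by case: pG => _ _ GP /GP; apply. Qed.
Lemma pos_graph_le v w r s : G (v, r) -> G (w, s) -> C (w - v) -> r <= s.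
Proof.
move=> Gv Gw Cwv; rewrite -subr_ge0; apply: (pos_graph_ge0 _ Cwv).
by apply: pos_graphD => //; exact: pos_graphN.
Qed.
Lemma pos_graph_fun v r s : G (v, r) -> G (v, s) -> r = s.
Proof.
move=> Gr Gs; apply/eqP; rewrite eq_le.
by rewrite (pos_graph_le Gr Gs) ?(pos_graph_le Gs Gr) // subrr.
Qed.
End PosGraph.

(** The new value has to separate the values at elements of [G] below [v] from those at elements
    above [v]; the supremum of the former does. [q] makes [L] nonempty and [p] bounds it. *)
Lemma riesz_extension_step G v p q : pos_graph G -> G p -> G q ->
  C (p.1 - v) -> C (v - q.1) ->
  exists a, pos_graph [set x | exists (t : R) y, G y /\ x = (t%:rc *: v + y.1, t * a + y.2)].
Proof.
case: p q => [p rp] [q rq] pG Gp Gq /= Cp Cq.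
pose L := [set s | exists w, G (w, s) /\ C (v - w)].
have ubL w s : G (w, s) -> C (w - v) -> ubound L s.
  move=> Gw Cw t [w' [Gw' Cw']]; apply: (pos_graph_le pG Gw' Gw).
  by rewrite -(subrK v w) -addrA; exact: CD.
have hL : has_sup L by split; [exists rq, q|exists rp; exact: ubL Gp Cp].
exists (sup L); have [G0 GP Gpos] := pG; split.
- exists 0, (0, 0); split=> //=.
  by rewrite rc0 scale0r mul0r !addr0.
- move=> r x y [t [x' [Gx ->]]] [u [y' [Gy ->]]] /=.
  exists (r * t + u), (r%:rc *: x'.1 + y'.1, r * x'.2 + y'.2); split; first exact: GP.
  congr pair => /=; last by ring.
  by rewrite rcD rcM scalerDl scalerDr !scalerA addrACA.
move=> _ [t [[w s] [Gw ->]]] /= Cw.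
have [t0|t0|t0] := ltgtP t 0.
- have t1 : 0 < - t by rewrite oppr_gt0.
  have t1' : 0 <= (- t)^-1 by rewrite invr_ge0 ltW.
  have Gw' := pos_graphZ pG (- t)^-1 Gw.
  have : sup L <= (- t)^-1 * s.
    apply: ge_sup; first by case: hL.
    apply: ubL Gw' _; have := CZ t1' Cw; rewrite scalerDr scalerA -rcM.
    have -> : (- t)^-1 * t = -1.
      by rewrite -[X in _ * X]opprK mulrN mulVf // gt_eqF.
    by rewrite rcN scaleN1r addrC.
  by rewrite mulrC ler_pdivlMr //; lra.
- have t1' : 0 <= t^-1 by rewrite invr_ge0 ltW.
  have Gw' := pos_graphN pG (pos_graphZ pG t^-1 Gw).
  have : - (t^-1 * s) <= sup L.
    apply: ub_le_sup; first by case: hL.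
    exists (- (t^-1%:rc *: w)); split=> //; have := CZ t1' Cw.
    by rewrite opprK scalerDr scalerA -rcM mulVf ?gt_eqF // scale1r.
  move=> h; have := ler_wpM2l (ltW t0) h.
  by rewrite mulrN mulrA mulfV ?gt_eqF // mul1r; lra.
by move: Cw; rewrite t0 rc0 scale0r add0r mul0r add0r => Cw; exact: (pos_graph_ge0 pG Gw Cw).
Qed.

Theorem riesz_extension G0 : pos_graph G0 -> exists G, [/\ pos_graph G, G0 `<=` G &
  forall v, (exists p, G0 p /\ C (p.1 - v)) -> (exists p, G0 p /\ C (v - p.1)) ->
    exists r, G (v, r)].
Proof.
(* The union with [G0] takes care of the empty chain: its union is empty, whereas a [pos_graph]
   contains [(0, 0)]. *)
move=> pG0; have [|A [PA maxA]] := @Zorn_bigcup _ [set G | pos_graph (G `|` G0)].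
  move=> F FP tF; split.
  - by right; case: pG0.
  - move=> r p q.
    have case1 X Y : F X -> F Y -> (X `|` G0) p -> (Y `|` G0) q ->
        (\bigcup_(X in F) X `|` G0) (r%:rc *: p.1 + q.1, r * p.2 + q.2).
      move=> FX FY Xp Yq.
      wlog XY : X Y FX FY Xp Yq / X `<=` Y \/ Y `<=` X.
        by move=> W; apply: (W X Y) => //; exact: tF.
      have [Z [FZ Zp Zq]] : exists Z, [/\ F Z, (Z `|` G0) p & (Z `|` G0) q].
        case: XY => s.
          by exists Y; split=> //; case: Xp => [/s ?|?]; [left|right].
        by exists X; split=> //; case: Yq => [/s ?|?]; [left|right].
      have [_ ZP _] := FP _ FZ.
      by have [h|h] := ZP r _ _ Zp Zq; [left; exists Z|right].
    move=> [[X FX Xp]|G0p] [[Y FY Yq]|G0q].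
    + by apply: (case1 X Y) => //; left.
    + by apply: (case1 X X) => //; [left|right].
    + by apply: (case1 Y Y) => //; [right|left].
    + by right; case: pG0 => _ GP _; exact: GP.
  - move=> p [[X FX Xp]|G0p]; last by case: pG0 => _ _; apply.
    by have [_ _ XP] := FP _ FX; apply: XP; left.
exists (A `|` G0); split; [exact: PA|by move=> p ?; right|].
move=> v [p [Gp Cp]] [q [Gq Cq]].
have [//|no] := pselect (exists r, (A `|` G0) (v, r)).
have [a pB] := riesz_extension_step (v := v) PA (or_intror Gp) (or_intror Gq) Cp Cq.
set B := [set x | _] in pB.
have AB : (A `|` G0) `<=` B.
  move=> [w s] Aw; exists 0, (w, s); split=> //=.
  by rewrite rc0 scale0r mul0r !add0r.
have G0B : G0 `<=` B by move=> x G0x; apply: AB; right.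
case: (maxA B).
  split; first by move=> x Ax; apply: AB; left.
  move=> BA; apply: no; exists a; left; apply: BA; exists 1, (0, 0); split=> /=.
    by case: PA.
  by rewrite rc1 scale1r mul1r !addr0.
by rewrite /= setUidl.
Qed.

End RieszExtension.

Lemma inner_preserving_linear (R : realType) (H K : hilbertType R) (V : H -> K) :
  (forall x y, '[V x, V y] = '[x, y]) -> linear V.
Proof.
move=> VI a x y; apply/eqP; rewrite -subr_eq0; apply/eqP/nm_eq0/eqP.
rewrite -sqrf_eq0 -Re_inner_nm.
rewrite !(innerDl, innerDr, innerNl, innerNr, innerZl, innerZr, VI).
set z := (X in Re X); suff -> : z = 0 by [].
by rewrite /z; ring.
Qed.

Lemma total_adj (R : realType) (X : Type) (Y : hilbertType R) (e : X -> Y)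
    (f g : Y -> Y) : total e -> bounded_op f -> bounded_op g ->
  (forall x y, '[f (e x), e y] = '[e x, g (e y)]) -> adj f = g.
Proof.
move=> te bf bg fg; apply: (total_ext te) => [|//|y]; first exact: bop_adj.
by apply: (total_extr te) => x; rewrite adjPr // innerC fg -innerC.
Qed.

Lemma big_subseq_uniq (T : eqType) (V : nmodType) (F : T -> V) (s s' : seq T) :
  uniq s -> uniq s' -> {subset s <= s'} ->
  (forall a, a \notin s -> F a = 0) -> \sum_(a <- s') F a = \sum_(a <- s) F a.
Proof.
move=> us us' ss F0; rewrite (bigID (mem s)) /= [X in _ + X]big1 ?addr0 => [|a /F0 //].
rewrite -big_filter; apply: perm_big; apply: uniq_perm; rewrite ?filter_uniq //.
by move=> a; rewrite mem_filter; case: (boolP (a \in s)) => //= /ss ->.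
Qed.

(** * Stinespring dilation of unital completely positive maps on operator systems *)

Section Dilation.
Context {R : realType} (H K : hilbertType R).
Variables (S : set (H -> H)) (theta : (H -> H) -> (K -> K)).
Hypothesis oS : operator_system S.
Hypothesis lth : linear_on S theta.
Hypothesis th1 : theta idfun = idfun.
Hypothesis thpos : forall n (A : 'I_n -> 'I_n -> H -> H),
  (forall i j, S (A i j)) -> repos A -> repos (fun i j => theta (A i j)).
Let sS := opsys_subspace oS.

(* A function v on K x K with values in B(H) stands for the formal sum of the
   v x y (x) (x, y); finitely supported ones pair with theta by the sum of the
   <theta (v x y) x, y>. *)
Notation V := (K -> K -> H -> H).
Implicit Types (v : V).

(** A list [l] encodes the finitely supported map from [K] to [H] with values [part l x]; positivity
    against all lists makes [v] a positive definite operator-valued kernel on [K]. *)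
Definition vform v (l : seq (K * H)) : R[i] := \sum_(a <- l) \sum_(b <- l) '[v a.1 b.1 a.2, b.2].
Definition vcone : set V := [set v | forall l, 0 <= Re (vform v l)].

Lemma vformP c v w l : vform (c *: v + w) l = c * vform v l + vform w l.
Proof.
rewrite /vform mulr_sumr -big_split; apply: eq_bigr => a _ /=.
rewrite mulr_sumr -big_split; apply: eq_bigr => b _ /=.
by rewrite -innerZl -innerDl.
Qed.
Lemma vformD v w l : vform (v + w) l = vform v l + vform w l.
Proof. by rewrite -[v]scale1r vformP mul1r scale1r. Qed.
Lemma vform0 l : vform 0 l = 0.
Proof. by rewrite /vform big1 // => a _; rewrite big1 // => b _; exact: inner0l. Qed.
Lemma vformZ c v l : vform (c *: v) l = c * vform v l.
Proof. by rewrite -[c *: v]addr0 vformP vform0 addr0. Qed.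
Lemma vformN v l : vform (- v) l = - vform v l.
Proof. by rewrite -scaleN1r vformZ mulN1r. Qed.
Lemma vform_sum (I : Type) (r : seq I) (F : I -> V) l :
  vform (\sum_(i <- r) F i) l = \sum_(i <- r) vform (F i) l.
Proof. exact: (big_morph (vform^~ l) (fun v w => vformD v w l) (vform0 l)). Qed.

Definition tens (d : H -> H) (x y : K) : V :=
  fun u w => ((u == x) && (w == y))%:R *: d.
Definition part (l : seq (K * H)) (x : K) : H := \sum_(a <- l) (a.1 == x)%:R *: a.2.

Lemma tensP c d d' x y : tens (c *: d + d') x y = c *: tens d x y + tens d' x y.
Proof.
apply/funext => u; apply/funext => w; rewrite /tens.
change (((u == x) && (w == y))%:R *: (c *: d + d') =
  c *: (((u == x) && (w == y))%:R *: d) + ((u == x) && (w == y))%:R *: d').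
by rewrite scalerDr !scalerA mulrC.
Qed.
Lemma tens0 x y : tens 0 x y = 0.
Proof. by apply/funext => u; apply/funext => w; rewrite /tens scaler0. Qed.
Lemma tensZ c d x y : tens (c *: d) x y = c *: tens d x y.
Proof. by rewrite -[c *: d]addr0 tensP tens0 addr0. Qed.

Lemma vform_tens d x y l : linear d -> vform (tens d x y) l = '[d (part l x), part l y].
Proof.
move=> ld; rewrite /part (lin_sum ld) inner_suml; apply: eq_bigr => a _.
rewrite inner_sumr; apply: eq_bigr => b _; rewrite (linZ ld) innerZr !innerZl.
by case: (a.1 == x); case: (b.1 == y); rewrite /= ?cj1 ?cj0; ring.
Qed.

Lemma vcone0 : vcone 0. Proof. by move=> l; rewrite vform0. Qed.
Lemma vconeD v w : vcone v -> vcone w -> vcone (v + w).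
Proof. by move=> hv hw l; rewrite vformD ReD addr_ge0. Qed.
Lemma vconeZ (r : R) v : 0 <= r -> vcone v -> vcone (r%:rc *: v).
Proof. by move=> r0 hv l; rewrite vformZ ReZ mulr_ge0. Qed.

Definition vsum v (s : seq K) : R[i] := \sum_(a <- s) \sum_(b <- s) '[theta (v a b) a, b].
Definition vsupp v (s : seq K) := forall x y, ~~ ((x \in s) && (y \in s)) -> v x y = 0.
Definition vgraph : set (V * R) := [set p | exists s,
  [/\ uniq s, vsupp p.1 s, forall x y, S (p.1 x y) & p.2 = Re (vsum p.1 s)]].

Let th0 : theta 0 = 0. Proof. exact: (linear_on0 sS lth). Qed.

Lemma vsum_extend v (s s' : seq K) : uniq s -> uniq s' -> {subset s <= s'} -> vsupp v s ->
  vsum v s' = vsum v s.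
Proof.
move=> us us' ss vs; rewrite /vsum.
have z a b : ~~ ((a \in s) && (b \in s)) -> '[theta (v a b) a, b] = 0.
  by move=> /vs ->; rewrite th0 inner0l.
rewrite (big_subseq_uniq us us' ss) => [|a as'].
  by apply: eq_bigr => a _; apply: big_subseq_uniq => // b bs; rewrite z // (negbTE bs) andbF.
by rewrite big1 // => b _; rewrite z // (negbTE as').
Qed.

Lemma vsuppS v (s s' : seq K) : {subset s <= s'} -> vsupp v s -> vsupp v s'.
Proof.
move=> ss vs x y h; apply: vs; apply: contra h => /andP[/ss -> /ss ->]; by [].
Qed.

Lemma vsumP c v w s : (forall x y, S (v x y)) -> (forall x y, S (w x y)) ->
  vsum (c *: v + w) s = c * vsum v s + vsum w s.
Proof.
move=> Sv Sw; rewrite /vsum mulr_sumr -big_split; apply: eq_bigr => a _ /=.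
rewrite mulr_sumr -big_split; apply: eq_bigr => b _ /=.
change ('[theta (c *: v a b + w a b) a, b] = c * '[theta (v a b) a, b] + '[theta (w a b) a, b]).
by rewrite lth // -innerZl -innerDl.
Qed.

Lemma vgraph_lin c v w s s' : uniq s -> uniq s' -> vsupp v s -> vsupp w s' ->
  (forall x y, S (v x y)) -> (forall x y, S (w x y)) ->
  exists t, [/\ uniq t, vsupp (c *: v + w) t, forall x y, S ((c *: v + w) x y) &
    vsum (c *: v + w) t = c * vsum v s + vsum w s'].
Proof.
move=> us us' vs ws Sv Sw; pose t := undup (s ++ s').
have ut : uniq t by exact: undup_uniq.
have st : {subset s <= t} by move=> a h; rewrite mem_undup mem_cat h.
have st' : {subset s' <= t} by move=> a h; rewrite mem_undup mem_cat h orbT.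
exists t; split=> //; last first.
- by rewrite vsumP // (vsum_extend us ut st vs) (vsum_extend us' ut st' ws).
- by move=> x y; exact: sS.2.
move=> x y h; change (c *: v x y + w x y = 0).
by rewrite (vsuppS st vs h) (vsuppS st' ws h) scaler0 addr0.
Qed.

(** Along an enumeration of the support the cone condition makes the matrix [v (x j) (x i)]
    positive; complete positivity of [theta], evaluated at the support vectors themselves, is then
    the claim. *)
Lemma vgraph_pos : pos_graph vcone vgraph.
Proof.
split.
- exists [::]; split=> //; last by rewrite /vsum big_nil.
  by move=> x y; exact: (subspace0 sS).
- move=> r [v rv] [w rw] [s [us vs Sv ->]] [s' [us' ws Sw ->]] /=.
  have [t [ut ht St E]] := vgraph_lin r%:rc us us' vs ws Sv Sw.
  by exists t; split=> //=; rewrite E ReD ReZ.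
move=> [v r] [s [us vs Sv ->]] /= cv.
pose n := size s; pose x (i : 'I_n) : K := tnth (in_tuple s) i.
have /thpos : forall i j : 'I_n, S (v (x j) (x i)) by [].
have E (W : hilbertType R) (F : K -> K -> W -> W) (z : 'I_n -> W) :
    opform (fun i j => F (x j) (x i)) z =
    \sum_(a <- [seq (x i, z i) | i <- enum 'I_n]) \sum_(b <- [seq (x i, z i) | i <- enum 'I_n])
      '[F a.1 b.1 a.2, b.2].
  rewrite /opform exchange_big big_map big_enum; apply: eq_bigr => j _.
  by rewrite big_map big_enum.
have /[swap]/[apply] : repos (fun i j : 'I_n => v (x j) (x i)) by move=> z; rewrite E; exact: cv.
move=> /(_ x); rewrite (E _ (fun a b => theta (v a b))); congr (0 <= Re _).
rewrite /vsum big_map big_enum (big_tnth _ _ s); apply: eq_bigr => j _.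
by rewrite big_map big_enum (big_tnth _ _ s).
Qed.

Lemma vgraph_tens d x y : S d -> vgraph (tens d x y, Re '[theta d x, y]).
Proof.
move=> Sd; pose s := undup [:: x; y].
have us : uniq s by exact: undup_uniq.
have xs : x \in s by rewrite mem_undup mem_head.
have ys : y \in s by rewrite mem_undup !inE eqxx orbT.
exists s; split=> //.
- move=> u w h; rewrite /= /tens; case: eqP => [ux|_]; last by rewrite scale0r.
  case: eqP => [wy|_]; last by rewrite scale0r.
  by move: h; rewrite ux wy xs ys.
- by move=> u w; exact: (subspaceZ sS).
rewrite /= /vsum (bigD1_seq x) //= (bigD1_seq y) //=.
have z u w : ~~ ((u == x) && (w == y)) -> '[theta (tens d x y u w) u, w] = 0.
  by rewrite /tens => /negbTE ->; rewrite scale0r th0 inner0l.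
rewrite [X in _ + X + _]big1 => [|b by']; last by rewrite z // (negbTE by') andbF.
rewrite [X in _ + X]big1 => [|a ax]; last first.
  by rewrite big1 // => b _; rewrite z // (negbTE ax).
by rewrite !addr0 /tens !eqxx scale1r.
Qed.

(** If [d] has bound [c], then [cabs '[d h, k]] is at most [c * nm h ^+ 2 + c * nm k ^+ 2]; so [c]
    times the units at [(x, x)] and [(y, y)] dominates. This is the cofinality that Riesz extension
    requires. *)
Lemma vgraph_dominates d x y : bounded_op d ->
  (exists p, vgraph p /\ vcone (p.1 - tens d x y)) /\
  (exists p, vgraph p /\ vcone (tens d x y - p.1)).
Proof.
move=> bd; have [c c0 dc] := bop_bnd bd; have ld := bop_lin bd.
have SI := opsys_id oS; have pG := vgraph_pos.
have [_ GP _] := pG.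
have G1 := GP c _ _ (vgraph_tens x x SI) (pos_graphZ pG c (vgraph_tens y y SI)).
have G2 := pos_graphN pG G1; rewrite /= in G1 G2.
have bound l : cabs '[d (part l x), part l y] <=
    c * nm (part l x) ^+ 2 + c * nm (part l y) ^+ 2.
  apply: (le_trans (cauchy_schwarz _ _)).
  have := ler_wpM2r (nm_ge0 (part l y)) (dc (part l x)).
  move: (nm (part l x)) (nm (part l y)) (nm (d _)) => p q t h.
  apply: (le_trans h); rewrite -mulrA -mulrDr ler_wpM2l //.
  by have := sqr_ge0 (p - q); rewrite sqrrB; have := sqr_ge0 p; have := sqr_ge0 q; lra.
have E l : vform (c%:rc *: tens idfun x x + c%:rc *: tens idfun y y) l =
    (c * nm (part l x) ^+ 2 + c * nm (part l y) ^+ 2)%:rc.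
  by rewrite vformP vformZ !vform_tens // !inner_nm -!rcM -rcD.
split; [eexists; split; first exact: G1|eexists; split; first exact: G2] => /=.
  move=> l; rewrite vformD vformN E vform_tens // ReD ReN /=.
  by have := bound l; have := Re_le_cabs '[d (part l x), part l y]; lra.
move=> l; rewrite opprK vformD E vform_tens // ReD /=.
by have := bound l; have := Re_geN_cabs '[d (part l x), part l y]; lra.
Qed.

Section Functional.
Variable G : set (V * R).
Hypothesis pG : pos_graph vcone G.
Hypothesis sG : vgraph `<=` G.
Hypothesis dG : forall d x y, bounded_op d -> exists r, G (tens d x y, r).

Definition vfun v : R := xget 0 [set r | G (v, r)].
Lemma vfunE v r : G (v, r) -> vfun v = r.
Proof.
move=> Gv; rewrite /vfun; case: xgetP => [t _ Gt|/(_ _ Gv) //].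
exact: (pos_graph_fun vcone0 pG Gt Gv).
Qed.

Definition vadm v := (exists r, G (v, r)) /\ (exists r, G ('i *: v, r)).
(** The complex-linear functional with real part [vfun]. The domain of [G] is a real subspace, so
    [vadm] asks for both [v] and ['i *: v]. *)
Definition vfunc v : R[i] := vfun v +i* (- vfun ('i *: v)).

Lemma vadm_lin c v w : vadm v -> vadm w ->
  vadm (c *: v + w) /\ vfunc (c *: v + w) = c * vfunc v + vfunc w.
Proof.
case: c => a b [[r Gr] [r' Gr']] [[q Gq] [q' Gq']].
have ii (u : V) : 'i *: ('i *: u) = - u by rewrite scalerA -expr2 sqr_i scaleN1r.
have E1 : (a +i* b) *: v + w = a%:rc *: v + (b%:rc *: ('i *: v) + w).
  rewrite addrA scalerA -scalerDl; congr (_ *: _ + _).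
  by apply: cplx_ext; rewrite ?ReD ?ImD ?ReZ ?ImZ /=; ring.
have E2 : 'i *: ((a +i* b) *: v + w) = a%:rc *: ('i *: v) + ((- b)%:rc *: v + 'i *: w).
  rewrite scalerDr !scalerA addrA -scalerDl; congr (_ *: _ + _).
  by apply: cplx_ext; rewrite /rc /=; ring.
have [_ GP _] := pG.
have G1 := GP a _ _ Gr (GP b _ _ Gr' Gq).
have G2 := GP a _ _ Gr' (GP (- b) _ _ Gr Gq').
rewrite /= in G1 G2; split; first by split; [rewrite E1|rewrite E2]; eexists; eassumption.
rewrite /vfunc E2 (vfunE G2) E1 (vfunE G1).
rewrite (vfunE Gr) (vfunE Gr') (vfunE Gq) (vfunE Gq').
by apply: cplx_ext; rewrite /=; ring.
Qed.

Lemma vadm_tens d x y : bounded_op d -> vadm (tens d x y).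
Proof.
move=> bd; split; first exact: dG.
by rewrite -tensZ; apply: dG; exact: bounded_opZ.
Qed.

Lemma vadm0 : vadm 0.
Proof. by rewrite -(tens0 0 0); exact/vadm_tens/bop0. Qed.
Lemma vfunc0 : vfunc 0 = 0.
Proof.
have [_ ] := vadm_lin 1 vadm0 vadm0; rewrite scaler0 addr0 mul1r => E.
by apply/(addrI (vfunc 0)); rewrite addr0 -E.
Qed.
Lemma vadmZ c v : vadm v -> vadm (c *: v) /\ vfunc (c *: v) = c * vfunc v.
Proof. by move=> av; have := vadm_lin c av vadm0; rewrite !addr0 vfunc0 addr0. Qed.
Lemma vadmD v w : vadm v -> vadm w -> vadm (v + w) /\ vfunc (v + w) = vfunc v + vfunc w.
Proof. by move=> av aw; have := vadm_lin 1 av aw; rewrite scale1r mul1r. Qed.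
Lemma vadm_sum (I : Type) (r : seq I) (F : I -> V) : (forall i, vadm (F i)) ->
  vadm (\sum_(i <- r) F i) /\ vfunc (\sum_(i <- r) F i) = \sum_(i <- r) vfunc (F i).
Proof.
move=> aF; elim: r => [|i r [IH1 IH2]].
  by rewrite !big_nil; split; [exact: vadm0|exact: vfunc0].
by rewrite !big_cons; have [h ->] := vadmD (aF i) IH1; rewrite IH2.
Qed.

Lemma vfunc_ge0 v : vadm v -> vcone v -> 0 <= Re (vfunc v).
Proof. by move=> [[r Gr] _] cv; rewrite /= (vfunE Gr); exact: (pos_graph_ge0 pG Gr cv). Qed.

Lemma vfunc_tens d x y : S d -> vfunc (tens d x y) = '[theta d x, y].
Proof.
move=> Sd; rewrite /vfunc -tensZ (vfunE (sG (vgraph_tens x y Sd))).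
rewrite (vfunE (sG (vgraph_tens x y (subspaceZ sS 'i Sd)))).
rewrite (linear_onZ sS lth) //.
have -> : ('i *: theta d) x = 'i *: theta d x by [].
by rewrite innerZl ReiM opprK; apply: cplx_ext.
Qed.

(** Elements whose forms have equal real parts differ by the cone in both directions, so the
    positive functional agrees on them. *)
Lemma vfunc_herm d x y : bounded_op d ->
  vfunc (tens (adj d) y x) = cj (vfunc (tens d x y)).
Proof.
move=> bd; have ba := bop_adj bd.
have key t t' (w w' : K) : bounded_op t -> bounded_op t' ->
    (forall l, Re (vform (tens t w w') l) = Re (vform (tens t' w' w) l)) ->
    vfun (tens t w w') = vfun (tens t' w' w).
  move=> bt bt' E; have [r Gr] := dG w w' bt; have [r' Gr'] := dG w' w bt'.
  rewrite (vfunE Gr) (vfunE Gr'); apply/eqP; rewrite eq_le.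
  rewrite (pos_graph_le pG Gr Gr') ?(pos_graph_le pG Gr' Gr) // => l;
    by rewrite vformD vformN ReD ReN E subrr.
have herm l : vform (tens (adj d) y x) l = cj (vform (tens d x y) l).
  by rewrite !vform_tens ?adjPr -?innerC //; exact: bop_lin.
apply: cplx_ext => /=; first by apply: key => // l; rewrite herm ReC.
rewrite opprK -!tensZ.
have bi : bounded_op ('i *: d) by exact: bounded_opZ.
have bi' : bounded_op ('i *: adj d) by exact: bounded_opZ.
have bn : bounded_op (- ('i *: d)) by exact: bounded_opN.
rewrite (key _ (- ('i *: d))) // => [|l].
  have [[r _] [r' Gr']] := vadm_tens x y bd.
  have -> : tens (- ('i *: d)) x y = - tens ('i *: d) x y.
    by rewrite -scaleN1r tensZ scaleN1r.
  rewrite -tensZ in Gr'.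
  by rewrite (vfunE (pos_graphN pG Gr')) (vfunE Gr') opprK.
rewrite -scaleN1r scalerA !tensZ !vformZ herm mulN1r mulNr ReN !ReiM ImC opprK; by [].
Qed.

Definition dilX : Type := ({d : H -> H | bounded_op d} * K)%type.
(** The Stinespring inner product on B(H) (x) K, with the extended functional in the place of
    ['[theta (adj d' \o d) x, x']]. *)
Definition dilk (p q : dilX) : R[i] :=
  vfunc (tens (adj (sval q.1) \o sval p.1) p.2 q.2).

Let bopX (p : dilX) : bounded_op (sval p.1) := svalP p.1.
Let bopXX (p q : dilX) : bounded_op (adj (sval q.1) \o sval p.1).
Proof. by apply: bop_comp; [exact: bop_adj|]. Qed.

Lemma dilk_herm p q : dilk q p = cj (dilk p q).
Proof. by rewrite /dilk -vfunc_herm // adj_comp ?adjK //; exact: bop_adj. Qed.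

Definition dilN (l : seq (R[i] * dilX)) : V := \sum_(a <- l) \sum_(b <- l)
  (a.1 * cj b.1) *: tens (adj (sval b.2.1) \o sval a.2.1) a.2.2 b.2.2.
Definition dilT (l : seq (R[i] * dilX)) m : H :=
  \sum_(a <- l) a.1 *: sval a.2.1 (part m a.2.2).

Lemma dilN_func l : vadm (dilN l) /\ vfunc (dilN l) = kform dilk l l.
Proof.
have h (a b : R[i] * dilX) := vadmZ (a.1 * cj b.1) (vadm_tens a.2.2 b.2.2 (bopXX a.2 b.2)).
have h1 a := vadm_sum l (fun b => (h a b).1).
have [h2 ->] := vadm_sum l (fun a => (h1 a).1); split=> //.
by apply: eq_bigr => a _; rewrite (h1 a).2; apply: eq_bigr => b _; rewrite (h a b).2.
Qed.

(** Exhibits [dilN l] as a square, hence as an element of the cone, which makes [dilk] positive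
    definite. *)
Lemma dilN_form l m : vform (dilN l) m = (nm (dilT l m) ^+ 2)%:rc.
Proof.
rewrite -inner_nm /dilT inner_suml vform_sum; apply: eq_bigr => a _.
rewrite inner_sumr vform_sum; apply: eq_bigr => b _.
rewrite vformZ vform_tens; last exact/bop_lin/bopXX.
by rewrite innerZl innerZr -mulrA /= adjPr.
Qed.

Lemma dilk_pos l : 0 <= Re (kform dilk l l).
Proof.
have [h <-] := dilN_func l; apply: vfunc_ge0 => // m.
by rewrite dilN_form /= sqr_ge0.
Qed.

Definition dil_act (a : {d : H -> H | bounded_op d}) (p : dilX) : dilX :=
  (exist _ (sval a \o sval p.1) (bop_comp (svalP a) (bopX p)), p.2).

(** Multiplying the entries of [l] by [a] applies [a] to the vector [dilT l m]; so [c ^+ 2] times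
    [dilN l] minus the multiplied version lies in the cone, where the functional is nonnegative. *)
Lemma dilk_act_le (a : {d : H -> H | bounded_op d}) (c : R) l : bnd (sval a) c ->
  Re (kform (fun p q => dilk (dil_act a p) (dil_act a q)) l l) <=
  c ^+ 2 * Re (kform dilk l l).
Proof.
move=> ac; pose al := [seq (p.1, dil_act a p.2) | p <- l].
have -> : kform (fun p q => dilk (dil_act a p) (dil_act a q)) l l = kform dilk al al.
  rewrite /kform big_map; apply: eq_bigr => p _.
  by rewrite big_map.
have [h1 <-] := dilN_func l; have [h2 <-] := dilN_func al.
have [h3 E3] := vadmZ (-1) h2; have [h4 E4] := vadm_lin (c ^+ 2)%:rc h1 h3.
rewrite -subr_ge0; suff : 0 <= Re (vfunc ((c ^+ 2)%:rc *: dilN l + -1 *: dilN al)).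
  by rewrite E4 E3 mulN1r ReD ReN ReZ.
apply: vfunc_ge0 => // m; rewrite vformP vformZ !dilN_form mulN1r -rcM -rcN -rcD /=.
rewrite subr_ge0.
have -> : dilT al m = sval a (dilT l m).
  have la := bop_lin (svalP a).
  rewrite /dilT big_map (lin_sum la); apply: eq_bigr => p _ /=.
  by rewrite (linZ la).
have := ac (dilT l m); have := nm_ge0 (sval a (dilT l m)).
move: (nm (sval a _)) (nm (dilT _ _)) => p q p0 pq.
by rewrite -exprMn; apply: lerXn2r; rewrite ?nnegrE //; apply: le_trans pq.
Qed.

Lemma dilation_of_functional : exists (Y : hilbertType R) (V : K -> Y)
    (tau : (H -> H) -> (Y -> Y)),
  [/\ unital_star_hom (@bounded_op R H H) tau,
      forall x y, '[V x, V y] = '[x, y] &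
      forall s x y, S s -> '[tau s (V x), V y] = '[theta s x, y]].
Proof.
have [Y [e [ek te]]] := kernel_hilbert dilk_herm dilk_pos.
have /choice[tau tauP] a : exists t : Y -> Y, forall ba : bounded_op a,
    bounded_op t /\ forall p, t (e p) = e (dil_act (exist _ a ba) p).
  have [ba|nba] := pselect (bounded_op a); last by exists id.
  have [c c0 ac] := bop_bnd ba.
  have [|t [bt _ tP]] := @extend_operator R _ Y Y e (e \o dil_act (exist _ a ba)) c te c0.
    move=> l; rewrite -ler_sqr ?nnegrE ?mulr_ge0 ?nm_ge0 // exprMn.
    rewrite (nm_combo _ ek) (nm_combo (e := e \o _) _ (fun p q => ek _ _)).
    exact: (dilk_act_le (a := exist _ a ba)).
  exists t => ba'; split=> // p; rewrite tP /=; congr e; congr pair.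
  exact: eq_exist.
exists Y, (fun x => e (exist _ idfun (@bop_id R H), x)), tau.
have bt a : bounded_op a -> bounded_op (tau a) by move=> ba; case: (tauP a ba).
have tE a (ba : bounded_op a) p : tau a (e p) = e (dil_act (exist _ a ba) p).
  by case: (tauP a ba).
have xP d d' (bd : bounded_op d) (bd' : bounded_op d') x x' :
    '[e (exist _ d bd, x), e (exist _ d' bd', x')] = vfunc (tens (adj d' \o d) x x').
  by rewrite ek.
split.
- split=> //.
  + move=> a f g bf bg; have bfg := (bop_subspace H H).2 a _ _ bf bg.
    apply: (total_ext te) => [||[[d bd] x]]; first exact: bt.
      by apply: (bop_subspace Y Y).2; exact: bt.
    change (tau (a *: f + g) (e (exist _ d bd, x)) =
      a *: tau f (e (exist _ d bd, x)) + tau g (e (exist _ d bd, x))).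
    rewrite !tE; apply: (total_extr te) => -[[d' bd'] x'].
    rewrite innerDl innerZl !xP /=.
    have bc t : bounded_op t -> bounded_op (adj d' \o (t \o d)).
      by move=> b; apply: bop_comp; [exact: bop_adj|exact: bop_comp].
    have -> : adj d' \o ((a *: f + g) \o d) = a *: (adj d' \o (f \o d)) + (adj d' \o (g \o d)).
      by apply/funext => z; exact: (bop_lin (bop_adj bd')).
    by rewrite tensP; have [_ ->] := vadm_lin a (vadm_tens x x' (bc _ bf)) (vadm_tens x x' (bc _ bg)).
  + apply: (total_ext te) => [||p]; [exact/bt/bop_id|exact: bop_id|].
    by rewrite (tE _ (bop_id H)) /=; congr e; case: p => -[d bd] x; congr pair; exact: eq_exist.
  + move=> f g bf bg; have bfg := bop_comp bf bg.
    apply: (total_ext te) => [||p]; [exact: bt|by apply: bop_comp; exact: bt|].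
    by rewrite /= !tE; congr e; congr pair; exact: eq_exist.
  + move=> f bf; have baf := bop_adj bf.
    apply/esym/(total_adj te); [exact: bt|exact: bt|].
    move=> [[d bd] x] [[d' bd'] x']; rewrite !tE !xP /= adj_comp ?adjK //.
- by move=> x y; rewrite xP adj_id (vfunc_tens _ _ (opsys_id oS)) th1.
move=> s x y Ss; have bs := opsys_bop oS Ss.
by rewrite tE xP adj_id vfunc_tens.
Qed.

End Functional.

(** Arveson extension and Stinespring dilation in one step: the Riesz extension reaches the tensors
    of all bounded operators, so [tau] acts on B(H) although [theta] is controlled on [S] only. *)
Theorem dilation : exists (Y : hilbertType R) (V : K -> Y)
    (tau : (H -> H) -> (Y -> Y)),
  [/\ unital_star_hom (@bounded_op R H H) tau,
      forall x y, '[V x, V y] = '[x, y] &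
      forall s x y, S s -> '[tau s (V x), V y] = '[theta s x, y]].
Proof.
have [G [pG sG dG]] := riesz_extension vconeD vconeZ vgraph_pos.
apply: (@dilation_of_functional G) => // d x y bd.
by have [h1 h2] := vgraph_dominates x y bd; exact: dG.
Qed.

End Dilation.

(** * Common covers *)

Section StrongLimits.
Context {R : realType}.

Lemma cvgs_norm (H : hilbertType R) (u : nat -> H) l : cvgs u l -> forall z,
  ccvg (fun n => '[u n, z]) '[l, z].
Proof.
move=> ul z; apply: (tends0_le (tends0Z (nm_ge0 z) ul)) => n.
by rewrite -innerBl mulrC; exact: cauchy_schwarz.
Qed.

Lemma cvgs_lin (H : hilbertType R) (u v : nat -> H) l m (a : R[i]) :
  cvgs u l -> cvgs v m -> cvgs (fun n => a *: u n + v n) (a *: l + m).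
Proof.
move=> ul vm; apply: (tends0_le (tends0D (tends0Z (cabs_ge0 a) ul) vm)) => n.
by rewrite opprD addrACA -scalerBr -nmZ; exact: nmD.
Qed.

Lemma cvgs_bnd (H : hilbertType R) (u : nat -> H) l c :
  cvgs u l -> (forall n, nm (u n) <= c) -> nm l <= c.
Proof.
move=> ul uc; rewrite -subr_le0; apply: tends0_const_le ul _ => n.
by have := nm_leD l (u n); rewrite nmB; have := uc n; lra.
Qed.

Lemma cvgs_cauchy (H : hilbertType R) (u : nat -> H) l : cvgs u l ->
  forall e : R, 0 < e -> exists N, forall n m, (N <= n)%N -> (N <= m)%N -> nm (u n - u m) <= e.
Proof.
move=> ul e e0; have [N h] := ul (e / 2) (divr_gt0 e0 (ltr0Sn _ 1)).
exists N => n m /h h1 /h h2; apply: (le_trans (nm_tri l _ _)).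
by rewrite (nmB l); lra.
Qed.

Lemma cvgs_subseq (H : hilbertType R) (u : nat -> H) l (f : nat -> nat) :
  (forall n, (n <= f n)%N) -> cvgs u l -> cvgs (fun n => u (f n)) l.
Proof.
move=> fn ul e /ul[N h]; exists N => n Nn; apply: h.
exact: leq_trans (fn n).
Qed.

Lemma strong_cvg_dense (H K : hilbertType R) (a : nat -> H -> K) (c : R) (E : set H) :
  (forall n, linear (a n)) -> 0 <= c -> (forall n, bnd (a n) c) ->
  (forall x, E x -> exists l, cvgs (fun n => a n x) l) ->
  forall z, (forall e : R, 0 < e -> exists2 y, E y & nm (z - y) <= e) ->
  exists l, cvgs (fun n => a n z) l.
Proof.
move=> la c0 ac aE z hz; apply: cauchy_cvgs => e e0.
have c1 : 0 < 3 * (c + 1) by lra.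
have [y Ey zy] := hz _ (divr_gt0 e0 c1); have [l hl] := aE _ Ey.
have [N h] := cvgs_cauchy hl (divr_gt0 e0 (ltr0Sn _ 2)).
have b n : nm (a n z - a n y) <= e / 3.
  rewrite -(linB (la n)); apply: (le_trans (ac n _)).
  apply: (@le_trans _ _ ((c + 1) * (e / (3 * (c + 1))))).
    by apply: ler_pM; rewrite ?nm_ge0 //; lra.
  by rewrite le_eqVlt; apply/orP; left; apply/eqP; field; rewrite gt_eqF //; lra.
exists N => n m Nn Nm; have := h _ _ Nn Nm; have := b n; have := b m.
have := nm_tri (a n y) (a n z) (a m z); have := nm_tri (a m y) (a n y) (a m z).
by rewrite (nmB (a m y)); lra.
Qed.

Lemma mono_cauchy (r : nat -> R) k c : (forall n m, (k <= n <= m)%N -> r n <= r m) ->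
  (forall n, r n <= c) ->
  forall e : R, 0 < e -> exists2 N, (k <= N)%N & forall n, (N <= n)%N -> r n - r N <= e.
Proof.
move=> rm rc e e0; pose A := [set r n | n in [set n | (k <= n)%N]].
have hs : has_sup A.
  by split; [exists (r k); exists k => //=|exists c => _ [n _ <-]; exact: rc].
have [_ [N /= kN <-] hN] := sup_adherent e0 hs.
exists N => // n Nn; have : r n <= sup A.
  by apply: ub_le_sup; [case: hs|exists n => //=; exact: leq_trans Nn].
by lra.
Qed.

Section SotLimit.
Variables (H Z : hilbertType R) (P : set (H -> H)) (Kn : nat -> hilbertType R).
Variables (J : forall n, Kn n -> Z) (tau : forall n, (H -> H) -> (Kn n -> Kn n)).
Arguments J : clear implicits.
Arguments tau : clear implicits.
Hypothesis oP : operator_system P.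
Hypothesis Ji : forall n x y, '[J n x, J n y] = '[x, y].
Hypothesis tauh : forall n, unital_star_hom (@bounded_op R H H) (tau n).
Hypothesis Jd : forall z, cvgs (fun n => J n (adj (J n) z)) z.
Arguments Ji : clear implicits.
Arguments tauh : clear implicits.

Lemma inner_preserving_bop (K K' : hilbertType R) (V : K -> K') :
  (forall x y, '[V x, V y] = '[x, y]) -> bounded_op V /\ bnd V 1.
Proof.
move=> VI; have b1 : bnd V 1.
  move=> x; rewrite mul1r -ler_sqr ?nnegrE ?nm_ge0 //.
  by rewrite -!Re_inner_nm VI.
by split=> //; apply/bopP; split; [exact: inner_preserving_linear|exists 1].
Qed.

Lemma adj_inner_preserving (K K' : hilbertType R) (V : K -> K') :
  (forall x y, '[V x, V y] = '[x, y]) -> forall x, adj V (V x) = x.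
Proof.
move=> VI x; have [bV _] := inner_preserving_bop VI.
by apply: inner_extl => y; rewrite adjPr.
Qed.

Let bJ n : bounded_op (J n). Proof. by case: (inner_preserving_bop (Ji n)). Qed.
Let J1 n : bnd (J n) 1. Proof. by case: (inner_preserving_bop (Ji n)). Qed.
Let Jt1 n : bnd (adj (J n)) 1. Proof. exact: bnd_adj. Qed.
Arguments J1 : clear implicits.
Arguments Jt1 : clear implicits.

Definition sot_seq n (d : H -> H) : Z -> Z := J n \o tau n d \o adj (J n).
Definition sot_conv (d : H -> H) := forall z, exists l, cvgs (fun n => sot_seq n d z) l.
Hypothesis Pc : forall p, P p -> sot_conv p.

Let cB := @bop_cstar R H.

Lemma sot_seq_bop n d : bounded_op d -> bounded_op (sot_seq n d).
Proof.
move=> bd; apply: bop_comp; last exact: bop_adj.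
by apply: bop_comp => //; exact: (hom_bop (tauh n)).
Qed.

Lemma sot_seq_bnd n d c : bounded_op d -> 0 <= c -> bnd d c -> bnd (sot_seq n d) c.
Proof.
move=> bd c0 dc; have tc := hom_bnd cB (tauh n) bd c0 dc.
by have := bnd_comp (mulr_ge0 ler01 c0) (bnd_comp ler01 (J1 n) tc) (Jt1 n); rewrite mul1r mulr1.
Qed.

Lemma sot_seq_lin n a d d' z : bounded_op d -> bounded_op d' ->
  sot_seq n (a *: d + d') z = a *: sot_seq n d z + sot_seq n d' z.
Proof.
move=> bd bd'; rewrite /sot_seq /= (hom_lin (tauh n)) //.
exact: (bop_lin (bJ n)).
Qed.

Lemma sot_seq_comp n d d' z : bounded_op d -> bounded_op d' ->
  sot_seq n (d \o d') z = sot_seq n d (sot_seq n d' z).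
Proof.
move=> bd bd'; rewrite /sot_seq /= (hom_comp (tauh n) bd bd') /=.
by rewrite (adj_inner_preserving (Ji n)).
Qed.

Lemma sot_seq_adj n d : bounded_op d -> adj (sot_seq n d) = sot_seq n (adj d).
Proof.
move=> bd; have bt := hom_bop (tauh n) bd; have bt' := bop_adj (bJ n).
rewrite /sot_seq adj_comp //; last exact: bop_comp.
by rewrite adjK // adj_comp // (hom_adj (tauh n)).
Qed.

(** Convergence is required of [adj d] as well because taking adjoints is not strongly continuous;
    products converge because the representations are contractive. *)
Lemma sot_cstar : unital_cstar_subalgebra
  [set d | [/\ bounded_op d, sot_conv d & sot_conv (adj d)]].
Proof.
have lin a d d' : bounded_op d -> bounded_op d' -> sot_conv d -> sot_conv d' ->
    sot_conv (a *: d + d').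
  move=> bd bd' hd hd' z; have [l hl] := hd z; have [m hm] := hd' z.
  exists (a *: l + m); apply: (tends0_le (cvgs_lin a hl hm)) => n.
  by rewrite sot_seq_lin.
have comp d d' : bounded_op d -> bounded_op d' -> sot_conv d -> sot_conv d' ->
    sot_conv (d \o d').
  move=> bd bd' hd hd' z; have [w hw] := hd' z; have [v hv] := hd w.
  have [c c0 dc] := bop_bnd bd.
  exists v; apply: (tends0_le (tends0D (tends0Z c0 hw) hv)) => n.
  rewrite sot_seq_comp //; apply: (le_trans (nm_tri (sot_seq n d w) _ _)).
  rewrite lerD2r -(linB (bop_lin (sot_seq_bop n bd))).
  exact: sot_seq_bnd.
have clos d : bounded_op d -> (forall e : R, 0 < e ->
    exists2 d', bounded_op d' /\ sot_conv d' & bnd (d - d') e) -> sot_conv d.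
  move=> bd hd z; apply: cauchy_cvgs => e e0.
  have z1 : 0 < 3 * (nm z + 1) by have := nm_ge0 z; lra.
  have ez := divr_gt0 e0 z1.
  have [d' [bd' cd'] dd] := hd _ ez; have [l hl] := cd' z.
  have [N h] := cvgs_cauchy hl (divr_gt0 e0 (ltr0Sn _ 2)).
  have b n : nm (sot_seq n d z - sot_seq n d' z) <= e / 3.
    have -> : sot_seq n d z - sot_seq n d' z = sot_seq n (-1 *: d' + d) z.
      by rewrite sot_seq_lin // scaleN1r addrC.
    apply: (@le_trans _ _ (e / (3 * (nm z + 1)) * nm z)).
      apply: sot_seq_bnd; [|exact: ltW|by rewrite scaleN1r addrC].
      exact: (bop_subspace H H).2.
    rewrite mulrAC ler_pdivrMr //.
    have -> : e / 3 * (3 * (nm z + 1)) = e * (nm z + 1) by field.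
    by rewrite ler_wpM2l ?(ltW e0) //; lra.
  exists N => n m Nn Nm; have := h _ _ Nn Nm; have := b n; have := b m.
  have := nm_tri (sot_seq n d' z) (sot_seq n d z) (sot_seq m d z).
  have := nm_tri (sot_seq m d' z) (sot_seq n d' z) (sot_seq m d z).
  by rewrite (nmB (sot_seq m d' z)); lra.
split; [split| |].
- by move=> d [].
- split.
    have c0 : sot_conv 0.
      move=> z; exists 0 => e e0; exists 0%N => n _.
      rewrite /sot_seq /= (hom0 cB (tauh n)).
      by rewrite (lin0 (bop_lin (bJ n))) subrr nm0 ltW.
    by split; rewrite ?adj0 //; exact: bop0.
  move=> a d d' [bd hd hd1] [bd' hd' hd1']; split; [|exact: lin|].
    exact: (bop_subspace H H).2.
  by rewrite adj_lincomb //; apply: lin => //; exact: bop_adj.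
- have ci : sot_conv idfun.
    move=> z; exists z; apply: (tends0_le (Jd z)) => n.
    by rewrite /sot_seq /= (hom_id (tauh n)).
  by split; rewrite ?adj_id //; exact: bop_id.
- by move=> d [bd hd hd']; split; rewrite ?adjK //; exact: bop_adj.
- move=> d d' [bd hd hd1] [bd' hd' hd1']; split; [exact: bop_comp|exact: comp|].
  by rewrite adj_comp //; apply: comp => //; exact: bop_adj.
move=> d /op_closureP[bd hd]; split=> //.
  by apply: clos => // e /hd[d' [b c _] h]; exists d'.
apply: clos; first exact: bop_adj.
move=> e e0; have [d' [b _ c] h] := hd _ e0; exists (adj d').
  by split=> //; exact: bop_adj.
by rewrite -adjB //; apply: bnd_adj => //; [exact: bounded_opB|exact: ltW].
Qed.

(** The operators with convergent images form a C*-algebra, so convergence on [P] spreads to the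
    algebra generated by [P]; the limit remains multiplicative there by the uniform bounds. *)
Lemma sot_limit : exists tau' : (H -> H) -> (Z -> Z),
  unital_star_hom (cstar_generated P) tau' /\
  forall d, cstar_generated P d -> forall z, cvgs (fun n => sot_seq n d z) (tau' d z).
Proof.
have bP := opsys_bop oP.
have cA := generated_cstar bP.
have sub : cstar_generated P `<=` [set d | [/\ bounded_op d, sot_conv d & sot_conv (adj d)]].
  apply: (generated_sub sot_cstar) => p Pp; split; [exact: bP|exact: Pc|].
  by apply: Pc; exact: (opsys_adj oP).
have /choice[t tP] (d : H -> H) : exists t : Z -> Z, cstar_generated P d ->
    forall z, cvgs (fun n => sot_seq n d z) (t z).
  have [/sub[_ cd _]|nd] := pselect (cstar_generated P d); last by exists id.
  by have [t tP] := choice cd; exists t.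
have bg d : cstar_generated P d -> bounded_op d by exact: (cstar_bop cA).
have lt d : cstar_generated P d -> linear (t d).
  move=> gd a x y; apply: (cvgs_uniq (tP _ gd _)).
  apply: (tends0_le (cvgs_lin a (tP _ gd x) (tP _ gd y))) => n.
  by rewrite (bop_lin (sot_seq_bop n (bg _ gd))).
have bt d : cstar_generated P d -> bounded_op (t d).
  move=> gd; apply/bopP; split; first exact: lt.
  have [c c0 dc] := bop_bnd (bg _ gd); exists c => // z.
  by apply: (cvgs_bnd (tP _ gd z)) => n; exact: (sot_seq_bnd n (bg _ gd) c0 dc).
exists t; split=> //; split=> //.
- move=> a d d' gd gd'; apply/funext => z.
  have gl := (cstar_subspace cA).2 a _ _ gd gd'.
  apply: (cvgs_uniq (tP _ gl z)).
  apply: (tends0_le (cvgs_lin a (tP _ gd z) (tP _ gd' z))) => n.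
  by rewrite sot_seq_lin //; exact: bg.
- apply/funext => z; apply: (cvgs_uniq (tP _ (cstar_id cA) z)).
  by apply: (tends0_le (Jd z)) => n; rewrite /sot_seq /= (hom_id (tauh n)).
- move=> d d' gd gd'; apply/funext => z.
  have gc := cstar_comp cA gd gd'; apply: (cvgs_uniq (tP _ gc z)).
  have [c c0 dc] := bop_bnd (bg _ gd).
  apply: (tends0_le (tends0D (tends0Z c0 (tP _ gd' z)) (tP _ gd (t d' z)))) => n.
  have b1 := bg _ gd; have b2 := bg _ gd'.
  rewrite sot_seq_comp //; apply: (le_trans (nm_tri (sot_seq n d (t d' z)) _ _)).
  rewrite lerD2r -(linB (bop_lin (sot_seq_bop n b1))).
  exact: sot_seq_bnd.
- move=> d gd; have ga := cstar_adj cA gd.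
  apply/esym/adj_uniq => [|z w]; first exact: bt.
  apply: (ccvg_uniq (cvgs_norm (tP _ gd z) w)).
  rewrite innerC; apply: (tends0_le (ccvg_cj (cvgs_norm (tP _ ga w) z))) => n.
  have bd := bg _ gd; have bs := sot_seq_bop n bd.
  suff -> : '[sot_seq n d z, w] = cj '[sot_seq n (adj d) w, z] by [].
  by rewrite -innerC -(sot_seq_adj n bd) -(adjP bs).
Qed.

End SotLimit.
End StrongLimits.

(** * Direct limits along isometries, and compatible compressions on them *)

Section DirectLimit.
Context {R : realType}.
Variables (st : nat -> hilbertType R) (V : forall n, st n -> st n.+1).
Arguments V : clear implicits.
Hypothesis Vi : forall n x y, '[V n x, V n y] = '[x, y].

(* The image of x : st n in each later st m; the value at m < n is junk. *)
Fixpoint thread (p : {n & st n}) m : st m :=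
  match m return st m with
  | 0%N => if eqVneq (tag p) 0%N is EqNotNeq e then eq_rect _ st (tagged p) _ e else 0
  | m'.+1 => if eqVneq (tag p) m'.+1 is EqNotNeq e then eq_rect _ st (tagged p) _ e
             else V m' (thread p m')
  end.

Lemma thread_tag p : thread p (tag p) = tagged p.
Proof.
case: p => -[|n] x /=; case: eqVneq => /= [e|]; rewrite ?eqxx //.
  by rewrite (eq_irrelevance e erefl).
by rewrite (eq_irrelevance e erefl).
Qed.

Lemma threadS p m : (tag p <= m)%N -> thread p m.+1 = V m (thread p m).
Proof.
by move=> pm /=; case: eqVneq => // e; exfalso; rewrite e ltnn in pm.
Qed.

(** [tag p + tag q] is a common later stage of both threads; since the connecting maps are
    isometric, every common stage gives the same value ([dlkE]). *)
Let dlk (p q : {n & st n}) : R[i] :=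
  '[thread p (tag p + tag q)%N, thread q (tag p + tag q)%N].

Let dlkE p q N : (tag p <= N)%N -> (tag q <= N)%N -> dlk p q = '[thread p N, thread q N].
Proof.
have step M k : (tag p <= M)%N -> (tag q <= M)%N ->
    '[thread p (M + k)%N, thread q (M + k)%N] = '[thread p M, thread q M].
  move=> pM qM; elim: k => [|k IH]; first by rewrite addn0.
  by rewrite addnS !threadS ?Vi // (leq_trans _ (leq_addr _ _)).
move=> pN qN; rewrite /dlk -(step (tag p + tag q)%N N) ?leq_addr ?leq_addl //.
by rewrite addnC step.
Qed.

(** Finitely many threads have a common stage, in which the kernel is a genuine inner product; this
    is its positivity. *)
Theorem direct_limit : exists (Z : hilbertType R) (J : forall n, st n -> Z),
  [/\ forall n (x y : st n), '[J n x, J n y] = '[x, y],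
      forall n x, J n.+1 (V n x) = J n x &
      forall z (e : R), 0 < e -> exists n y, nm (z - J n y) <= e].
Proof.
have kC p q : dlk q p = cj (dlk p q) by rewrite /dlk addnC innerC.
have bound (l : seq (R[i] * {n & st n})) : exists N, forall a, List.In a l -> (tag a.2 <= N)%N.
  elim: l => [|a l [N IH]]; first by exists 0%N.
  exists (maxn (tag a.2) N) => b [->|/IH h]; first exact: leq_maxl.
  exact: leq_trans h (leq_maxr _ _).
have sumE (I : Type) (W : zmodType) (F G : I -> W) (l : seq I) :
    (forall a, List.In a l -> F a = G a) -> \sum_(a <- l) F a = \sum_(a <- l) G a.
  elim: l => [|a l IH] h; first by rewrite !big_nil.
  by rewrite !big_cons h ?IH //; [move=> b hb; apply: h; right|left].
have kP l : 0 <= Re (kform dlk l l).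
  have [N hN] := bound l; have -> : kform dlk l l = '[combo (thread^~ N) l, combo (thread^~ N) l].
    rewrite (inner_combo (k := fun p q => '[thread p N, thread q N])) //.
    by apply: (sumE) => a /hN aN; apply: (sumE) => b /hN bN; rewrite (dlkE aN bN).
  by rewrite Re_inner_nm sqr_ge0.
have [Z [e [ek te]]] := kernel_hilbert kC kP.
pose J n (x : st n) : Z := e (Tagged st x).
have JE m n (x : st m) (y : st n) N : (m <= N)%N -> (n <= N)%N ->
    '[J m x, J n y] = '[thread (Tagged st x) N, thread (Tagged st y) N].
  by move=> mN nN; rewrite /J ek; exact: dlkE.
have Ji n (x y : st n) : '[J n x, J n y] = '[x, y].
  by rewrite (JE _ _ _ _ n) // -[n in thread _ n]/(tag (Tagged st x)) thread_tag
    -[n in thread _ n]/(tag (Tagged st y)) thread_tag.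
have tV n (x : st n) N : (n < N)%N -> thread (Tagged st (V n x)) N = thread (Tagged st x) N.
  move=> nN; rewrite -(subnKC nN); elim: (N - n.+1)%N => [|k IH].
    rewrite addn0 [RHS]threadS //.
    rewrite -[n.+1 in LHS]/(tag (Tagged st (V n x))) thread_tag.
    by rewrite -[n in thread _ n]/(tag (Tagged st x)) thread_tag.
  have a1 : (n <= n.+1 + k)%N by exact: leq_trans (leqnSn n) (leq_addr _ _).
  rewrite addnS (threadS (p := Tagged st (V n x)) (leq_addr k n.+1)).
  by rewrite (threadS (p := Tagged st x) a1) IH.
have lJ n : linear (J n) by apply: inner_preserving_linear; exact: Ji.
have JV n x : J n.+1 (V n x) = J n x.
  apply: inner_extl => z; apply/eqP; rewrite -subr_eq0 -innerBl; apply/eqP.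
  have -> : J n.+1 (V n x) - J n x = 0; last exact: inner0l.
  apply: nm_eq0; apply/eqP; rewrite -sqrf_eq0 -Re_inner_nm innerBl !innerBr.
  by rewrite !(JE _ _ _ _ n.+1) // tV // !subrr.
have JT p N : (tag p <= N)%N -> J N (thread p N) = e p.
  move=> pN; rewrite -(subnKC pN); elim: (N - tag p)%N => [|k IH].
    by rewrite addn0 thread_tag /J; case: p {pN}.
  by rewrite addnS threadS ?leq_addr // JV.
exists Z, J; split=> // z eps eps0; have [l hl] := te z _ eps0.
have [N hN] := bound l; exists N, (combo (thread^~ N) l).
suff -> : J N (combo (thread^~ N) l) = combo e l by [].
rewrite (lin_combo _ _ (lJ N)); apply: (sumE) => a /hN aN /=.
by rewrite JT.
Qed.

End DirectLimit.

Section LimitAction.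
Context {R : realType}.
Variables (st : nat -> hilbertType R) (V : forall n, st n -> st n.+1).
Variables (Z : hilbertType R) (J : forall n, st n -> Z) (th : forall n, st n -> st n).
Arguments V : clear implicits.
Arguments J : clear implicits.
Arguments th : clear implicits.
Variable c : R.
Hypothesis c0 : 0 <= c.
Hypothesis Ji : forall n (x y : st n), '[J n x, J n y] = '[x, y].
Hypothesis JV : forall n x, J n.+1 (V n x) = J n x.
Hypothesis Jd : forall z (e : R), 0 < e -> exists n y, nm (z - J n y) <= e.
Hypothesis thc : forall n x y, '[th n.+1 (V n x), V n y] = '[th n x, y].
Hypothesis thb : forall n, linear (th n).
Hypothesis th1 : forall n, bnd (th n) c.
Arguments Ji : clear implicits.
Arguments JV : clear implicits.
Arguments th1 : clear implicits.

Let Jp n := inner_preserving_bop (Ji n).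
Let JK n := adj_inner_preserving (Ji n).
Let lJ n : linear (J n) := bop_lin (Jp n).1.
Arguments JK : clear implicits.
Arguments lJ : clear implicits.
Arguments thb : clear implicits.
Let Jinj n x y : J n x = J n y -> x = y.
Proof. by move=> E; rewrite -(JK n x) E JK. Qed.

Lemma limit_lift n m (x : st n) : (n <= m)%N -> exists y : st m, J m y = J n x.
Proof.
move=> nm; rewrite -(subnKC nm); elim: (m - n)%N => [|k [y yE]].
  by rewrite addn0; exists x.
by rewrite addnS; exists (V _ y); rewrite JV.
Qed.

Lemma limit_proj z : cvgs (fun n => J n (adj (J n) z)) z.
Proof.
move=> e e0; have [N [y zy]] := Jd z (divr_gt0 e0 (ltr0Sn _ 1)).
exists N => n Nn; have [y' yE] := limit_lift y Nn; rewrite -yE in zy.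
apply: (le_trans (nm_tri (J n y') _ _)); rewrite (nmB (J n y')).
have -> : J n (adj (J n) z) - J n y' = J n (adj (J n) (z - J n y')).
  by rewrite (linB (bop_lin (bop_adj (Jp n).1))) JK (linB (lJ n)).
have := (Jp n).2 (adj (J n) (z - J n y')).
have := bnd_adj (Jp n).1 ler01 (Jp n).2 (z - J n y'); lra.
Qed.

Lemma limit_compression n m (x y : st n) (x' y' : st m) : (n <= m)%N ->
  J m x' = J n x -> J m y' = J n y -> '[th m x', y'] = '[th n x, y].
Proof.
move=> nm; move: x' y'; rewrite -(subnKC nm).
suff H k : exists2 W : st n -> st (n + k)%N, forall x, J (n + k)%N (W x) = J n x &
    forall x y, '[th (n + k)%N (W x), W y] = '[th n x, y].
  have [W WJ Wt] := H (m - n)%N => x' y'; rewrite -!WJ.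
  by move=> /Jinj -> /Jinj ->.
elim: k => [|k [W WJ Wt]]; first by rewrite addn0; exists id.
rewrite addnS; exists (V _ \o W) => [z|z w] /=; first by rewrite JV.
by rewrite thc.
Qed.

(** For a vector of some stage, the image at stage [n] is the projection of the image at any later
    stage [m]. The squared norms therefore increase, they are bounded, and Pythagoras turns this
    into a Cauchy sequence. *)
Lemma limit_action z : exists l, cvgs (fun n => J n (th n (adj (J n) z))) l.
Proof.
have lT n : linear (J n \o th n \o adj (J n)).
  exact: (lin_comp (lin_comp (lJ n) (thb n)) (bop_lin (bop_adj (Jp n).1))).
have bT n : bnd (J n \o th n \o adj (J n)) c.
  have b1 := bnd_adj (Jp n).1 ler01 (Jp n).2.
  by have := bnd_comp (mulr_ge0 ler01 c0) (bnd_comp ler01 (Jp n).2 (th1 n)) b1; rewrite mul1r mulr1.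
pose E := [set w | exists n x, w = J n x].
suff cE w : E w -> exists l, cvgs (fun n => J n (th n (adj (J n) w))) l.
  apply: (strong_cvg_dense lT c0 bT cE) => e e0.
  by have [n [y zy]] := Jd z e0; exists (J n y) => //; exists n, y.
move=> [k [x ->]]; pose u n := J n (th n (adj (J n) (J k x))).
have norm_step n m : (k <= n)%N -> (n <= m)%N ->
    nm (u m - u n) ^+ 2 = nm (u m) ^+ 2 - nm (u n) ^+ 2.
  move=> kn nm; have [xn xnE] := limit_lift x kn; have [xm xmE] := limit_lift xn nm.
  have un : u n = J n (th n xn) by rewrite /u -xnE JK.
  have um : u m = J m (th m xm) by rewrite /u -xnE -xmE JK.
  have [v vE] := limit_lift (th n xn) nm.
  have E1 : '[u m, u n] = '[u n, u n].
    by rewrite um un -{1}vE Ji (limit_compression nm xmE vE) Ji.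
  by rewrite nm_sqrB E1 Re_inner_nm; lra.
apply: cauchy_cvgs => e e0.
have [|n|N kN h] := @mono_cauchy R (fun n => nm (u n) ^+ 2) k ((c * nm (J k x)) ^+ 2) _ _
    ((e / 2) ^+ 2) (exprn_gt0 _ (divr_gt0 e0 (ltr0Sn _ 1))).
- move=> n m /andP[kn nm]; rewrite -subr_ge0 -norm_step //; exact: sqr_ge0.
- by rewrite lerXn2r ?nnegrE ?mulr_ge0 ?nm_ge0 //; exact: bT.
have b n : (N <= n)%N -> nm (u n - u N) <= e / 2.
  move=> Nn; rewrite -ler_sqr ?nnegrE ?nm_ge0 ?divr_ge0 ?(ltW e0) //.
  by rewrite norm_step //; exact: h.
exists N => n m /b h1 /b h2; apply: (le_trans (nm_tri (u N) _ _)).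
by rewrite (nmB (u N)); lra.
Qed.

End LimitAction.

Section UcoeImage.
Context {R : realType}.
Implicit Types H K : hilbertType R.

Lemma quad_eq0 (K : hilbertType R) (f : K -> K) : linear f ->
  (forall x, '[f x, x] = 0) -> f = 0.
Proof.
move=> lf f0; apply/funext => x; apply: inner_extl => y; rewrite inner0l.
have h1 := real_form_selfadj lf (fun x => congr1 (@Im R) (f0 x)) x y.
have li : linear (fun x => 'i *: f x) by move=> a u v; rewrite lf scalerDr !scalerA mulrC.
have li0 z : Im '['i *: f z, z] = 0 by rewrite innerZl f0 mulr0.
have := real_form_selfadj li li0 x y.
rewrite innerZl innerZr cj_i mulNr -mulrN => /(mulfI i_neq0); rewrite -h1.
by move=> /eqP; rewrite -addr_eq0 -mulr2n mulrn_eq0 /= => /eqP.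
Qed.

(** The scalars 1, -1, ['i] and [- 'i] already force the quadratic form to vanish. Through this the
    matrix order detects 0, whence the injectivity of order embeddings. *)
Lemma repos_scale_eq0 H (f : H -> H) : linear f ->
  (forall a : R[i], repos (fun _ _ : 'I_1 => a *: f)) -> f = 0.
Proof.
move=> lf pf; apply: quad_eq0 => // x.
have nn a : 0 <= Re (a * '[f x, x]).
  by have := pf a (fun=> x); rewrite /opform !big_ord1 -innerZl.
have := nn 1; have := nn (-1); have := nn 'i; have := nn (- 'i).
rewrite !mulNr !mul1r !ReN ReiM => h1 h2 h3 h4.
by apply: cplx_ext => /=; lra.
Qed.

Lemma ucoe_id H (T : set (H -> H)) : operator_system T -> ucoe T id.
Proof. by move=> oT; apply: ucoe_intro => // f; exact: (opsys_bop oT). Qed.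

Section Image.
Variables (H K : hilbertType R) (T : set (H -> H)) (psi : (H -> H) -> (K -> K)).
Hypotheses (oT : operator_system T) (psiu : ucoe T psi).
Let sT := opsys_subspace oT.

Lemma ucoe_inj t t' : T t -> T t' -> psi t = psi t' -> t = t'.
Proof.
move=> Tt Tt' E; apply/eqP; rewrite -subr_eq0; apply/eqP.
have Td : T (t - t') by exact: subspaceB.
apply: repos_scale_eq0 => [|a]; first exact/bop_lin/(opsys_bop oT).
apply/(ucoe_repos oT psiu (fun _ _ => subspaceZ sT a Td)) => y.
have [_ lpsi _ _] := psiu.
rewrite /opform !big_ord1 (linear_onZ sT lpsi) // (linear_onB sT lpsi) // E subrr scaler0.
by rewrite inner0l.
Qed.

Lemma ucoe_image_opsys : operator_system (psi @` T).
Proof.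
have [bpsi lpsi psi1 _] := psiu; split.
- by move=> _ [t Tt <-]; exact: bpsi.
- split; first by exists 0; [exact: subspace0|exact: (linear_on0 sT lpsi)].
  move=> a _ _ [t Tt <-] [t' Tt' <-]; exists (a *: t + t'); first exact: sT.2.
  exact: lpsi.
- by exists idfun => //; exact: (opsys_id oT).
move=> _ [t Tt <-]; exists (adj t); first exact: (opsys_adj oT).
exact: (ucoe_adj oT).
Qed.

End Image.
End UcoeImage.

(** * Alternating dilations along two embeddings *)

Section CommonCover.
Context {R : realType}.
Variables (H : hilbertType R) (T : set (H -> H)) (Hb : bool -> hilbertType R).
Variable psi : forall b, (H -> H) -> (Hb b -> Hb b).
Arguments psi : clear implicits.
Hypothesis oT : operator_system T.
Hypothesis psiu : forall b, ucoe T (psi b).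
Let sT := opsys_subspace oT.

(** Positivity is carried in the forward direction only; reflection of the order is recovered in the
    limit by compressing to the initial stage. *)
Record stage := Stage {
  stage_space :> hilbertType R;
  stage_map : (H -> H) -> (stage_space -> stage_space);
  stage_lin : linear_on T stage_map;
  stage_id : stage_map idfun = idfun;
  stage_pos : forall n (A : 'I_n -> 'I_n -> H -> H), (forall i j, T (A i j)) ->
    repos A -> repos (fun i j => stage_map (A i j)) }.

Arguments stage_map : clear implicits.

Record extension (b : bool) (s : stage) := Extension {
  ext_stage : stage;
  ext_emb : s -> ext_stage;
  ext_emb_inner : forall x y, '[ext_emb x, ext_emb y] = '[x, y];
  ext_compress : forall t x y, T t ->
    '[stage_map ext_stage t (ext_emb x), ext_emb y] = '[stage_map s t x, y];
  ext_hom : exists2 tau : (Hb b -> Hb b) -> (ext_stage -> ext_stage),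
    unital_star_hom (@bounded_op R (Hb b) (Hb b)) tau &
    forall t, T t -> stage_map ext_stage t = tau (psi b t) }.

(** Dilates the map taking [psi b t] to [stage_map s t]; it is completely positive on the image of
    [psi b] because [psi b] reflects the order. *)
Lemma extension_exists b s : exists e : extension b s, True.
Proof.
have [bpsi lpsi psi1 _] := psiu b.
pose inv (f : Hb b -> Hb b) : H -> H := xget 0 [set t | T t /\ psi b t = f].
have invP t : T t -> inv (psi b t) = t.
  move=> Tt; rewrite /inv; case: xgetP => [t' _ [Tt' E]|/(_ t)[]//].
  exact: (ucoe_inj oT (psiu b) Tt' Tt E).
have lS : linear_on (psi b @` T) (fun f => stage_map s (inv f)).
  move=> a _ _ [t Tt <-] [t' Tt' <-].
  rewrite -lpsi // !invP //; first exact: stage_lin.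
  exact: sT.2.
have idS : stage_map s (inv idfun) = idfun.
  by rewrite -psi1 invP; [exact: stage_id|exact: (opsys_id oT)].
have [n A TA pA|Y [V [tau [ht Vi Vc]]]] := dilation (ucoe_image_opsys oT (psiu b)) lS idS.
  have /choice[B BP] i : exists f : 'I_n -> H -> H, forall j, T (f j) /\ psi b (f j) = A i j.
    have /choice[f fP] j : exists t, T t /\ psi b t = A i j.
      by have [t Tt E] := TA i j; exists t.
    by exists f.
  have AE : A = fun i j => psi b (B i j).
    by apply/funext => i; apply/funext => j; case: (BP i j).
  have TB i j : T (B i j) by case: (BP i j).
  rewrite AE in pA *; have -> : (fun i j => stage_map s (inv (psi b (B i j)))) =
      (fun i j => stage_map s (B i j)).
    by apply/funext => i; apply/funext => j; rewrite invP.
  by apply: stage_pos => //; apply/(ucoe_repos oT (psiu b) TB).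
have ht' f := hom_bop ht (f := f).
pose m t := tau (psi b t).
have lm : linear_on T m.
  by move=> a t t' Tt Tt'; rewrite /m lpsi // (hom_lin ht) //; exact: bpsi.
have m1 : m idfun = idfun by rewrite /m psi1 (hom_id ht).
have pm n (A : 'I_n -> 'I_n -> H -> H) : (forall i j, T (A i j)) ->
    repos A -> repos (fun i j => m (A i j)).
  move=> TA /(ucoe_repos oT (psiu b) TA); apply: (hom_repos (bop_cstar _) ht) => i j.
  exact: bpsi.
unshelve eexists (@Extension b s (Stage lm m1 pm) V Vi _ _) => //=.
- move=> t x y Tt; rewrite Vc ?invP //; by exists t.
- by exists tau.
Qed.

(** The stage maps converge strongly along the whole sequence, while every second one is a
    homomorphism composed with [psi b]. Both subsequences share the limit [chi], and each presents
    it as a homomorphism on its own C*-algebra. *)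
Theorem common_cover : exists (Z : hilbertType R) (chi : (H -> H) -> (Z -> Z)),
  ucoe T chi /\ forall b, exists2 tau : (Hb b -> Hb b) -> (Z -> Z),
    unital_star_hom (cstar_generated (psi b @` T)) tau &
    forall t, T t -> tau (psi b t) = chi t.
Proof.
pose ext b s : extension b s := sval (cid (extension_exists b s)).
have [bpsi0 lpsi0 psi10 _] := psiu true.
have pos0 n (A : 'I_n -> 'I_n -> H -> H) : (forall i j, T (A i j)) ->
    repos A -> repos (fun i j => psi true (A i j)).
  by move=> TA; apply: (ucoe_repos oT (psiu true) TA).1.
pose s0 := Stage lpsi0 psi10 pos0.
pose st := fix st n : stage := if n is m.+1 then ext_stage (ext (odd m) (st m)) else s0.
pose V n : st n -> st n.+1 := ext_emb (ext (odd n) (st n)).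
have Vi n x y : '[V n x, V n y] = '[x, y] by exact: ext_emb_inner.
have Vc n t x y : T t -> '[stage_map (st n.+1) t (V n x), V n y] = '[stage_map (st n) t x, y].
  by move=> Tt; exact: (ext_compress (ext (odd n) (st n))).
have Vh b n : odd n = b -> exists2 tau : (Hb b -> Hb b) -> (st n.+1 -> st n.+1),
    unital_star_hom (@bounded_op R (Hb b) (Hb b)) tau &
    forall t, T t -> stage_map (st n.+1) t = tau (psi b t).
  by move=> <-; exact: (ext_hom (ext (odd n) (st n))).
have [Z [J [Ji JV Jd]]] := direct_limit Vi.
have smb t : T t -> exists2 c, 0 <= c & forall n, linear (stage_map (st n) t) /\ bnd (stage_map (st n) t) c.
  move=> Tt; have bp b : bounded_op (psi b t) by case: (psiu b) => h _ _ _; exact: h.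
  have [c c0 hc] := bop_bnd (bp true); have [d d0 hd] := bop_bnd (bp false).
  exists (c + d); first exact: addr_ge0.
  move=> [|n]; first by split; [exact: (bop_lin (bp true))|apply: bnd_le hc; rewrite lerDl].
  have [tau th tE] := Vh (odd n) n erefl; rewrite tE //.
  split; first by apply: bop_lin; exact: (hom_bop th).
  apply: (hom_bnd (bop_cstar _) th); [exact: bp|exact: addr_ge0|].
  by case: (odd n); [apply: bnd_le hc; rewrite lerDl|apply: bnd_le hd; rewrite lerDr].
have lim t : T t -> forall z, exists l, cvgs (fun n => J n (stage_map (st n) t (adj (J n) z))) l.
  move=> Tt z; have [c c0 h] := smb t Tt.
  apply: (@limit_action _ _ V Z J (fun n => stage_map (st n) t) c c0 Ji JV Jd) => n.
  - by move=> x y; exact: Vc.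
  - by case: (h n).
  - by case: (h n).
have /choice[chi chiP] t : exists f : Z -> Z, T t ->
    forall z, cvgs (fun n => J n (stage_map (st n) t (adj (J n) z))) (f z).
  have [Tt|nT] := pselect (T t); last by exists id.
  by have [f fP] := choice (lim t Tt); exists f.
have Pj := limit_proj Ji JV Jd.
have homs b : exists2 tau : (Hb b -> Hb b) -> (Z -> Z),
    unital_star_hom (cstar_generated (psi b @` T)) tau &
    forall t, T t -> tau (psi b t) = chi t.
  (* The extension taken at [f k], of parity [b], produces stage [(f k).+1]; hence the successors
     below. *)
  pose f k := (b + k.*2)%N.
  have odf k : odd (f k) = b by rewrite /f oddD odd_double addbF oddb.
  have fk k : (k <= (f k).+1)%N.
    by rewrite /f -addnn; apply: leqW; exact: leq_trans (leq_addr k k) (leq_addl b _).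
  pose good k (tau : (Hb b -> Hb b) -> (st (f k).+1 -> st (f k).+1)) :=
    unital_star_hom (@bounded_op R (Hb b) (Hb b)) tau /\
    forall t, T t -> stage_map (st (f k).+1) t = tau (psi b t).
  have ex k : exists tau, good k tau by have [tau h1 h2] := Vh b (f k) (odf k); exists tau.
  pose tau k := sval (cid (ex k)).
  have tauP k : good k (tau k) := svalP (cid (ex k)).
  have tauE k t : T t -> stage_map (st (f k).+1) t = tau k (psi b t) by case: (tauP k) => _; apply.
  have [|||p [t Tt <-] z|tau' [ht' tl]] := @sot_limit R (Hb b) Z (psi b @` T)
    (fun k => st (f k).+1) (fun k => J (f k).+1) tau (ucoe_image_opsys oT (psiu b)).
  - by move=> k; exact: Ji.
  - by move=> k; case: (tauP k).
  - by move=> z; exact: (cvgs_subseq fk (Pj z)).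
  - exists (chi t z); apply: (tends0_le (cvgs_subseq fk (chiP t Tt z))) => k.
    by rewrite /sot_seq /= tauE.
  exists tau' => // t Tt; apply/funext => z.
  have gt : cstar_generated (psi b @` T) (psi b t) by apply: sub_generated; exists t.
  apply: (cvgs_uniq (tl _ gt z)).
  apply: (tends0_le (cvgs_subseq fk (chiP t Tt z))) => k.
  by rewrite /sot_seq /= tauE.
exists Z, chi; split=> //.
have [tau ht tE] := homs true.
have cA := generated_cstar (opsys_bop (ucoe_image_opsys oT (psiu true))).
have gen t : T t -> cstar_generated (psi true @` T) (psi true t).
  by move=> Tt; apply: sub_generated; exists t.
apply: (ucoe_intro oT) => [t Tt|a t t' Tt Tt'||n A TA].
- by rewrite -tE //; apply: (hom_bop ht); exact: gen.
- rewrite -(tE t Tt) -(tE t' Tt') -tE; last exact: sT.2.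
  by rewrite lpsi0 // (hom_lin ht) //; exact: gen.
- by rewrite -tE ?psi10 ?(hom_id ht) //; exact: (opsys_id oT).
split=> [pA|pA].
  have -> : (fun i j => chi (A i j)) = (fun i j => tau (psi true (A i j))).
    by apply/funext => i; apply/funext => j; rewrite tE.
  by apply: (hom_repos cA ht) => [i j|]; [exact: gen|exact: (pos0)].
(* Order reflection: on vectors of stage 0 the form of [chi] is that of [psi true], because every
   later stage compresses to it. *)
apply/(ucoe_repos oT (psiu true) TA) => x.
have := pA (fun i => J 0%N (x i)); congr (0 <= Re _).
apply: eq_bigr => i _; apply: eq_bigr => j _.
apply: (ccvg_uniq (cvgs_norm (chiP _ (TA i j) (J 0%N (x j))) (J 0%N (x i)))).
apply: (tends0_le (ccvg_const '[psi true (A i j) (x j), x i])) => m.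
suff -> : '[J m (stage_map (st m) (A i j) (adj (J m) (J 0%N (x j)))), J 0%N (x i)] =
    '[psi true (A i j) (x j), x i] by [].
have [y yE] := limit_lift JV (x j : st 0%N) (leq0n m).
have [w wE] := limit_lift JV (x i : st 0%N) (leq0n m).
rewrite -yE -wE (adj_inner_preserving (Ji m)) Ji.
exact: (limit_compression (th := fun k => stage_map (st k) (A i j)) Ji JV
  (fun k u v => Vc k _ u v (TA i j)) (leq0n m) yE wE).
Qed.

End CommonCover.

(** * Ternary rings of operators *)

Section TroBasics.
Context {R : realType}.
Implicit Types H K L Z : hilbertType R.

Definition tro_relates H K (M : set (H -> K)) (P : set (H -> H)) (Q : set (K -> K)) :=
  [/\ tro M, tro_nondegenerate M,
    forall a t b, M a -> Q t -> M b -> op_closure P (adj a \o t \o b) &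
    forall a s b, M a -> P s -> M b -> op_closure Q (a \o s \o adj b)].

Lemma tro_bop H K (M : set (H -> K)) a : tro M -> M a -> bounded_op a.
Proof. by case=> b _ _; exact: b. Qed.

Lemma op_closure_subset H K (X A : set (H -> K)) : op_closure A `<=` A -> X `<=` A ->
  op_closure X `<=` A.
Proof. by move=> cA XA f Xf; apply: cA; exact: op_closureS Xf. Qed.

Lemma lin_span_bop H K (X : set (H -> K)) : X `<=` @bounded_op R H K ->
  lin_span X `<=` @bounded_op R H K.
Proof. by move=> bX; apply: lin_span_ind => //; exact: bop_subspace. Qed.

(* Inserts an approximate unit between two factors of an element of a closed set. *)
Lemma closure_insert H K L (X : set (K -> K)) (A : set (H -> L)) f g :
  X `<=` @bounded_op R K K ->
  op_closure (lin_span X) idfun -> bounded_op f -> bounded_op g ->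
  subspace A -> op_closure A `<=` A ->
  (forall x, X x -> A (f \o x \o g)) -> A (f \o g).
Proof.
move=> bX X1 bf bg sA cA XA; apply: cA.
have := @op_closure_comp _ _ _ _ _ (lin_span X) A f g idfun bf bg; apply=> // x Xx.
apply: sub_op_closure.
  by apply: bop_comp => //; apply: bop_comp => //; exact: lin_span_bop Xx.
have sE : subspace [set x : K -> K | A (f \o x \o g)].
  have lf := bop_lin bf; split=> [|a y z Ay Az] /=.
    have -> : f \o 0 \o g = 0 by apply/funext => v /=; exact: (lin0 lf).
    exact: subspace0.
  have -> : f \o (a *: y + z) \o g = a *: (f \o y \o g) + (f \o z \o g).
    by apply/funext => v; exact: lf.
  exact: sA.2.
exact: (lin_span_ind sE XA Xx).
Qed.

Lemma tro_adj H K (M : set (H -> K)) P Q : tro_relates M P Q ->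
  tro_relates [set adj a | a in M] Q P.
Proof.
move=> [[bM sM tM] [M1 M2] MQ MP]; split.
- split.
  + by move=> _ [a Ma <-]; apply: bop_adj; exact: bM.
  + split; first by exists 0; [exact: subspace0|exact: adj0].
    move=> c _ _ [a Ma <-] [b Mb <-]; exists (cj c *: a + b); first exact: sM.2.
    by rewrite adj_lincomb ?cjK //; exact: bM.
  + move=> _ _ _ [a Ma <-] [b Mb <-] [c Mc <-]; exists (c \o adj b \o a); first exact: tM.
    have [ba bb bc] := And3 (bM _ Ma) (bM _ Mb) (bM _ Mc); have bab := bop_adj bb.
    by rewrite (adj_comp (bop_comp bc bab) ba) (adj_comp bc bab) (adjK bb).
- split.
  + apply: op_closureS M2; apply: lin_span_ind; first exact: lin_span_subspace.
    move=> _ [a Ma [b Mb <-]]; apply: sub_lin_span.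
    by exists (adj a); [exists a|exists (adj b); [exists b|rewrite adjK //; exact: bM]].
  + apply: op_closureS M1; apply: lin_span_ind; first exact: lin_span_subspace.
    move=> _ [a Ma [b Mb <-]]; apply: sub_lin_span.
    by exists (adj a); [exists a|exists (adj b); [exists b|rewrite adjK //; exact: bM]].
- move=> _ t _ [a Ma <-] Pt [b Mb <-]; rewrite adjK; first exact: MP.
  exact: bM.
- move=> _ t _ [a Ma <-] Qt [b Mb <-]; rewrite adjK; first exact: MQ.
  exact: bM.
Qed.

(** Pulls positivity on [K] back to [H]: for vectors that are sums of values of TRO elements, the
    matrix acquires entries [adj m \o A \o m] indexed by all the summands. *)
Lemma opform_sigma H K (I : finType) (n : I -> nat) (A : I -> I -> K -> K)
    (m : {i : I & 'I_(n i)} -> H -> K) (x : {i : I & 'I_(n i)} -> H) :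
  (forall i j, bounded_op (A i j)) -> (forall p, bounded_op (m p)) ->
  opform A (fun i => \sum_(k < n i) m (existT _ i k) (x (existT _ i k))) =
  opform (fun p r => adj (m p) \o A (tag p) (tag r) \o m r) x.
Proof.
move=> bA bm; rewrite /opform.
pose F p r := '[A (tag p) (tag r) (m r (x r)), m p (x p)].
transitivity (\sum_i \sum_(k < n i) \sum_j \sum_(l < n j) F (existT _ i k) (existT _ j l)).
  apply: eq_bigr => i _; rewrite exchange_big; apply: eq_bigr => j _ /=.
  rewrite (lin_sum (bop_lin (bA i j))) inner_suml exchange_big; apply: eq_bigr => l _ /=.
  by rewrite inner_sumr; apply: eq_bigr.
rewrite (sig_big_dep (J := fun i => 'I_(n i)) (fun _ => true) (fun _ _ => true)
  (fun i (k : 'I_(n i)) => \sum_j \sum_(l < n j) F (existT _ i k) (existT _ j l))) /=.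
apply: eq_big => [//|[i k] _] /=.
rewrite (sig_big_dep (J := fun i => 'I_(n i)) (fun _ => true) (fun _ _ => true)
  (fun j (l : 'I_(n j)) => F (existT _ i k) (existT _ j l))) /=.
apply: eq_big => [//|[j l] _] /=; by rewrite adjPr.
Qed.

(** The entries are approximated by elements of [P], and a small multiple of the identity on the
    diagonal restores positivity of the image before reflection is applied. *)
Lemma reflect_repos_closure H Z (P : set (H -> H)) (kappa : (H -> H) -> (Z -> Z)) :
  operator_system P -> unital_star_hom (cstar_generated P) kappa ->
  (forall (I : finType) (A : I -> I -> H -> H), (forall i j, P (A i j)) ->
     repos (fun i j => kappa (A i j)) -> repos A) ->
  forall (I : finType) (A : I -> I -> H -> H), (forall i j, op_closure P (A i j)) ->
     repos (fun i j => kappa (A i j)) -> repos A.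
Proof.
move=> oP hk rf I A PA pA x.
have bP := opsys_bop oP; have cA := generated_cstar bP; have sP := opsys_subspace oP.
have sub := @sub_generated _ _ P.
have clA f : op_closure P f -> cstar_generated P f.
  by apply: op_closure_subset; [exact: cstar_closed|exact: sub].
pose N : R := #|I|%:R; pose X (W : hilbertType R) (y : I -> W) := \sum_i nm (y i) ^+ 2.
have X0 (W : hilbertType R) (y : I -> W) : 0 <= X W y by apply: sumr_ge0 => i _; exact: sqr_ge0.
have N0 : 0 <= N by rewrite ler0n.
have double (W : hilbertType R) (y : I -> W) : \sum_i \sum_j nm (y j) * nm (y i) <= N * X W y.
  have -> : N * X W y = \sum_i \sum_j (nm (y j) ^+ 2 + nm (y i) ^+ 2) / 2.
    have A1 : \sum_(i : I) \sum_j nm (y j) ^+ 2 = N * X W y.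
      by rewrite sumr_const -mulr_natl.
    have A2 : \sum_i \sum_(j : I) nm (y i) ^+ 2 = N * X W y by rewrite exchange_big A1.
    under eq_bigr do rewrite -mulr_suml big_split /=.
    by rewrite -mulr_suml big_split /= A1 A2; field.
  apply: ler_sum => i _; apply: ler_sum => j _.
  by have := sqr_ge0 (nm (y j) - nm (y i)); rewrite sqrrB; lra.
have diff (W : hilbertType R) (B C : I -> I -> W -> W) (e : R) (y : I -> W) : 0 <= e ->
    (forall i j, bnd (B i j - C i j) e) ->
    cabs (opform B y - opform C y) <= e * (N * X W y).
  move=> e0 BC; apply: (@le_trans _ _ (e * \sum_i \sum_j nm (y j) * nm (y i))); last first.
    by rewrite ler_wpM2l.
  rewrite /opform -sumrB mulr_sumr; apply: (le_trans (cabs_sum _ _)); apply: ler_sum => i _.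
  rewrite -sumrB mulr_sumr; apply: (le_trans (cabs_sum _ _)); apply: ler_sum => j _.
  rewrite -innerBl; apply: (le_trans (cauchy_schwarz _ _)).
  by rewrite mulrA ler_wpM2r ?nm_ge0 //; exact: BC.
have diag (W : hilbertType R) (B : I -> I -> W -> W) (t : R) (y : I -> W) :
    opform (fun i j => (i == j)%:R *: (t%:rc *: idfun) + B i j) y = (t * X W y)%:rc + opform B y.
  rewrite opformD; congr (_ + _); rewrite /opform /X mulr_sumr.
  rewrite (big_morph (@rc R) (@rcD R) (@rc0 R)); apply: eq_bigr => i _.
  rewrite (bigD1 i) //= eqxx big1 ?addr0 => [|j ji].
    change ('[1 *: (t%:rc *: y i), y i] = (t * nm (y i) ^+ 2)%:rc).
    by rewrite scale1r innerZl inner_nm rcM.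
  change ('[(i == j)%:R *: (t%:rc *: y j), y i] = 0).
  by rewrite eq_sym (negbTE ji) scale0r inner0l.
apply/ler_addgt0Pr => d d0.
have [e e0 ed] : exists2 e : R, 0 < e & e * (2 * N * X H x) <= d.
  have D0 : 0 < 2 * N * X H x + 1 by rewrite ltr_wpDl ?mulr_ge0 ?X0.
  exists (d / (2 * N * X H x + 1)); first by rewrite divr_gt0.
  by rewrite mulrAC ler_pdivrMr // ler_wpM2l ?(ltW d0) // lerDl.
have /choice[B BP] (p : I * I) : exists f, P f /\ bnd (A p.1 p.2 - f) e.
  by have /op_closureP[_ h] := PA p.1 p.2; have [f Pf hf] := h _ e0; exists f.
(* An entrywise error [e] changes a form by at most [e * N] times the squared norm of the family;
   the diagonal compensates for this under [kappa], and returning from [B] to [A] costs the same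
   again, whence the factor [2 * N] above. *)
pose C i j := (i == j)%:R *: ((e * N)%:rc *: idfun) + B (i, j).
have PC i j : P (C i j).
  apply: (subspaceD sP); last by case: (BP (i, j)).
  by do 2!apply: (subspaceZ sP); exact: (opsys_id oP).
have /rf pC : repos (fun i j => kappa (C i j)).
  move=> z; have E : (fun i j => kappa (C i j)) =
      (fun i j => (i == j)%:R *: ((e * N)%:rc *: idfun) + kappa (B (i, j))).
    apply/funext => i; apply/funext => j; have A1 := cstar_id cA.
    have A2 := sub _ (BP (i, j)).1.
    rewrite (homD hk) ?(homZ cA hk) ?(hom_id hk) //; first exact: (subspaceZ (cstar_subspace cA)).
    by do 2!apply: (subspaceZ (cstar_subspace cA)).
  rewrite E diag ReD /=; have := pA z; have kd i j : bnd (kappa (A i j) - kappa (B (i, j))) e.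
    have [PB AB] := BP (i, j); rewrite -(homB cA hk); [|exact: clA|exact: sub].
    apply: (hom_bnd cA hk) AB; last exact: ltW.
    by apply: (subspaceB (cstar_subspace cA)); [exact: clA|exact: sub].
  have := diff _ (fun i j => kappa (A i j)) (fun i j => kappa (B (i, j))) e z (ltW e0) kd.
  have := Re_le_cabs (opform (fun i j => kappa (A i j)) z - opform (fun i j => kappa (B (i, j))) z).
  by rewrite ReD ReN; lra.
have := pC PC x; rewrite /C diag ReD /=.
have AB i j : bnd (A i j - B (i, j)) e by case: (BP (i, j)).
have := diff _ A (fun i j => B (i, j)) e x (ltW e0) AB.
have := Re_geN_cabs (opform A x - opform (fun i j => B (i, j)) x); rewrite ReD ReN.
by lra.
Qed.

End TroBasics.

(** * Rieffel induction of homomorphisms across a TRO *)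

Section Induction.
Context {R : realType}.
Variables (H K Z : hilbertType R) (P : set (H -> H)) (Q : set (K -> K)) (M : set (H -> K)).
Variable kappa : (H -> H) -> (Z -> Z).
Hypotheses (oP : operator_system P) (oQ : operator_system Q).
Hypothesis rM : tro_relates M P Q.
Hypothesis hk : unital_star_hom (cstar_generated P) kappa.

Let A := cstar_generated P.
Let D := cstar_generated Q.
Let bP := opsys_bop oP.
Let bQ := opsys_bop oQ.
Let cA : unital_cstar_subalgebra A := generated_cstar bP.
Let cD : unital_cstar_subalgebra D := generated_cstar bQ.
Let sA := cstar_subspace cA.
Let tM : tro M. Proof. by case: rM. Qed.
Let bM m : M m -> bounded_op m := tro_bop tM.
Let sM : subspace M. Proof. by case: tM. Qed.
Let M1 : op_closure (lin_span [set adj a \o b | a in M & b in M]) idfun.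
Proof. by case: rM => _ []. Qed.
Let M2 : op_closure (lin_span [set a \o adj b | a in M & b in M]) idfun.
Proof. by case: rM => _ []. Qed.
Let MQM a t b : M a -> Q t -> M b -> op_closure P (adj a \o t \o b).
Proof. by case: rM => _ _ h _; exact: h. Qed.
Let MPM a s b : M a -> P s -> M b -> op_closure Q (a \o s \o adj b).
Proof. by case: rM => _ _ _ h; exact: h. Qed.
Let PA f : op_closure P f -> A f.
Proof. by apply: op_closure_subset; [exact: (cstar_closed cA)|exact: sub_generated]. Qed.
Let QD f : op_closure Q f -> D f.
Proof. by apply: op_closure_subset; [exact: (cstar_closed cD)|exact: sub_generated]. Qed.
Let MM a b : M a -> M b -> A (adj a \o b).
Proof. by move=> Ma Mb; apply: PA; exact: (MQM Ma (opsys_id oQ) Mb). Qed.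
Let MM' a b : M a -> M b -> D (a \o adj b).
Proof. by move=> Ma Mb; apply: QD; exact: (MPM Ma (opsys_id oP) Mb). Qed.

(* The largest module over both algebras on which kappa can be induced. *)
Definition tro_hull : set (H -> K) :=
  [set n | bounded_op n /\ forall m, M m -> A (adj m \o n)].

Let bN n : tro_hull n -> bounded_op n. Proof. by case. Qed.

Lemma tro_sub_hull : M `<=` tro_hull.
Proof. by move=> m Mm; split=> [|a Ma]; [exact: bM|exact: MM]. Qed.

Let comp_lin (U V W : lmodType R[i]) (f : V -> W) a (g h : U -> V) :
  linear f -> f \o (a *: g + h) = a *: (f \o g) + (f \o h).
Proof. by move=> lf; apply/funext => x; exact: lf. Qed.

Lemma tro_hull_subspace : subspace tro_hull.
Proof.
split=> [|a n n' [bn hn] [bn' hn']].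
  split=> [|m Mm]; first exact: bop0.
  have -> : adj m \o (0 : H -> K) = 0 :> (H -> H).
    by apply/funext => x /=; exact: (lin0 (bop_lin (bop_adj (bM Mm)))).
  exact: subspace0.
split=> [|m Mm]; first exact: (bop_subspace H K).2.
rewrite comp_lin; last exact/bop_lin/bop_adj/bM.
by apply: sA.2; [exact: hn|exact: hn'].
Qed.

(** Inserting [a \o adj b] in the middle turns the product into [adj (adj a \o n) \o (adj b \o n')],
    whose factors lie in [A]. *)
Lemma tro_hull_gram n n' : tro_hull n -> tro_hull n' -> A (adj n \o n').
Proof.
move=> [bn hn] [bn' hn'].
apply: (closure_insert _ M2 (bop_adj bn) bn' sA (cstar_closed cA)).
  by move=> _ [a Ma [b Mb <-]]; apply: bop_comp; [exact: bM|exact/bop_adj/bM].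
move=> _ [a Ma [b Mb <-]]; have ba := bM Ma.
have := cstar_comp cA (cstar_adj cA (hn _ Ma)) (hn' _ Mb).
by rewrite (adj_comp (bop_adj ba) bn) (adjK ba).
Qed.

Lemma tro_hull_mulr n f : tro_hull n -> A f -> tro_hull (n \o f).
Proof.
move=> [bn hn] Af; split=> [|m Mm]; first by apply: bop_comp => //; exact: (cstar_bop cA).
exact: (cstar_comp cA (hn _ Mm) Af).
Qed.

(** The condition on [adj d] makes this set selfadjoint; being a C*-algebra, it contains [D] as soon
    as it contains [Q]. *)
Let Dhat := [set d | [/\ bounded_op d, forall n, tro_hull n -> tro_hull (d \o n) &
                        forall n, tro_hull n -> tro_hull (adj d \o n)]].

Let Dhat_cstar : unital_cstar_subalgebra Dhat.
Proof.
have lin a d d' : (forall n, tro_hull n -> tro_hull (d \o n)) ->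
    (forall n, tro_hull n -> tro_hull (d' \o n)) ->
    forall n, tro_hull n -> tro_hull ((a *: d + d') \o n).
  move=> h h' n hn; change (tro_hull (a *: (d \o n) + (d' \o n))).
  by apply: tro_hull_subspace.2; [exact: h|exact: h'].
have clos d : op_closure [set d | bounded_op d /\
    forall n, tro_hull n -> tro_hull (d \o n)] d ->
    forall n, tro_hull n -> tro_hull (d \o n).
  move=> hd n hn; have [bd _] := hd; split=> [|m Mm].
    by apply: bop_comp => //; exact: bN.
  apply: (cstar_closed cA).
  apply: (op_closure_comp (bop_adj (bM Mm)) (bN hn) _ hd) => x [bx hx].
  have [_ /(_ m Mm) Ax] := hx n hn.
  exact: (sub_op_closure (cstar_bop cA Ax) Ax).
split; [split| |].
- by move=> d [].
- split.
    have h0 n : tro_hull n -> tro_hull (0 \o n).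
      move=> _; exact: (subspace0 tro_hull_subspace).
    by split; rewrite ?adj0 //; exact: bop0.
  move=> a d d' [bd h1 h2] [bd' h1' h2']; split; [|exact: lin|].
    exact: (bop_subspace K K).2.
  by rewrite adj_lincomb //; exact: lin.
- by split; rewrite ?adj_id //; exact: bop_id.
- by move=> d [bd h h']; split; rewrite ?adjK //; exact: bop_adj.
- move=> d d' [bd h1 h2] [bd' h1' h2']; split; first exact: bop_comp.
    by move=> n hn; exact: (h1 _ (h1' _ hn)).
  by rewrite (adj_comp bd bd') => n hn; exact: (h2' _ (h2 _ hn)).
move=> d hd; have [bd _] := hd; split=> //.
  by apply: clos; apply: op_closureS hd => x [bx h _].
apply: clos; apply: op_closure_adj hd => x [bx h h'] //.
by split=> //; exact: bop_adj.
Qed.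

(** For [t] in [Q], inserting [a \o adj b] between [t] and [n] gives
    [(adj m \o t \o a) \o (adj b \o n)], with both factors in [A]; generation by [Q] does the
    rest. *)
Lemma tro_hull_mull d n : D d -> tro_hull n -> tro_hull (d \o n).
Proof.
move=> Dd; suff [_ h _] : Dhat d by exact: h.
move: d Dd; apply: (generated_sub Dhat_cstar) => q Qq.
have half t : Q t -> forall n', tro_hull n' -> tro_hull (t \o n').
  move=> Qt n' [bn hn]; have bt := bQ Qt; split=> [|m Mm]; first exact: bop_comp.
  have bmt : bounded_op (adj m \o t) by apply: bop_comp => //; exact/bop_adj/bM.
  apply: (closure_insert _ M2 bmt bn sA (cstar_closed cA)).
    by move=> _ [a Ma [b Mb <-]]; apply: bop_comp; [exact: bM|exact/bop_adj/bM].
  move=> _ [a Ma [b Mb <-]].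
  exact: (cstar_comp cA (PA (MQM Mm Qt Ma)) (hn _ Mb)).
by split; [exact: bQ|exact: half|exact/half/(opsys_adj oQ)].
Qed.

(** Operators outside the hull are sent to 0, so that the kernel below is total on pairs. *)
Let cut (n : H -> K) : H -> K := if `[< tro_hull n >] then n else 0.
Let cutE n : tro_hull n -> cut n = n.
Proof. by move=> hn; rewrite /cut asboolT. Qed.
Let cut_hull n : tro_hull (cut n).
Proof.
rewrite /cut; case: ifPn => [/asboolP //|_]; exact: (subspace0 tro_hull_subspace).
Qed.

Let X : Type := ((H -> K) * Z)%type.
(** The inner product of the interior tensor product of the hull with [Z] along [kappa]. *)
Let ker (p q : X) : R[i] := '[kappa (adj (cut q.1) \o cut p.1) p.2, q.2].
Let gramA n n' : A (adj (cut n) \o cut n') := tro_hull_gram (cut_hull n) (cut_hull n').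

Let ker_herm p q : ker q p = cj (ker p q).
Proof.
have G := gramA q.1 p.1; have bk := hom_bop hk G.
rewrite /ker innerC; congr cj; rewrite (adjP bk) -(hom_adj hk G).
rewrite (adj_comp (bop_adj (bN (cut_hull q.1))) (bN (cut_hull p.1))).
by rewrite (adjK (bN (cut_hull q.1))) innerC -innerC.
Qed.

(** The inserted positive [T] serves twice: as the identity it gives positivity of the kernel, and
    as [c ^+ 2 - adj d \o d] it bounds the action of [d]. *)
Let ker_pos_gen (T : K -> K) (l : seq (R[i] * X)) : bounded_op T ->
  (forall v, 0 <= Re '[T v, v]) ->
  (forall n n', A (adj (cut n) \o (T \o cut n'))) ->
  0 <= Re (kform (fun p q : X => '[kappa (adj (cut q.1) \o (T \o cut p.1)) p.2, q.2]) l l).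
Proof.
move=> bT T0 AT; pose t (i : 'I_(size l)) := tnth (in_tuple l) i.
pose B i j := adj (cut (t i).2.1) \o (T \o cut (t j).2.1).
have pB : repos B.
  move=> x; pose v := \sum_i cut (t i).2.1 (x i).
  have -> : opform B x = '[T v, v]; last exact: T0.
  rewrite /v (lin_sum (bop_lin bT)) inner_sumr; apply: eq_bigr => i _.
  rewrite inner_suml; apply: eq_bigr => j _.
  by rewrite /B /= (adjPr (bN (cut_hull _))).
have := hom_repos cA hk (fun i j => AT (t i).2.1 (t j).2.1) pB.
move=> /(_ (fun i => (t i).1 *: (t i).2.2)); congr (0 <= Re _).
rewrite /opform exchange_big /kform (big_tnth _ _ l); apply: eq_bigr => j _.
rewrite (big_tnth _ _ l); apply: eq_bigr => i _.
have bk := hom_bop hk (AT (t i).2.1 (t j).2.1).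
by rewrite (linZ (bop_lin bk)) innerZl innerZr mulrA.
Qed.

Let ker_pos l : 0 <= Re (kform ker l l).
Proof.
apply: (@ker_pos_gen idfun) => [|v|n n']; first exact: bop_id.
  by rewrite Re_inner_nm sqr_ge0.
exact: gramA.
Qed.

Let act (d : K -> K) (p : X) : X := (d \o cut p.1, p.2).

Let ker_act_le d c l : D d -> 0 <= c -> bnd d c ->
  Re (kform (fun p q => ker (act d p) (act d q)) l l) <= c ^+ 2 * Re (kform ker l l).
Proof.
move=> Dd c0 dc; have bd := cstar_bop cD Dd.
pose T := (c ^+ 2)%:rc *: idfun - (adj d \o d).
have Ddd := cstar_comp cD (cstar_adj cD Dd) Dd.
have DT : D T.
  apply: (subspaceB (cstar_subspace cD)) => //.
  by apply: (subspaceZ (cstar_subspace cD)); exact: (cstar_id cD).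
have cutd n : cut (d \o cut n) = d \o cut n.
  by apply: cutE; apply: tro_hull_mull => //; exact: cut_hull.
have posT v : 0 <= Re '[T v, v].
  change (0 <= Re '[(c ^+ 2)%:rc *: v - adj d (d v), v]).
  rewrite innerBl innerZl adjPr // !inner_nm -rcM -rcB /= subr_ge0 -exprMn.
  by rewrite ler_sqr ?nnegrE ?mulr_ge0 ?nm_ge0.
have AT n n' : A (adj (cut n) \o (T \o cut n')).
  by apply: tro_hull_gram; [exact: cut_hull|apply: tro_hull_mull => //; exact: cut_hull].
have := ker_pos_gen l (cstar_bop cD DT) posT AT.
suff -> : kform (fun p q : X => '[kappa (adj (cut q.1) \o (T \o cut p.1)) p.2, q.2]) l l =
    (c ^+ 2)%:rc * kform ker l l - kform (fun p q => ker (act d p) (act d q)) l l.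
  by rewrite ReD ReN ReZ subr_ge0.
rewrite /kform mulr_sumr -sumrB; apply: eq_bigr => p _.
rewrite mulr_sumr -sumrB; apply: eq_bigr => q _; set e := p.1 * cj q.1.
rewrite mulrCA -mulrBr; congr (e * _).
have h1 := gramA q.2.1 p.2.1; have h2 := gramA (act d q.2).1 (act d p.2).1.
rewrite /ker -innerZl -innerBl /act /= !cutd in h2 *.
have -> : adj (cut q.2.1) \o (T \o cut p.2.1) = (c ^+ 2)%:rc *: (adj (cut q.2.1) \o cut p.2.1)
    - (adj (d \o cut q.2.1) \o (d \o cut p.2.1)).
  have ln := bop_lin (bop_adj (bN (cut_hull q.2.1))).
  rewrite (adj_comp bd (bN (cut_hull _))); apply/funext => v.
  rewrite [LHS](linB ln) [X in X - _](linZ ln); by [].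
by rewrite (homB cA hk) ?(homZ cA hk) //; exact: (subspaceZ sA).
Qed.

(** [theta d] multiplies the first factor of [n (x) z], and [M'] consists of the operators taking
    [z] to [m (x) z] with [m] in [M]. Order reflection passes from [kappa] to [theta] because sums
    of vectors [m h] are dense in [K], which turns matrices over [Q] into matrices over the closure
    of [P]. *)
Theorem induction : exists (Y : hilbertType R) (theta : (K -> K) -> (Y -> Y))
    (M' : set (Z -> Y)),
  [/\ unital_star_hom (cstar_generated Q) theta,
      tro_relates M' (kappa @` P) (theta @` Q) &
      (forall (I : finType) (B : I -> I -> H -> H), (forall i j, P (B i j)) ->
         repos (fun i j => kappa (B i j)) -> repos B) ->
      forall (I : finType) (B : I -> I -> K -> K), (forall i j, Q (B i j)) ->
         repos (fun i j => theta (B i j)) -> repos B].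
Proof.
have [Y [e [ek te]]] := kernel_hilbert ker_herm ker_pos.
have /choice[theta thP] d : exists t : Y -> Y, D d ->
    bounded_op t /\ forall p, t (e p) = e (act d p).
  have [Dd|nd] := pselect (D d); last by exists id.
  have bd := cstar_bop cD Dd; have [c c0 dc] := bop_bnd bd.
  have [|t [bt _ tP]] := @extend_operator R _ Y Y e (e \o act d) c te c0.
    move=> l; rewrite -ler_sqr ?nnegrE ?mulr_ge0 ?nm_ge0 // exprMn.
    rewrite (nm_combo _ ek) (nm_combo (e := e \o _) _ (fun p q => ek _ _)).
    exact: ker_act_le.
  by exists t.
have bt d : D d -> bounded_op (theta d) by move=> /thP[].
pose emb n : Z -> Y := fun z => e (n, z).
have embE n n' z z' : tro_hull n -> tro_hull n' ->
    '[emb n z, emb n' z'] = '[kappa (adj n' \o n) z, z'].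
  by move=> hn hn'; rewrite ek /ker /= !cutE.
have eE p : e p = emb (cut p.1) p.2.
  apply: (total_extr te) => q; rewrite /emb !ek /ker /= [cut (cut _)]cutE //; exact: cut_hull.
have thE d n z : D d -> tro_hull n -> theta d (emb n z) = emb (d \o n) z.
  by move=> Dd hn; have [_ ->] := thP _ Dd; rewrite /act /= cutE.
have extr y y' : (forall n z, tro_hull n -> '[y, emb n z] = '[y', emb n z]) -> y = y'.
  by move=> E; apply: (total_extr te) => p; rewrite eE E //; exact: cut_hull.
have ext (f g : Y -> Y) : bounded_op f -> bounded_op g ->
    (forall n z, tro_hull n -> f (emb n z) = g (emb n z)) -> f = g.
  by move=> bf bg E; apply: (total_ext te) => // p; rewrite eE E //; exact: cut_hull.
have emb_lin n : tro_hull n -> linear (emb n).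
  move=> hn a z z'; apply: extr => n' w hn'; rewrite innerDl innerZl !embE //.
  by rewrite (bop_lin (hom_bop hk (tro_hull_gram hn' hn))) innerDl innerZl.
have emb_bop n : tro_hull n -> bounded_op (emb n).
  move=> hn; apply/bopP; split; first exact: emb_lin.
  have [c c0 hc] := bop_bnd (hom_bop hk (tro_hull_gram hn hn)).
  exists (c + 1); first lra.
  move=> z; rewrite -ler_sqr ?nnegrE ?mulr_ge0 ?nm_ge0 //; last lra.
  rewrite -Re_inner_nm embE // exprMn; apply: (le_trans (Re_inner_le _ _)).
  apply: (@le_trans _ _ (c * nm z * nm z)); first by rewrite ler_wpM2r ?nm_ge0.
  by rewrite -mulrA -expr2 ler_wpM2r ?sqr_ge0 // expr2; nra.
have emb_add a n n' : tro_hull n -> tro_hull n' -> emb (a *: n + n') = a *: emb n + emb n'.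
  move=> hn hn'; have hl := tro_hull_subspace.2 a _ _ hn hn'.
  apply/funext => z; apply: extr => m w hm.
  change ('[emb (a *: n + n') z, emb m w] = '[a *: emb n z + emb n' z, emb m w]).
  rewrite innerDl innerZl !embE // comp_lin; last exact/bop_lin/bop_adj/bN.
  by rewrite (hom_lin hk) ?[LHS]innerDl ?[X in X + _]innerZl //; exact: tro_hull_gram.
have emb_gram n n' : tro_hull n -> tro_hull n' -> adj (emb n) \o emb n' = kappa (adj n \o n').
  move=> hn hn'; apply/funext => z; apply: inner_extl => w.
  by rewrite /= (adjPr (emb_bop _ hn)) embE.
have emb_mulr n f z : tro_hull n -> A f -> emb n (kappa f z) = emb (n \o f) z.
  move=> hn Af; have hnf := tro_hull_mulr hn Af; apply: extr => m w hm; rewrite !embE //.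
  by rewrite -[in RHS]/((adj m \o n) \o f) (hom_comp hk (tro_hull_gram hm hn) Af).
have emb_mull n n' : tro_hull n -> tro_hull n' -> D (n \o adj n') ->
    emb n \o adj (emb n') = theta (n \o adj n').
  move=> hn hn' Dn; apply: ext => [||m z hm]; last first.
  - rewrite thE //= -[adj (emb n') _]/((adj (emb n') \o emb m) z) emb_gram //.
    by rewrite emb_mulr //; exact: tro_hull_gram.
  - exact: bt.
  - by apply: bop_comp; [exact: emb_bop|apply: bop_adj; exact: emb_bop].
have hth : unital_star_hom D theta.
  split=> //.
  - move=> a d d' Dd Dd'; have Dl := (cstar_subspace cD).2 a _ _ Dd Dd'.
    apply: ext => [||n z hn]; first exact: bt.
      by apply: (bop_subspace Y Y).2; exact: bt.
    change (theta (a *: d + d') (emb n z) = a *: theta d (emb n z) + theta d' (emb n z)).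
    rewrite !thE // -[(a *: d + d') \o n]/(a *: (d \o n) + (d' \o n)).
    by rewrite emb_add //; exact: tro_hull_mull.
  - apply: ext => [||n z hn]; [by apply: bt; exact: (cstar_id cD)|exact: bop_id|].
    by rewrite thE //; exact: (cstar_id cD).
  - move=> d d' Dd Dd'; have Dc := cstar_comp cD Dd Dd'.
    apply: ext => [||n z hn]; [exact: bt|by apply: bop_comp; exact: bt|].
    by rewrite /= !thE //; exact: tro_hull_mull.
  - move=> d Dd; have Da := cstar_adj cD Dd; have bd := cstar_bop cD Dd.
    apply/esym/(total_adj te); [exact: bt|exact: bt|move=> p q].
    rewrite !eE; have hp := cut_hull p.1; have hq := cut_hull q.1.
    have h1 := tro_hull_mull Dd hp; have h2 := tro_hull_mull Da hq.
    rewrite !thE // !embE //.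
    by rewrite (adj_comp (bop_adj bd) (bN hq)) (adjK bd).
have sMh := tro_sub_hull.
exists Y, theta, [set emb m | m in M]; split=> //.
- split.
  + split.
    * by move=> _ [m Mm <-]; apply: emb_bop; exact: sMh.
    * split.
        exists 0; first exact: (subspace0 sM).
        have h0 := subspace0 tro_hull_subspace.
        have := emb_add (-1) _ _ h0 h0; rewrite scaler0 addr0 => ->.
        by rewrite scaleN1r addNr.
      move=> a _ _ [m Mm <-] [m' Mm' <-]; exists (a *: m + m'); first exact: sM.2.
      by rewrite emb_add //; exact: sMh.
    * move=> _ _ _ [a Ma <-] [b Mb <-] [c Mc <-].
      have Mabc : M (a \o adj b \o c) by case: tM => _ _; exact.
      exists (a \o adj b \o c) => //; apply/funext => z /=.
      rewrite -[adj (emb b) _]/((adj (emb b) \o emb c) z) (emb_gram _ _ (sMh _ Mb) (sMh _ Mc)).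
      by rewrite (emb_mulr _ _ _ (sMh _ Ma) (MM Mb Mc)).
  (* Nondegeneracy: [kappa] and [theta] are norm continuous and unital, so they carry approximations
     of the identity by spans over [M] to such approximations over [M']. *)
  + have span_image (L L' : hilbertType R) (X1 B : set (L -> L)) (X2 : set (L' -> L')) f :
        unital_cstar_subalgebra B -> unital_star_hom B f -> X1 `<=` B ->
        (forall x, X1 x -> X2 (f x)) -> lin_span X1 `<=` B /\ f @` lin_span X1 `<=` lin_span X2.
      move=> cB hf XB X12; have sB := cstar_subspace cB.
      have : lin_span X1 `<=` [set x | B x /\ lin_span X2 (f x)].
        apply: lin_span_ind => [|x Xx]; last by split; [exact: XB|by apply: sub_lin_span; exact: X12].
        split=> [|a x y [Bx Xx] [By Xy]].
          split; first exact: subspace0.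
          by rewrite (hom0 cB hf); exact: (subspace0 (lin_span_subspace X2)).
        split; first exact: sB.2.
        by rewrite (hom_lin hf) //; exact: (lin_span_subspace X2).2.
      by move=> h; split=> [x /h[]//|_ [x /h[_ ?] <-]].
    split.
      have [|x [a Ma [b Mb <-]]|s1 s2] := @span_image H Z [set adj a \o b | a in M & b in M] A
         [set adj a \o b | a in [set emb m | m in M] & b in [set emb m | m in M]] kappa cA hk.
      * by move=> _ [a Ma [b Mb <-]]; exact: MM.
      * exists (emb a); first by exists a.
        exists (emb b); first by exists b.
        by apply: emb_gram; exact: sMh.
      by have := hom_closure cA hk s1 M1; rewrite (hom_id hk); exact: op_closureS.
    have [|x [a Ma [b Mb <-]]|s1 s2] := @span_image K Y [set a \o adj b | a in M & b in M] D
         [set a \o adj b | a in [set emb m | m in M] & b in [set emb m | m in M]] theta cD hth.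
    * by move=> _ [a Ma [b Mb <-]]; exact: MM'.
    * exists (emb a); first by exists a.
      exists (emb b); first by exists b.
      by apply: emb_mull; [exact: sMh|exact: sMh|exact: MM'].
    by have := hom_closure cD hth s1 M2; rewrite (hom_id hth); exact: op_closureS.
  + move=> _ _ _ [a Ma <-] [q Qq <-] [b Mb <-].
    have Dq : D q by exact: sub_generated.
    have hb := sMh _ Mb; have ha := sMh _ Ma; have hqb := tro_hull_mull Dq hb.
    have -> : adj (emb a) \o theta q \o emb b = kappa (adj a \o q \o b).
      rewrite -[RHS](emb_gram _ _ ha hqb); apply/funext => z /=.
      by rewrite thE.
    apply: (hom_closure cA hk); [exact: sub_generated|exact: MQM].
  + move=> _ _ _ [a Ma <-] [p Pp <-] [b Mb <-].
    have Ap : A p by exact: sub_generated.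
    have hb := sMh _ Mb; have ha := sMh _ Ma; have hap := tro_hull_mulr ha Ap.
    have Dab := QD (MPM Ma Pp Mb).
    have -> : emb a \o kappa p \o adj (emb b) = theta (a \o p \o adj b).
      rewrite -(emb_mull _ _ hap hb) //; apply/funext => z /=.
      by rewrite emb_mulr.
    apply: (hom_closure cD hth); [exact: sub_generated|exact: MPM].
move=> rf I B QB pB.
have rfc := reflect_repos_closure oP hk rf.
(* The algebraic span of the vectors [m h]; it is dense because the identity of [K] is a norm limit
   of sums of [a \o adj b]. *)
pose E := [set y : K | exists n (m : 'I_n -> H -> K) (h : 'I_n -> H),
  (forall k, M (m k)) /\ y = \sum_(k < n) m k (h k)].
have E1 m h : M m -> E (m h).
  by move=> Mm; exists 1%N, (fun=> m), (fun=> h); rewrite big_ord1.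
have sE : subspace E.
  split; first by exists 0%N, (fun=> 0), (fun=> 0); rewrite big_ord0; split=> // -[].
  move=> a _ _ [n [m [h [Mm ->]]]] [n' [m' [h' [Mm' ->]]]].
  exists (n + n')%N, (fun k => match fintype.split k with inl i => m i | inr j => m' j end),
    (fun k => match fintype.split k with inl i => a *: h i | inr j => h' j end).
  split=> [k|]; first by case: (fintype.split k).
  rewrite big_split_ord /= scaler_sumr; congr (_ + _); apply: eq_bigr => i _.
    by rewrite -[lshift n' i]/(unsplit (inl i)) unsplitK (linZ (bop_lin (bM (Mm i)))).
  by rewrite -[rshift n i]/(unsplit (inr i)) unsplitK.
have spanE f : lin_span [set a \o adj b | a in M & b in M] f -> forall y, E (f y).
  move: f; apply: lin_span_ind => [|_ [a Ma [b Mb <-]] y]; last exact: E1.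
  split=> [y|a f g hf hg y]; first exact: (subspace0 sE).
  exact: sE.2.
have bB i j : bounded_op (B i j) by exact/bQ/QB.
move=> x; apply: (repos_dense bB (E := E)) => [{}x hx|i eps eps0]; last first.
  have [_ h] := (op_closureP _ _).1 M2; have x1 : 0 < nm (x i) + 1 by have := nm_ge0 (x i); lra.
  have [f hf fx] := h _ (divr_gt0 eps0 x1); exists (f (x i)); first exact: spanE.
  apply: (le_trans (fx (x i))); rewrite mulrAC ler_pdivrMr // ler_wpM2l ?(ltW eps0) //; lra.
pose n i := sval (cid (hx i)); pose m i := sval (cid (svalP (cid (hx i)))).
pose h i := sval (cid (svalP (cid (svalP (cid (hx i)))))).
have mhP i : (forall k, M (m i k)) /\ x i = \sum_(k < n i) m i k (h i k).
  exact: svalP (cid (svalP (cid (svalP (cid (hx i)))))).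
pose T := {i : I & 'I_(n i)}.
pose mm (p : T) := m (tag p) (tagged p); pose hh (p : T) := h (tag p) (tagged p).
have Mmm p : M (mm p) by exact: (mhP (tag p)).1.
have -> : x = fun i => \sum_(k < n i) mm (existT _ i k) (hh (existT _ i k)).
  by apply/funext => i; exact: (mhP i).2.
rewrite opform_sigma // => [|p]; last exact: bM.
apply: rfc => [p r|z]; first exact: (MQM (Mmm p) (QB _ _) (Mmm r)).
(* The same sums of TRO elements as in [x], with arbitrary vectors [z] of [Z] in place of the
   [hh p]; the resulting form has the entries [adj m \o B \o m] under [kappa]. *)
pose y i := \sum_(k < n i) emb (mm (existT _ i k)) (z (existT _ i k)).
have := pB y; congr (0 <= Re _).
rewrite (@opform_sigma _ _ _ _ n (fun i j => theta (B i j)) (fun p => emb (mm p)) z)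
  => [|i j|p]; last 2 first.
- by apply: bt; exact: sub_generated.
- by apply: emb_bop; exact: sMh.
apply: eq_bigr => p _; apply: eq_bigr => r _; congr ('[_, _]).
have Dq : D (B (tag p) (tag r)) by exact: sub_generated.
have hb := sMh _ (Mmm r); have ha := sMh _ (Mmm p); have hqb := tro_hull_mull Dq hb.
rewrite -[in RHS]/(adj (mm p) \o (B (tag p) (tag r) \o mm r)) -(emb_gram _ _ ha hqb) /=.
by rewrite thE.
Qed.

End Induction.

(** * Transitivity of TRO-equivalence *)

Section TroComposition.
Context {R : realType}.
Implicit Types H K L : hilbertType R.

Lemma span_compl H K L (X : set (H -> K)) (E : set (L -> K)) u f :
  subspace E -> (forall x, X x -> E (x \o u)) -> lin_span X f -> E (f \o u).
Proof.
move=> sE XE hf; suff : lin_span X `<=` [set g : H -> K | E (g \o u)] by apply.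
apply: lin_span_ind => //; split=> [|a g h Eg Eh]; first exact: (subspace0 sE).
exact: (sE.2 a _ _ Eg Eh).
Qed.

Lemma span_compr H K L (X : set (H -> K)) (E : set (H -> L)) (u : K -> L) f : linear u ->
  subspace E -> (forall x, X x -> E (u \o x)) -> lin_span X f -> E (u \o f).
Proof.
move=> lu sE XE hf; suff : lin_span X `<=` [set g : H -> K | E (u \o g)] by apply.
apply: lin_span_ind => //; split=> [|a g h Eg Eh] /=.
  have -> : u \o (0 : H -> K) = 0 :> (H -> L) by apply/funext => x; exact: (lin0 lu).
  exact: (subspace0 sE).
have -> : u \o (a *: g + h) = a *: (u \o g) + (u \o h) by apply/funext => x; exact: lu.
exact: sE.2.
Qed.

Lemma span_adj H K (X : set (H -> K)) (F : set (K -> H)) f : X `<=` @bounded_op R H K ->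
  subspace F -> (forall x, X x -> F (adj x)) -> lin_span X f -> F (adj f).
Proof.
move=> bX sF XF hf.
have : lin_span X `<=` [set g : H -> K | bounded_op g /\ F (adj g)].
  apply: lin_span_ind => [|x Xx]; last by split; [exact: bX|exact: XF].
  split=> [|a g h [bg Fg] [bh Fh]].
    by split; [exact: bop0|rewrite adj0; exact: (subspace0 sF)].
  split; first exact: (bop_subspace H K).2.
  by rewrite adj_lincomb //; exact: sF.2.
by move=> /(_ _ hf)[].
Qed.

Lemma op_closure_opsys_adj H (X : set (H -> H)) f : operator_system X ->
  op_closure X f -> op_closure X (adj f).
Proof.
by move=> oX; apply: op_closure_adj; [exact: (opsys_bop oX)|exact: (opsys_adj oX)].
Qed.

(** Inserting [adj c \o d] to the right of [x] brackets the product as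
    [adj a \o (b \o x \o adj c) \o d], which passes into the closure of [T] and back into that of
    [X]. *)
Lemma tro_module H K (M : set (H -> K)) X T a b x : tro_relates M X T ->
  subspace X -> M a -> M b -> op_closure X x -> op_closure X ((adj a \o b) \o x).
Proof.
move=> [tM [M1 _] MT MX] sX Ma Mb hx.
have bM m (Mm : M m) := tro_bop tM Mm; have bx := op_closure_bop hx.
have bf : bounded_op ((adj a \o b) \o x).
  by apply: bop_comp => //; apply: bop_comp; [exact/bop_adj/bM|exact: bM].
apply: (closure_insert (g := idfun) _ M1 bf (@bop_id R H) (op_closure_subspace sX)).
- by move=> _ [c Mc [d Md <-]]; apply: bop_comp; [exact/bop_adj/bM|exact: bM].
- by move=> y; exact: op_closure_idem.
move=> _ [c Mc [d Md <-]].
have h1 : op_closure T (b \o x \o adj c).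
  by apply: (op_closure_comp (bM _ Mb) (bop_adj (bM _ Mc)) _ hx) => y Xy; exact: MX.
by apply: (op_closure_comp (bop_adj (bM _ Ma)) (bM _ Md) _ h1) => y Ty; exact: MT.
Qed.

Section Compose.
Variables (H K L : hilbertType R) (N : set (H -> K)) (M : set (K -> L)).
Variables (P : set (H -> H)) (X : set (K -> K)) (T : set (L -> L)).
Hypotheses (oP : operator_system P) (oX : operator_system X) (oT : operator_system T).
Hypotheses (rN : tro_relates N P X) (rM : tro_relates M X T).

Let tN : tro N. Proof. by case: rN. Qed.
Let tM : tro M. Proof. by case: rM. Qed.
Let bN n : N n -> bounded_op n := tro_bop tN.
Let bM m : M m -> bounded_op m := tro_bop tM.
Let sX := op_closure_subspace (opsys_subspace oX).

(* Words in M^* M and N N^*; both algebras multiply the closure of X into itself. *)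
Definition tro_words : set (K -> K) := smallest (@star_algebra R K)
  ([set adj a \o b | a in M & b in M] `|` [set c \o adj d | c in N & d in N]).

Let multiplier : set (K -> K) := [set w | [/\ bounded_op w,
  forall x, op_closure X x -> op_closure X (w \o x) &
  forall x, op_closure X x -> op_closure X (x \o w)]].

Let multiplier_star : star_algebra multiplier.
Proof.
split; first split.
- by move=> w [].
- split.
    split; [exact: bop0|by move=> x _; exact: (subspace0 sX)|move=> x hx].
    have -> : x \o (0 : K -> K) = 0 :> (K -> K).
      by apply/funext => v; exact: (lin0 (bop_lin (op_closure_bop hx))).
    exact: (subspace0 sX).
  move=> a w w' [bw h1 h2] [bw' h1' h2']; split; first exact: (bop_subspace K K).2.
    by move=> x hx; exact: (sX.2 a _ _ (h1 _ hx) (h1' _ hx)).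
  move=> x hx; have -> : x \o (a *: w + w') = a *: (x \o w) + (x \o w').
    by apply/funext => v; exact: (bop_lin (op_closure_bop hx)).
  exact: (sX.2 a _ _ (h2 _ hx) (h2' _ hx)).
- by split=> //; exact: bop_id.
- move=> w [bw h1 h2]; split; first exact: bop_adj.
    move=> x hx; have bx := op_closure_bop hx.
    have := op_closure_opsys_adj oX (h2 _ (op_closure_opsys_adj oX hx)).
    by rewrite (adj_comp (bop_adj bx) bw) (adjK bx).
  move=> x hx; have bx := op_closure_bop hx.
  have := op_closure_opsys_adj oX (h1 _ (op_closure_opsys_adj oX hx)).
  by rewrite (adj_comp bw (bop_adj bx)) (adjK bx).
move=> w w' [bw h1 h2] [bw' h1' h2']; split; first exact: bop_comp.
  by move=> x hx; exact: (h1 _ (h1' _ hx)).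
by move=> x hx; exact: (h2' _ (h2 _ hx)).
Qed.

Let gens_multiplier :
  [set adj a \o b | a in M & b in M] `|` [set c \o adj d | c in N & d in N] `<=` multiplier.
Proof.
have sub (K' : hilbertType R) (M' : set (K -> K')) T' a b : tro_relates M' X T' ->
    M' a -> M' b -> multiplier (adj a \o b).
  move=> rM' Ma Mb; have [tM' _ _ _] := rM'.
  have ba := tro_bop tM' Ma; have bb := tro_bop tM' Mb.
  have sX0 := opsys_subspace oX.
  split; [by apply: bop_comp => //; exact: bop_adj|by move=> x; exact: (tro_module rM')|].
  move=> x hx; have bx := op_closure_bop hx.
  have := op_closure_opsys_adj oX (tro_module rM' sX0 Mb Ma (op_closure_opsys_adj oX hx)).
  have bba := bop_comp (bop_adj bb) ba.
  by rewrite (adj_comp bba (bop_adj bx)) (adj_comp (bop_adj bb) ba) (adjK bx) (adjK bb).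
move=> _ [[a Ma [b Mb <-]]|[c Nc [d Nd <-]]]; first exact: (sub _ M T).
rewrite -(adjK (bN Nc)); apply: (sub _ _ P _ _ (tro_adj rN)); [by exists c|by exists d].
Qed.

Let words_multiplier : tro_words `<=` multiplier.
Proof. by move=> w; apply; split; [exact: multiplier_star|exact: gens_multiplier]. Qed.

Let words_star : star_algebra tro_words.
Proof.
split; first split.
- by move=> w /words_multiplier[].
- split=> [B [[oB _] _]|a w w' hw hw' B [sB GB]]; first exact: (subspace0 (opsys_subspace oB)).
  by apply: (opsys_subspace sB.1).2; [exact: hw|exact: hw'].
- by move=> B [[oB _] _]; exact: (opsys_id oB).
- by move=> w hw B [sB GB]; apply: (opsys_adj sB.1); exact: hw.
by move=> w w' hw hw' B [sB GB]; apply: sB.2; [exact: hw|exact: hw'].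
Qed.

Let wordsM a b : M a -> M b -> tro_words (adj a \o b).
Proof. by move=> Ma Mb B [_]; apply; left; exists a => //; exists b. Qed.
Let wordsN c d : N c -> N d -> tro_words (c \o adj d).
Proof. by move=> Nc Nd B [_]; apply; right; exists c => //; exists d. Qed.
Let words1 : tro_words idfun := opsys_id words_star.1.
Let wordsA w : tro_words w -> tro_words (adj w).
Proof. exact: (opsys_adj words_star.1). Qed.
Let words_bop w : tro_words w -> bounded_op w.
Proof. by move=> /words_multiplier[]. Qed.

(** Products [m \o n] alone need not be closed under the triple product, which puts
    [n \o adj n1 \o adj m1 \o m2] between the outer factors; the words absorb it. *)
Definition tro_simple : set (H -> L) :=
  [set f | exists m w n, [/\ M m, tro_words w, N n & f = m \o w \o n]].

Let simple_bop : tro_simple `<=` @bounded_op R H L.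
Proof.
move=> _ [m [w [n [Mm Ww Nn ->]]]]; apply: bop_comp; last exact: bN.
by apply: bop_comp; [exact: bM|exact: words_bop].
Qed.

Let simple_adj m w n : M m -> tro_words w -> N n ->
  adj (m \o w \o n) = adj n \o adj w \o adj m.
Proof.
move=> Mm Ww Nn; have bm := bM Mm; have bw := words_bop Ww.
by rewrite (adj_comp (bop_comp bm bw) (bN Nn)) (adj_comp bm bw).
Qed.

(** [M] carries [T] into the closure of [X], the words keep it there, and [N] carries it on into the
    closure of [P]; the way back is symmetric. For nondegeneracy the approximate unit of one TRO is
    inserted between the factors of the other. *)
Theorem tro_compose : tro_relates (lin_span tro_simple) P T.
Proof.
have sS := lin_span_subspace tro_simple.
have bS := lin_span_bop simple_bop.
have sim m w n : M m -> tro_words w -> N n -> lin_span tro_simple (m \o w \o n).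
  by move=> Mm Ww Nn; apply: sub_lin_span; exists m, w, n.
have simMN m n : M m -> N n -> lin_span tro_simple (m \o n).
  by move=> Mm Nn; exact: (sim m idfun n Mm words1 Nn).
have [_ [N1 N2] NX NP] := rN; have [_ [M1 M2] MT MX] := rM.
split.
- split=> // a b c ha hb hc.
  apply: (span_compl (X := tro_simple) (u := adj b \o c) (f := a) sS _ ha) => x hx.
  have bx := simple_bop hx.
  have bc := bS _ hc.
  suff : lin_span tro_simple ((x \o adj b) \o c) by [].
  apply: (span_compr (u := x \o adj b) _ sS _ hc) => [|y hy].
    by apply: bop_lin; apply: bop_comp => //; exact/bop_adj/bS.
  have by' := simple_bop hy.
  have sF : subspace [set g : L -> H | linear g /\ lin_span tro_simple (x \o g \o y)].
    have lx := bop_lin bx; split=> [|e g g' [lg hg] [lg' hg']].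
      split; first by move=> e v v'; rewrite scaler0 addr0.
      have -> : x \o (0 : L -> H) \o y = 0 :> (H -> L) by apply/funext => v; exact: (lin0 lx).
      exact: (subspace0 sS).
    split.
      move=> t v v'; change (e *: g (t *: v + v') + g' (t *: v + v') =
        t *: (e *: g v + g' v) + (e *: g v' + g' v')).
      by rewrite lg lg' !scalerDr !scalerA (mulrC e t) addrACA.
    have -> : x \o (e *: g + g') \o y = e *: (x \o g \o y) + (x \o g' \o y).
      by apply/funext => v; exact: lx.
    exact: sS.2.
  suff [] : [set g : L -> H | linear g /\ lin_span tro_simple (x \o g \o y)] (adj b) by [].
  apply: (span_adj simple_bop sF _ hb) => z hz.
  split; first exact/bop_lin/bop_adj/simple_bop.
  move: hx hy hz => [m [w [n [Mm Ww Nn ->]]]] [m2 [w2 [n2 [Mm2 Ww2 Nn2 ->]]]].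
  move=> [m1 [w1 [n1 [Mm1 Ww1 Nn1 ->]]]]; rewrite simple_adj //.
  have Wc := words_star.2.
  exact: (sim _ _ _ Mm (Wc _ _ (Wc _ _ (Wc _ _ (Wc _ _ Ww (wordsN Nn Nn1)) (wordsA Ww1))
    (wordsM Mm1 Mm2)) Ww2) Nn2).
- have bMM : [set adj a \o b | a in M & b in M] `<=` @bounded_op R K K.
    by move=> _ [a Ma [b Mb <-]]; apply: bop_comp; [exact/bop_adj/bM|exact: bM].
  have bNN : [set a \o adj b | a in N & b in N] `<=` @bounded_op R K K.
    by move=> _ [a Ma [b Mb <-]]; apply: bop_comp; [exact: bN|exact/bop_adj/bN].
  split.
  + apply: op_closure_idem; apply: op_closureS N1.
    apply: lin_span_ind; first exact/op_closure_subspace/lin_span_subspace.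
    move=> _ [a Na [b Nb <-]].
    apply: (closure_insert bMM M1 (bop_adj (bN Na)) (bN Nb)).
    * exact/op_closure_subspace/lin_span_subspace.
    * by move=> y; exact: op_closure_idem.
    move=> _ [c Mc [d Md <-]]; apply: sub_op_closure.
      have b1 := bop_comp (bop_adj (bM Mc)) (bM Md).
      exact: (bop_comp (bop_comp (bop_adj (bN Na)) b1) (bN Nb)).
    apply: sub_lin_span; exists (c \o a); first exact: simMN.
    exists (d \o b); first exact: simMN.
    by rewrite (adj_comp (bM Mc) (bN Na)).
  + apply: op_closure_idem; apply: op_closureS M2.
    apply: lin_span_ind; first exact/op_closure_subspace/lin_span_subspace.
    move=> _ [a Ma [b Mb <-]].
    apply: (closure_insert bNN N2 (bM Ma) (bop_adj (bM Mb))).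
    * exact/op_closure_subspace/lin_span_subspace.
    * by move=> y; exact: op_closure_idem.
    move=> _ [c Nc [d Nd <-]]; apply: sub_op_closure.
      have b1 := bop_comp (bN Nc) (bop_adj (bN Nd)).
      exact: (bop_comp (bop_comp (bM Ma) b1) (bop_adj (bM Mb))).
    apply: sub_lin_span; exists (a \o c); first exact: simMN.
    exists (b \o d); first exact: simMN.
    by rewrite (adj_comp (bM Mb) (bN Nd)).
- move=> a t b ha Tt hb; have sP := op_closure_subspace (opsys_subspace oP).
  have bt := opsys_bop oT Tt.
  apply: (span_compr (u := adj a \o t) _ sP _ hb) => [|y hy].
    by apply: bop_lin; apply: bop_comp => //; exact/bop_adj/bS.
  have sF : subspace [set g : L -> H | op_closure P (g \o t \o y)].
    split; first exact: (subspace0 sP).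
    by move=> e g g' hg hg'; exact: (sP.2 e _ _ hg hg').
  apply: (span_adj simple_bop sF _ ha) => x hx.
  move: hx hy => [m [w [n [Mm Ww Nn ->]]]] [m2 [w2 [n2 [Mm2 Ww2 Nn2 ->]]]] /=.
  rewrite simple_adj //.
  have h1 := MT _ _ _ Mm Tt Mm2.
  have [_ h2 _] := words_multiplier (wordsA Ww); have [_ _ h3] := words_multiplier Ww2.
  have h4 := h3 _ (h2 _ h1).
  by apply: (op_closure_comp (bop_adj (bN Nn)) (bN Nn2) _ h4) => z Xz; exact: NX.
move=> a s b ha Ps hb; have sT := op_closure_subspace (opsys_subspace oT).
have bs := opsys_bop oP Ps.
apply: (span_compl (X := tro_simple) (u := s \o adj b) (f := a) sT _ ha) => x hx.
have lx := bop_lin (bop_comp (simple_bop hx) bs).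
have sF : subspace [set g : L -> H | op_closure T ((x \o s) \o g)].
  split=> [|e g g' hg hg'] /=.
    have -> : (x \o s) \o (0 : L -> H) = 0 :> (L -> L) by apply/funext => v; exact: (lin0 lx).
    exact: (subspace0 sT).
  have -> : (x \o s) \o (e *: g + g') = e *: ((x \o s) \o g) + ((x \o s) \o g').
    by apply/funext => v; exact: lx.
  exact: (sT.2 e _ _ hg hg').
apply: (span_adj simple_bop sF _ hb) => y hy.
move: hx hy {lx sF} => [m [w [n [Mm Ww Nn ->]]]] [m2 [w2 [n2 [Mm2 Ww2 Nn2 ->]]]] /=.
rewrite simple_adj //.
have h1 := NP _ _ _ Nn Ps Nn2.
have [_ h2 _] := words_multiplier Ww; have [_ _ h3] := words_multiplier (wordsA Ww2).
have h4 := h3 _ (h2 _ h1).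
by apply: (op_closure_comp (bM Mm) (bop_adj (bM Mm2)) _ h4) => z Xz; exact: MX.
Qed.

End Compose.
End TroComposition.

(** * Projections in the universal representation *)

Section Compressions.
Context {R : realType}.
Implicit Types H K L U Y : hilbertType R.

Section Corner.
Variables (U : hilbertType R) (p : projection U).

Definition corner (f : U -> U) : prange p -> prange p := fun x => pproj p (f (val x)).

Lemma prange_id (x : prange p) : p (val x) = val x.
Proof. exact/eqP/(valP x). Qed.

Lemma corner_inner f (x y : prange p) : '[corner f x, y] = '[f (val x), val y].
Proof.
change ('[p (f (val x)), val y] = '[f (val x), val y]).
by rewrite proj_selfadj prange_id.
Qed.

Lemma opform_corner (I : finType) (f : I -> I -> U -> U) (x : I -> prange p) :
  opform (fun i j => corner (f i j)) x = opform f (fun i => val (x i)).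
Proof.
by rewrite /opform; apply: eq_bigr => i _; apply: eq_bigr => j _; exact: corner_inner.
Qed.

Lemma corner_lin a f g : corner (a *: f + g) = a *: corner f + corner g.
Proof.
apply/funext => x; apply: val_inj.
change (p (a *: f (val x) + g (val x)) = a *: p (f (val x)) + p (g (val x))).
exact: linearP.
Qed.

Lemma proj_bop : bounded_op p.
Proof. by split; [move=> a x y; exact: linearP|exact: proj_continuous]. Qed.

Lemma corner_bop f : bounded_op f -> bounded_op (corner f).
Proof.
move=> bf; have := bop_comp proj_bop bf => /bopP[lpf [c c0 hc]].
apply/bopP; split; last by exists c => // x; exact: hc.
by move=> a x y; apply: val_inj; exact: lpf.
Qed.

Lemma corner_id : corner idfun = idfun.
Proof. by apply/funext => x; exact: pprojK. Qed.

Lemma corner_comp f g : p \o f = f \o p -> p \o g = g \o p ->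
  corner (f \o g) = corner f \o corner g.
Proof.
move=> pf pg; apply/funext => x; apply: val_inj.
change (p (f (g (val x))) = p (f (p (g (val x))))).
have E v : p (g v) = g (p v) by exact: (congr1 (fun h => h v) pg).
by rewrite E prange_id.
Qed.

Lemma corner_adj f : bounded_op f -> adj (corner f) = corner (adj f).
Proof.
move=> bf; apply: (adj_uniq (corner_bop bf)) => x y.
by rewrite corner_inner innerC [X in _ = X]innerC corner_inner -adjPr // -[in RHS]innerC innerC.
Qed.

Lemma corner_hom H (A : set (H -> H)) sigma : unital_star_hom A sigma ->
  (forall a, A a -> p \o sigma a = sigma a \o p) ->
  unital_star_hom A (fun a => corner (sigma a)).
Proof.
move=> hs ps; split.
- by move=> f Af; exact/corner_bop/(hom_bop hs).
- by move=> a f g Af Ag; rewrite (hom_lin hs) // corner_lin.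
- by rewrite (hom_id hs) corner_id.
- by move=> f g Af Ag; rewrite (hom_comp hs) // corner_comp //; exact: ps.
by move=> f Af; rewrite (hom_adj hs) // corner_adj //; exact: (hom_bop hs).
Qed.

Lemma commuting_cstar : unital_cstar_subalgebra [set f | bounded_op f /\ p \o f = f \o p].
Proof.
have lp a x y : p (a *: x + y) = a *: p x + p y by exact: linearP.
have at_ f x : p \o f = f \o p -> p (f x) = f (p x) by move=> E; exact: (congr1 (fun u => u x) E).
split; [split|move=> g h [bg Eg] [bh Eh]|move=> g hg].
- by move=> g [].
- split; first by split; [exact: bop0|apply/funext => x; exact: linear0].
  move=> a g h [bg Eg] [bh Eh]; split; first exact: (bop_subspace U U).2.
  apply/funext => x; change (p (a *: g x + h x) = a *: g (p x) + h (p x)).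
  by rewrite lp (at_ g) // (at_ h).
- by split; first exact: bop_id.
- move=> g [bg Eg]; split; first exact: bop_adj.
  apply/funext => x; apply: inner_extr => z /=.
  by rewrite -proj_selfadj -adjP // -adjP // -proj_selfadj (at_ g).
- by split; [exact: bop_comp|apply/funext => x /=; rewrite (at_ g) // (at_ h)].
have bg := op_closure_bop hg; have /op_closureP[_ hcl] := hg; split=> //.
have [c c0 pc] := bop_bnd_gt0 proj_bop.
apply/eqP; rewrite -subr_eq0; apply/eqP/bnd_eq0 => e e0.
have c2 : 0 < c + c by lra.
have [h [bh Eh] gh] := hcl _ (divr_gt0 e0 c2).
have -> : (p \o g) - (g \o p) = (p \o (g - h)) + - ((g - h) \o p).
  apply/funext => x.
  change (p (g x) - g (p x) = p (g x - h x) - (g (p x) - h (p x))).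
  by rewrite linearB /= (at_ h) // opprB addrA subrK.
apply: (bnd_le _ (bndD (bnd_comp (ltW c0) pc gh) (bnd_opp (bnd_comp (ltW (divr_gt0 e0 c2)) gh pc)))).
by rewrite [X in _ + X]mulrC -mulrDl mulrC divfK ?gt_eqF.
Qed.

End Corner.

Arguments corner {U} p f.

Section HomGenerated.
Variables (H Z : hilbertType R) (S : set (H -> H)) (kappa : (H -> H) -> (Z -> Z)).
Hypotheses (oS : operator_system S) (hk : unital_star_hom (cstar_generated S) kappa).
Let cA := generated_cstar (opsys_bop oS).

Lemma hom_opsys : operator_system (kappa @` S).
Proof.
have sub := @sub_generated _ _ S; split.
- by move=> _ [f Sf <-]; exact: (hom_bop hk (sub _ Sf)).
- split; first by exists 0; [exact: (subspace0 (opsys_subspace oS))|exact: (hom0 cA hk)].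
  move=> a _ _ [f Sf <-] [g Sg <-]; exists (a *: f + g); first exact: (opsys_subspace oS).2.
  by apply: (hom_lin hk); exact: sub.
- by exists idfun; [exact: (opsys_id oS)|exact: (hom_id hk)].
move=> _ [f Sf <-]; exists (adj f); first exact: (opsys_adj oS).
by apply: (hom_adj hk); exact: sub.
Qed.

Lemma hom_generated f : cstar_generated S f -> cstar_generated (kappa @` S) (kappa f).
Proof.
have cB := generated_cstar (opsys_bop hom_opsys).
suff cC : unital_cstar_subalgebra
    [set f | cstar_generated S f /\ cstar_generated (kappa @` S) (kappa f)].
  move=> /(_ _ (conj cC _)) h; apply: (proj2 (h _)) => g Sg.
  by split; apply: sub_generated => //; exists g.
split; [split|move=> g h [Ag Bg] [Ah Bh]|move=> g hg].
- by move=> g [Ag _]; exact: (cstar_bop cA).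
- split.
    by split; [exact: (subspace0 (cstar_subspace cA))|rewrite (hom0 cA hk);
      exact: (subspace0 (cstar_subspace cB))].
  move=> a g h [Ag Bg] [Ah Bh]; split; first exact: (cstar_subspace cA).2.
  by rewrite (hom_lin hk) //; exact: (cstar_subspace cB).2.
- by split; [exact: (cstar_id cA)|rewrite (hom_id hk); exact: (cstar_id cB)].
- move=> g [Ag Bg]; split; first exact: (cstar_adj cA).
  by rewrite (hom_adj hk) //; exact: (cstar_adj cB).
- split; first exact: (cstar_comp cA).
  by rewrite (hom_comp hk) //; exact: (cstar_comp cB).
have Ag : cstar_generated S g by apply: (cstar_closed cA); apply: op_closureS hg => h [].
split=> //; apply: (cstar_closed cB).
apply: (op_closureS _ (hom_closure cA hk _ hg)) => [_ [h [Ah Bh] <-] //|h []//].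
Qed.

Lemma commuting_generated (p : projection Z) : (forall f, S f -> p \o kappa f = kappa f \o p) ->
  forall f, cstar_generated S f -> p \o kappa f = kappa f \o p.
Proof.
move=> pS f /hom_generated hf.
have [|_ //] := generated_sub (commuting_cstar p) _ hf.
by move=> _ [g Sg <-]; split; [apply: (hom_bop hk); exact: sub_generated|exact: pS].
Qed.

End HomGenerated.

Section ProjectionOfHom.
Variables (L U Y : hilbertType R) (A : set (L -> L)).
Variables (sigma : (L -> L) -> (U -> U)) (theta : (L -> L) -> (Y -> Y)).
Hypotheses (cA : unital_cstar_subalgebra A) (us : universal_rep A sigma).
Hypothesis ht : unital_star_hom A theta.

Let hs : unital_star_hom A sigma. Proof. by case: us. Qed.
Let sA := cstar_subspace cA.
Let bs a : A a -> bounded_op (sigma a). Proof. exact: (hom_bop hs). Qed.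
Let bt a : A a -> bounded_op (theta a). Proof. exact: (hom_bop ht). Qed.

Lemma vector_state y : nm y = 1 -> state A (fun a => '[theta a y, y]).
Proof.
move=> y1; split=> [c a b Aa Ab|a Aa|].
- by rewrite (hom_lin ht) // -innerZl -innerDl.
- rewrite (hom_comp ht) ?(hom_adj ht) //; last exact: (cstar_adj cA).
  by rewrite /= adjPr ?inner_nm; [rewrite -rc0 rc_le sqr_ge0|exact: bt].
by rewrite (hom_id ht) inner_nm y1 expr1n.
Qed.

Section Vectors.
Variable Xi : set U.
Hypothesis Xi_orth : forall xi eta, Xi xi -> Xi eta -> xi <> eta ->
  forall a b, A a -> A b -> '[sigma a xi, sigma b eta] = 0.
Hypothesis Xi_state : forall f, state A f -> exists xi, Xi xi /\
  forall a, A a -> f a = '[sigma a xi, xi].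

Let occurs : set U := [set xi | Xi xi /\ exists y, forall a, A a ->
  '[sigma a xi, xi] = '[theta a y, y]].

(* Finite sums of the cyclic subspaces of the states that occur as vector states in theta. *)
Let hull : set U := [set x | exists s a, [/\ uniq s, forall xi, xi \in s -> occurs xi,
  forall xi, A (a xi), forall xi, xi \notin s -> a xi = 0 &
  x = \sum_(xi <- s) sigma (a xi) xi]].

Let hull_widen (s s' : seq U) (a : U -> L -> L) : uniq s -> uniq s' -> {subset s <= s'} ->
  (forall xi, xi \notin s -> a xi = 0) ->
  \sum_(xi <- s') sigma (a xi) xi = \sum_(xi <- s) sigma (a xi) xi.
Proof. by move=> us0 us' ss a0; apply: big_subseq_uniq => // xi /a0 ->; rewrite (hom0 cA hs). Qed.

Let hull_subspace : subspace hull.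
Proof.
split.
  exists [::], (fun=> 0); split=> //; last by rewrite big_nil.
  by move=> _; exact: (subspace0 sA).
move=> c x y [s [a [us0 os Aa a0 ->]]] [s' [b [us' os' Ab b0 ->]]].
have uu := undup_uniq (s ++ s').
have s1 : {subset s <= undup (s ++ s')} by move=> z zs; rewrite mem_undup mem_cat zs.
have s2 : {subset s' <= undup (s ++ s')} by move=> z zs; rewrite mem_undup mem_cat zs orbT.
exists (undup (s ++ s')), (fun xi => c *: a xi + b xi); split=> //.
- by move=> xi; rewrite mem_undup mem_cat => /orP[/os|/os'].
- by move=> xi; exact: sA.2.
- by move=> xi; rewrite mem_undup mem_cat negb_or => /andP[/a0 -> /b0 ->]; rewrite scaler0 addr0.
rewrite -(hull_widen us0 uu s1 a0) -(hull_widen us' uu s2 b0) scaler_sumr -big_split.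
by apply: eq_bigr => xi _; rewrite (hom_lin hs).
Qed.

Let hull_invariant a x : A a -> hull x -> hull (sigma a x).
Proof.
move=> Aa [s [b [us0 os Ab b0 ->]]]; exists s, (fun xi => a \o b xi); split=> //.
- by move=> xi; exact: (cstar_comp cA).
- move=> xi /b0 ->; apply/funext => v; exact: (lin0 (bop_lin (cstar_bop cA Aa))).
rewrite (lin_sum (bop_lin (bs Aa))); apply: eq_bigr => xi _.
by rewrite (hom_comp hs).
Qed.

Let sum_orth s (F G : U -> L -> L) : uniq s -> (forall xi, xi \in s -> Xi xi) ->
  (forall xi, A (F xi)) -> (forall xi, A (G xi)) ->
  '[\sum_(xi <- s) sigma (F xi) xi, \sum_(xi <- s) sigma (G xi) xi] =
  \sum_(xi <- s) '[sigma (F xi) xi, sigma (G xi) xi].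
Proof.
move=> us0 Xs AF AG; rewrite inner_suml big_seq [RHS]big_seq; apply: eq_bigr => xi xs.
rewrite inner_sumr (bigD1_seq xi) //= big_seq_cond big1 ?addr0 // => eta /andP[es /eqP ne].
by apply: Xi_orth => //; [exact: Xs|exact: Xs|move=> E; apply: ne].
Qed.

(** The form splits along the orthogonal cyclic subspaces. On that of [xi] it is the state of [xi]
    at one algebra element, and this state is also a vector state of [theta]. *)
Let hull_pos (I : finType) (B : I -> I -> L -> L) x : (forall i j, A (B i j)) ->
  repos (fun i j => theta (B i j)) -> (forall i, hull (x i)) ->
  0 <= Re (opform (fun i j => sigma (B i j)) x).
Proof.
move=> AB pB hx.
have /choice[s sP] i : exists s, exists a, [/\ uniq s, forall xi, xi \in s -> occurs xi,
  forall xi, A (a xi), forall xi, xi \notin s -> a xi = 0 &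
  x i = \sum_(xi <- s) sigma (a xi) xi] by exact: hx.
have /choice[a aP] := sP.
pose t := undup (flatten [seq s i | i <- enum I]).
have st i : {subset s i <= t}.
  move=> xi xs; rewrite mem_undup; apply/flattenP; exists (s i) => //.
  by apply/mapP; exists i; rewrite ?mem_enum.
have ot xi : xi \in t -> occurs xi.
  rewrite mem_undup => /flattenP[_ /mapP[i _ ->] xs].
  by have [_ os _ _ _] := aP i; exact: os.
have Aa i xi : A (a i xi) by have [_ _ Aa _ _] := aP i.
have ut : uniq t := undup_uniq _.
have xE i : x i = \sum_(xi <- t) sigma (a i xi) xi.
  by have [us0 _ _ a0 ->] := aP i; rewrite (hull_widen us0 ut (@st i) a0).
have -> : opform (fun i j => sigma (B i j)) x =
    \sum_(xi <- t) opform (fun i j => sigma (B i j)) (fun i => sigma (a i xi) xi).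
  rewrite exchange_big; apply: eq_bigr => i _.
  rewrite exchange_big; apply: eq_bigr => j _.
  rewrite (xE j) (xE i) (lin_sum (bop_lin (bs (AB i j)))).
  have cE xi : sigma (B i j) (sigma (a j xi) xi) = sigma (B i j \o a j xi) xi.
    by rewrite (hom_comp hs (AB i j) (Aa j xi)).
  rewrite (eq_bigr _ (fun xi _ => cE xi)) [RHS](eq_bigr _ (fun xi _ => congr1 (inner^~ _) (cE xi))).
  apply: sum_orth => // [xi /ot[]//|xi].
  exact: (cstar_comp cA).
rewrite Re_sum big_seq; apply: sumr_ge0 => xi /ot[_ [y yP]].
rewrite (opform_hom cA hs) // yP.
  by rewrite -(opform_hom cA ht) //; exact: pB.
do 2!apply: (subspace_sum sA) => ? _.
by apply: (cstar_comp cA (cstar_adj cA _)) => //; exact: (cstar_comp cA).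
Qed.

(** By [repos_cyclic] one vector [z] suffices; after normalisation its vector state is realised by
    some [xi] in [Xi], whose cyclic subspace lies in the hull. *)
Let theta_pos (I : finType) (B : I -> I -> L -> L) : (forall i j, A (B i j)) ->
  (forall x, (forall i, hull (x i)) -> 0 <= Re (opform (fun i j => sigma (B i j)) x)) ->
  repos (fun i j => theta (B i j)).
Proof.
move=> AB pB; apply: (repos_cyclic (hom_image_star_algebra cA ht)) => [i j|z b hb].
  by exists (B i j).
have /choice[b' bP] i : exists f, A f /\ theta f = b i.
  by have [f Af <-] := hb i; exists f.
have Ab i := (bP i).1.
have -> : (fun i => b i z) = (fun i => theta (b' i) z).
  by apply/funext => i; rewrite (bP i).2.
rewrite (opform_hom cA ht) //; set c := (X in theta X).
have Ac : A c.
  do 2!apply: (subspace_sum sA) => ? _.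
  by apply: (cstar_comp cA (cstar_adj cA _)) => //; exact: (cstar_comp cA).
have [->|z0] := eqVneq z 0; first by rewrite inner0r.
have nz : nm z != 0 by apply: contra z0 => /eqP/nm_eq0 ->.
pose y := (nm z)^-1%:rc *: z.
have zE : z = (nm z)%:rc *: y by rewrite scalerA -rcM divff // rc1 scale1r.
have y1 : nm y = 1 by rewrite nmZ cabs_real ger0_norm ?invr_ge0 ?nm_ge0 // mulVf.
have [xi [Xxi xiP]] := Xi_state (vector_state y1).
have oxi : occurs xi by split=> //; exists y => d Ad; rewrite xiP.
have -> : '[theta c z, z] = ((nm z) ^+ 2)%:rc * '[sigma c xi, xi].
  rewrite {1 2}zE (linZ (bop_lin (bt Ac))) innerZl innerZr -xiP // cj_rc mulrA -rcM.
  by rewrite expr2.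
rewrite ReZ; apply: mulr_ge0; first exact: sqr_ge0.
rewrite -(opform_hom cA hs) //; apply: pB => i.
exists [:: xi], (fun eta => if eta == xi then b' i else 0); split=> //.
- by move=> eta; rewrite inE => /eqP ->.
- by move=> eta; case: eqP => // _; exact: (subspace0 sA).
- by move=> eta; rewrite inE => /negbTE ->.
by rewrite big_seq1 eqxx.
Qed.

(** Projects onto the closure of the hull. Invariance under both [sigma a] and [sigma (adj a)]
    yields commutation, and by density positivity is decided on the hull. *)
Lemma projection_of_vectors : exists p : projection U,
  (forall a, A a -> p \o sigma a = sigma a \o p) /\
  forall (I : finType) (B : I -> I -> L -> L), (forall i j, A (B i j)) ->
    repos (fun i j => corner p (sigma (B i j))) <-> repos (fun i j => theta (B i j)).
Proof.
have sc := sclosure_subspace hull_subspace.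
have [p [pE pid]] := projection_exists sc (sclosure_closed (E := hull)).
set E := mkset _ in sc pE pid.
have Einv a x : A a -> E x -> E (sigma a x).
  by move=> Aa Ex; apply: (sclosure_image (bs Aa) _ Ex) => y; exact: hull_invariant.
exists p; split=> [a Aa|I B AB].
  have psp b x : A b -> p (sigma b (p x)) = sigma b (p x) by move=> Ab; apply: pid; exact: Einv.
  apply/funext => x; apply: inner_extl => y /=.
  rewrite proj_selfadj (adjP (bs Aa)) -(hom_adj hs Aa) -psp; last exact: (cstar_adj cA).
  rewrite -proj_selfadj (hom_adj hs Aa) -(adjP (bs Aa)) -proj_selfadj psp //.
split=> [pB|pB x].
  apply: theta_pos => // x hx; have := pB (fun i => pproj p (x i)).
  rewrite opform_corner; congr (0 <= Re (opform _ _)).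
  apply/funext => i; apply: pid => e e0; exists (x i) => //.
  by rewrite subrr nm0 ltW.
rewrite opform_corner; apply: (repos_dense (E := hull)) => [i j|y hy|i].
- exact: bs.
- exact: hull_pos.
by rewrite -prange_id; exact: pE.
Qed.

End Vectors.

Theorem projection_of_hom : exists p : projection U,
  (forall a, A a -> p \o sigma a = sigma a \o p) /\
  forall (I : finType) (B : I -> I -> L -> L), (forall i j, A (B i j)) ->
    repos (fun i j => corner p (sigma (B i j))) <-> repos (fun i j => theta (B i j)).
Proof.
have [_ [Xi [_ Xex Xor _]]] := us; apply: (projection_of_vectors Xor) => f /Xex[xi [? _]].
by exists xi.
Qed.

End ProjectionOfHom.
End Compressions.

Arguments corner {R U} p f.

Section DeltaEnv.
Context {R : realType}.
Implicit Types H K L U Y Z : hilbertType R.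

Lemma hom_compose H K Z (A : set (H -> H)) (B : set (K -> K)) kappa (theta : (K -> K) -> (Z -> Z)) :
  unital_cstar_subalgebra A -> unital_star_hom A kappa -> (forall f, A f -> B (kappa f)) ->
  unital_star_hom B theta -> unital_star_hom A (theta \o kappa).
Proof.
move=> cA hk AB ht; split=> [f Af|a f g Af Ag||f g Af Ag|f Af] /=.
- by apply: (hom_bop ht); exact: AB.
- by rewrite (hom_lin hk) // (hom_lin ht) //; exact: AB.
- by rewrite (hom_id hk) (hom_id ht).
- by rewrite (hom_comp hk) // (hom_comp ht) //; exact: AB.
by rewrite (hom_adj hk) // (hom_adj ht) //; exact: AB.
Qed.

(* The second embedding and the identity of X have a common cover; the TRO is induced
   along the homomorphism leading to it. *)
Lemma delta_equivalent_hom H K (S : set (H -> H)) (X : set (K -> K)) :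
  operator_system S -> operator_system X -> delta_equivalent S X ->
  exists Y Z (phi : (H -> H) -> (Y -> Y)) (tau : (K -> K) -> (Z -> Z)) M,
    [/\ ucoe S phi, unital_star_hom (cstar_generated X) tau &
        tro_relates M (phi @` S) (tau @` X)].
Proof.
move=> oS oX [K1 [K2 [phi [psi [uphi upsi [M rM]]]]]].
(* [true] stands for the identity embedding of [X] and [false] for [psi]. *)
pose fam (b : bool) : {Hb : hilbertType R & (K -> K) -> (Hb -> Hb)} :=
  if b then existT (fun Hb : hilbertType R => (K -> K) -> (Hb -> Hb)) K id
  else existT (fun Hb : hilbertType R => (K -> K) -> (Hb -> Hb)) K2 psi.
have ufam b : ucoe X (projT2 (fam b)) by case: b => //=; exact: ucoe_id.
have [Z [chi [uchi hom]]] := common_cover oX ufam.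
have [tau ht tE] := hom true; have [kappa hk kE] := hom false.
rewrite /= image_id in ht tE hk kE.
have oP := ucoe_image_opsys oX upsi; have oQ := ucoe_image_opsys oS uphi.
(* The TRO is reversed because [kappa] is given on the side of [X] and has to be induced to the side
   of [S]. *)
have [Y [theta [M' [hth rM' rf]]]] := induction oP oQ (tro_adj rM) hk.
exists Y, Z, (theta \o phi), tau, [set adj a | a in M']; split=> //.
  have sub s : S s -> cstar_generated (phi @` S) (phi s).
    by move=> Ss; apply: sub_generated; exists s.
  have [bphi lphi phi1 _] := uphi; apply: (ucoe_intro oS).
  - by move=> f Sf; apply: (hom_bop hth); exact: sub.
  - by move=> a f g Sf Sg /=; rewrite lphi // (hom_lin hth) //; exact: sub.
  - by rewrite /= phi1 (hom_id hth).
  move=> n A SA; split=> [pA|].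
    apply: (hom_repos (generated_cstar (opsys_bop oQ)) hth) => [i j|]; first exact: sub.
    exact/(ucoe_repos oS uphi SA).
  (* [kappa] reflects the order on the image of [psi], since [kappa (psi x) = chi x] there and [chi]
     is an order embedding; [rf] then says the same of [theta], so [theta \o phi] stays an order
     embedding. *)
  move=> /rf pA; apply/(ucoe_repos oS uphi SA); apply: pA => [I B PB pB|i j]; last by exists (A i j).
  have /choice[x xP] (ij : I * I) : exists t, X t /\ psi t = B ij.1 ij.2.
    by have [t Xt E] := PB ij.1 ij.2; exists t.
  have Xx i j : X (x (i, j)) by case: (xP (i, j)).
  have BE : B = fun i j => psi (x (i, j)).
    by apply/funext => i; apply/funext => j; case: (xP (i, j)).
  rewrite BE in pB *; apply/(ucoe_repos oX upsi Xx); apply/(ucoe_repos oX uchi Xx).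
  suff -> : (fun i j => chi (x (i, j))) = (fun i j => kappa (psi (x (i, j)))) by [].
  by apply/funext => i; apply/funext => j; rewrite kE.
suff E : kappa @` (psi @` X) = tau @` X by rewrite -image_comp -E; exact: tro_adj.
by rewrite image_comp; apply: eq_imagel => t Xt /=; rewrite kE // tE.
Qed.

(** As [p] commutes with the generators it commutes with the whole represented algebra, so
    compression to its range is multiplicative. *)
Lemma embeds_hom H K (S : set (H -> H)) (T : set (K -> K)) : operator_system T ->
  delta_env_embeds S T -> exists L U iota (sigma : (L -> L) -> (U -> U)),
    [/\ cstar_envelope T iota, universal_rep (cstar_generated (iota @` T)) sigma &
      exists Y (rho : (L -> L) -> (Y -> Y)),
        unital_star_hom (cstar_generated (iota @` T)) rho /\
        delta_equivalent S (rho @` (iota @` T))].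
Proof.
move=> oT [L [U [iota [sigma [env us [p [[_ pc] eq]]]]]]].
exists L, U, iota, sigma; split=> //.
have oI := ucoe_image_opsys oT env.1; have [hs _] := us.
exists (prange p), (fun a => corner p (sigma a)); split.
  apply: corner_hom => //; apply: (commuting_generated oI hs) => _ [t Tt <-].
  by apply: pc; exists t.
rewrite /compression -(image_comp iota) image_comp in eq; exact: eq.
Qed.

(** The embedding [psi] of the image of [rho] is moved to the compression by choosing preimages.
    That [rho] and the compression have the same matrix order makes this well defined and a complete
    order embedding. *)
Lemma hom_embeds H K L U Y (S : set (H -> H)) (T : set (K -> K))
    iota (sigma : (L -> L) -> (U -> U)) (rho : (L -> L) -> (Y -> Y)) :
  operator_system T -> cstar_envelope T iota ->
  universal_rep (cstar_generated (iota @` T)) sigma ->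
  unital_star_hom (cstar_generated (iota @` T)) rho ->
  delta_equivalent S (rho @` (iota @` T)) -> delta_env_embeds S T.
Proof.
move=> oT env us hr [H' [K' [phi [psi [uphi upsi eq]]]]].
have oI := ucoe_image_opsys oT env.1; have [hs _] := us.
have cA := generated_cstar (opsys_bop oI); have sub := @sub_generated _ _ (iota @` T).
have [p [pc pP]] := projection_of_hom cA us hr.
exists L, U, iota, sigma; split=> //; exists p; split.
  by split=> [|_ [t Tt <-]]; [exact: proj_bop|apply: pc; apply: sub; exists t].
have hp := corner_hom hs pc; have oX := hom_opsys oI hr; have oX' := hom_opsys oI hp.
set W := iota @` T in oI cA sub hr upsi eq pc pP hp oX oX'.
have WA w : W w -> cstar_generated W w := @sub w.
have -> : compression (p := p) ((sigma \o iota) @` T) = (fun a => corner p (sigma a)) @` W.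
  by rewrite /compression -(image_comp iota) image_comp.
(* If the compression kills a difference, all scalar multiples of the difference are positive there,
   hence also under [rho], which makes its image 0. *)
have inj a b : W a -> W b -> corner p (sigma a) = corner p (sigma b) -> rho a = rho b.
  move=> /WA Ga /WA Gb E; apply/eqP; rewrite -subr_eq0 -(homB cA hr Ga Gb); apply/eqP.
  have Ad : cstar_generated W (a - b) by exact: (subspaceB (cstar_subspace cA)).
  apply: repos_scale_eq0 => [|c]; first exact/bop_lin/(hom_bop hr).
  rewrite -(homZ cA hr) //.
  apply: (pP _ (fun _ _ => c *: (a - b)) (fun _ _ => subspaceZ (cstar_subspace cA) c Ad)).1 => y.
  rewrite /opform !big_ord1 (homZ cA hp c Ad) (homB cA hp Ga Gb) E subrr scaler0.
  by rewrite inner0l.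
pose lift f := xget 0 [set w | W w /\ corner p (sigma w) = f].
have liftP w : W w -> W (lift (corner p (sigma w))) /\ rho (lift (corner p (sigma w))) = rho w.
  move=> Ww; rewrite /lift; case: xgetP => [w' _ [Ww' E]|/(_ w)[]//].
  by split=> //; exact: inj.
have [bpsi lpsi psi1 _] := upsi.
have rX w : W w -> (rho @` W) (rho w) by move=> Ww; exists w.
have psiE : (psi \o rho \o lift) @` ((fun a => corner p (sigma a)) @` W) = psi @` (rho @` W).
  rewrite (image_comp rho psi) (image_comp _ (psi \o rho \o lift)).
  apply: eq_imagel => w Ww /=.
  by rewrite (liftP _ Ww).2.
exists H', K', phi, (psi \o rho \o lift); split=> //; last by rewrite psiE.
apply: (ucoe_intro oX') => //.
- by move=> _ [w Ww <-] /=; rewrite (liftP _ Ww).2; apply: bpsi; exact: rX.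
- move=> a _ _ [w Ww <-] [v Wv <-] /=.
  have Wd : W (a *: w + v) by exact: (opsys_subspace oI).2.
  rewrite -(hom_lin hp _ (WA _ Ww) (WA _ Wv)) (liftP _ Wd).2 (liftP _ Ww).2 (liftP _ Wv).2.
  by rewrite (hom_lin hr _ (WA _ Ww) (WA _ Wv)) lpsi //; exact: rX.
- have W1 := opsys_id oI.
  by have := (liftP _ W1).2; rewrite (hom_id hs) corner_id /= => ->; rewrite (hom_id hr).
move=> n A XA.
have /choice[w wP] (ij : 'I_n * 'I_n) : exists t, W t /\ corner p (sigma t) = A ij.1 ij.2.
  by have [t Wt E] := XA ij.1 ij.2; exists t.
have Ww i j : W (w (i, j)) by case: (wP (i, j)).
have -> : A = fun i j => corner p (sigma (w (i, j))).
  by apply/funext => i; apply/funext => j; case: (wP (i, j)).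
have -> : (fun i j => (psi \o rho \o lift) (corner p (sigma (w (i, j))))) =
    (fun i j => psi (rho (w (i, j)))).
  by apply/funext => i; apply/funext => j /=; rewrite (liftP _ (Ww i j)).2.
apply: (iff_trans (pP _ _ (fun i j => WA _ (Ww i j)))).
by apply: (ucoe_repos oX upsi) => i j; exact: rX.
Qed.

End DeltaEnv.

Theorem corollary8p4 (R : realType) (H1 H2 H3 : hilbertType R)
    (S1 : set (H1 -> H1)) (S2 : set (H2 -> H2)) (S3 : set (H3 -> H3))
    (hS1 : operator_system S1) (hS2 : operator_system S2)
    (hS3 : operator_system S3) :
  delta_env_embeds S1 S2 -> delta_env_embeds S2 S3 -> delta_env_embeds S1 S3.
Proof.
move=> /(embeds_hom hS2)[L1 [U1 [iota1 [_ [env1 _ [Y1 [rho1 [h1 eq1]]]]]]]].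
move=> /(embeds_hom hS3)[L2 [U2 [iota2 [sigma2 [env2 us2 [Y2 [rho2 [h2 eq2]]]]]]]].
have o1 := ucoe_image_opsys hS2 env1.1; have o2 := ucoe_image_opsys hS3 env2.1.
have c1 := generated_cstar (opsys_bop o1); have c2 := generated_cstar (opsys_bop o2).
have oX1 := hom_opsys o1 h1; have oX2 := hom_opsys o2 h2.
have [Z1 [Z1' [phi1 [tau1 [N [u1 ht1 rN]]]]]] := delta_equivalent_hom hS1 oX1 eq1.
have [Z2 [Z2' [phi2 [tau2 [M [u2 ht2 rM]]]]]] := delta_equivalent_hom hS2 oX2 eq2.
have oP := ucoe_image_opsys hS2 u2; have cP := generated_cstar (opsys_bop oP).
have [pi [hpi piE pit]] := env1.2 _ _ u2.
(* By [piE] the values of [pi] lie in the domain of [rho1]. On [phi2 s] with [s] in [S2] the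
   composite is [tau1 (rho1 (iota1 s))], so the induced relation starts where the one with [phi1]
   ends. *)
have hk : unital_star_hom (cstar_generated (phi2 @` S2)) (tau1 \o (rho1 \o pi)).
  apply: (hom_compose cP _ _ ht1) => [|f Pf].
    by apply: (hom_compose cP hpi _ h1) => f Pf; rewrite -piE; exists f.
  by apply: (hom_generated o1 h1); rewrite -piE; exists f.
have [Y [theta [M' [hth rM' _]]]] := induction oP (hom_opsys oX2 ht2) rM hk.
have hT : unital_star_hom (cstar_generated (iota2 @` S3)) (theta \o (tau2 \o rho2)).
  apply: (hom_compose c2 _ _ hth) => [|f Cf].
    by apply: (hom_compose c2 h2 _ ht2); exact: (hom_generated o2 h2).
  by apply: (hom_generated oX2 ht2); exact: (hom_generated o2 h2).
apply: (hom_embeds hS3 env2 us2 hT).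
have oT := hom_opsys o2 hT.
have E1 : (tau1 \o (rho1 \o pi)) @` (phi2 @` S2) = tau1 @` (rho1 @` (iota1 @` S2)).
  by rewrite !image_comp; apply: eq_imagel => s Ss /=; rewrite pit.
have E2 : theta @` (tau2 @` (rho2 @` (iota2 @` S3))) = (theta \o (tau2 \o rho2)) @` (iota2 @` S3).
  by rewrite !image_comp.
rewrite E1 E2 in rM'.
(* The right-hand system is already the concrete image of [iota2] under the composed homomorphism,
   so the identity embeds it. *)
exists Z1, Y, phi1, id; split=> //; first exact: ucoe_id.
rewrite image_id; eexists.
exact: (tro_compose (ucoe_image_opsys hS1 u1) (hom_opsys oX1 ht1) oT rN rM').
Qed.
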